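(* In the setting described in the context, for every $1<p\le2$ there is a constant $C_p>0$, depending only on $p$, such that for every $f\in L^p(m)$ $$\|\widetilde G\|_p\le C_p\|f\|_p .$$
   Context: Setting. $E$ is a locally compact separable metric space with Borel $\sigma$-algebra $\mathcal B(E)$, and $m$ is a Radon measure on $E$ with $\operatorname{supp} m=E$. $L^p(m)$ is the real $L^p$-space with norm $\|\cdot\|_p$. Let $d=\{(x,y)\in E\times E: x=y\}$. $(\mathcal E,\mathcal D(\mathcal E))$ is a regular (symmetric) Dirichlet form on $L^2(m)$ which is pure-jump: there is a symmetric jumping measure $J$ on $E\times E\setminus d$ such that $$\mathcal E(u,v)=\tfrac12\iint_{E\times E\setminus d}(u(y)-u(x))(v(y)-v(x))\,J(dx,dy)$$ for all $u,v\in\mathcal D(\mathcal E)$ (taken in quasi-continuous versions). It is assumed that $J$ is given by a kernel: $J(dx,dy)=J(x,dy)\,m(dx)$. $X=(X_t)$ is the associated $m$-symmetric Hunt process, with laws $\mathbb P_x$, expectations $\mathbb E_x$ and cemetery $\Delta$. Its semigroup $P_tg(x)=\mathbb E_x g(X_t)$ (with $g(\Delta)=0$) extends to a semigroup of sub-Markovian contractions on $L^p(m)$, $1\le p\le\infty$, strongly continuous for $1\le p<\infty$ and symmetric on $L^2(m)$. Square function. Let $\chi(s,t)=1$ if $|s|>|t|$, $\chi(s,t)=\tfrac12$ if $|s|=|t|$, $\chi(s,t)=0$ if $|s|<|t|$. For $f\in L^p(m)$, $1<p<\infty$, $$\widetilde G(x)=\Big(\int_0^\infty\int_{E\setminus\{x\}}(P_tf(y)-P_tf(x))^2\,\chi(P_tf(x),P_tf(y))\,J(x,dy)\,dt\Big)^{1/2}\in[0,\infty].$$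 *)

(* Defs.v *)
From HB Require Import structures.
From mathcomp Require Import all_boot all_order all_algebra.
From mathcomp Require Import all_classical all_reals all_analysis measurable_realfun.

Set Implicit Arguments.
Unset Strict Implicit.
Unset Printing Implicit Defensive.
Import Order.TTheory GRing.Theory Num.Theory.
Import numFieldNormedType.Exports.

Local Open Scope classical_set_scope.
Local Open Scope ring_scope.

(* The library's measurable types are pointed, so metric spaces are taken
   pointed (i.e. nonempty) as well; the base point plays no other role. *)
#[short(type="pmetricType")]
HB.structure Definition PMetric (K : numDomainType) :=
  {M of Metric K M & Pointed M}.

Notation borel T := (g_sigma_algebraType (@open T)).

(* The state space with the cemetery adjoined: the point [None] is at infinity,
   and it is isolated when E is compact. *)
Notation cemetery E := (one_point_compactification E).

Definition separable (T : topologicalType) : Prop :=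
  exists2 S : set T, countable S & dense S.

Section Topology.
Context {R : realType} {E : pmetricType R}.
Implicit Types (m : {measure set (borel E) -> \bar R}).

Definition radon m : Prop := [/\
  forall A : set E, compact A -> (m A < +oo)%E,
  forall A : set (borel E), measurable A ->
    m A = ereal_inf [set m U | U in [set U : set E | open U /\ A `<=` U]] &
  forall U : set E, open U ->
    m U = ereal_sup [set m A | A in [set A : set E | compact A /\ A `<=` U]]].

Definition full_support m : Prop :=
  forall U : set E, open U -> U !=set0 -> (0 < m U)%E.

Definition Cc : set (E -> R) :=
  [set u | continuous u /\ compact (closure [set x | u x != 0])].

End Topology.

(* A form on L^2(m) is given on Borel representatives: [D] is the set of all
   representatives of the elements of the domain. *)
Section DirichletForm.
Context {R : realType} {E : pmetricType R}.
Variables (m : {measure set (borel E) -> \bar R}).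
Variables (D : set (borel E -> R)) (Ef : (borel E -> R) -> (borel E -> R) -> R).

Definition l2dot (u v : borel E -> R) : R := \int[m]_x (u x * v x).

Definition E1 (u v : borel E -> R) : R := Ef u v + l2dot u v.

Record dirichlet_form : Prop := {
  form_L2 : forall u, D u -> u \in Lfun m 2%:E ;
  form_ae : forall u u', D u -> u' \in Lfun m 2%:E ->
    {ae m, forall x, u x = u' x} -> D u' /\ forall v, D v -> Ef u v = Ef u' v ;
  form_D0 : D (fun=> 0) ;
  form_Dlin : forall (a : R) u v, D u -> D v -> D (fun x => a * u x + v x) ;
  form_dense : forall f, f \in Lfun m 2%:E -> forall e : R, 0 < e ->
    exists2 u, D u & ('N[m]_2%:E[EFin \o (fun x => f x - u x)%R] < e%:E)%E ;
  form_sym : forall u v, D u -> D v -> Ef u v = Ef v u ;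
  form_lin : forall (a : R) u v w, D u -> D v -> D w ->
    Ef (fun x => a * u x + v x) w = a * Ef u w + Ef v w ;
  form_ge0 : forall u, D u -> 0 <= Ef u u ;
  form_closed : forall u_ : nat -> borel E -> R, (forall n, D (u_ n)) ->
    (forall e : R, 0 < e -> exists N : nat, forall i j : nat,
      (N <= i)%N -> (N <= j)%N ->
      E1 (fun x => u_ i x - u_ j x) (fun x => u_ i x - u_ j x) < e) ->
    exists2 u, D u &
      E1 (fun x => u_ n x - u x) (fun x => u_ n x - u x) @[n --> \oo] --> 0 ;
  form_markov : forall u, D u ->
    let v x := Num.min (Num.max (u x) 0) 1 in D v /\ Ef v v <= Ef u u }.

Record regular_form : Prop := {
  regular_E1 : forall u, D u -> forall e : R, 0 < e ->
    exists2 v, D v /\ Cc v & E1 (fun x => u x - v x) (fun x => u x - v x) < e ;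
  regular_unif : forall u, Cc u -> forall e : R, 0 < e ->
    exists2 v, D v /\ Cc v & forall x, `|u x - v x| < e }.

Definition open_capacity (G : set E) : \bar R :=
  ereal_inf [set (E1 u u)%:E |
    u in [set u | D u /\ {ae m, forall x : E, G x -> 1 <= u x}]].

Definition quasi_continuous (u : E -> R) : Prop :=
  forall e : R, 0 < e -> exists G : set E,
    [/\ open G, (open_capacity G < e%:E)%E & {within ~` G, continuous u}].

End DirichletForm.

Section Jumps.
Context {R : realType} {E : pmetricType R}.
Implicit Types (J : {measure set (borel E * borel E) -> \bar R}).

Definition diagE : set (borel E * borel E) := [set z | z.1 = z.2].

(* A measure on E x E \ d is represented by a measure on E x E of which only
   the values on sets disjoint from d are used. *)
Definition jumping_measure J : Prop :=
  (forall C : set (borel E * borel E), measurable C -> C `<=` ~` diagE ->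
     J [set z | C (z.2, z.1)] = J C) /\
  (forall C : set (E * E), compact C -> C `<=` ~` diagE -> (J C < +oo)%E).

(* J(dx,dy) = K(x,dy) m(dx) *)
Definition has_kernel (m : {measure set (borel E) -> \bar R}) J
    (K : R.-ker (borel E) ~> (borel E)) : Prop :=
  forall C : set (borel E * borel E), measurable C -> C `<=` ~` diagE ->
    J C = (\int[m]_x K x (xsection C x))%E.

Definition pure_jump (m : {measure set (borel E) -> \bar R})
    (D : set (borel E -> R)) (Ef : (borel E -> R) -> (borel E -> R) -> R) J
    : Prop :=
  forall u v, D u -> D v ->
    quasi_continuous m D Ef u -> quasi_continuous m D Ef v ->
    (Ef u v)%:E = ((2^-1)%:E * \int[J]_(z in ~` diagE)
      ((u z.2 - u z.1) * (v z.2 - v z.1))%:E)%E.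

End Jumps.

Section HuntProcess.
Context {R : realType} {E : pmetricType R} {d : measure_display}
  {Omega : measurableType d}.

Variables (P : cemetery E -> probability Omega R)
  (X : R -> Omega -> cemetery E).

Record right_continuous_filtration (M : R -> set (set Omega)) : Prop := {
  filtration_sigma : forall t, 0 <= t -> sigma_algebra [set: Omega] (M t) ;
  filtration_sub : forall t, 0 <= t -> M t `<=` measurable ;
  filtration_mono : forall s t, 0 <= s -> s <= t -> M s `<=` M t ;
  filtration_right : forall t, 0 <= t -> M t = \bigcap_(s in `]t, +oo[) M s }.

Definition adapted (M : R -> set (set Omega)) : Prop :=
  forall t (B : set (borel (cemetery E))), 0 <= t -> measurable B ->
    M t (X t @^-1` B).

Definition stopping_time (M : R -> set (set Omega)) (sigma : Omega -> \bar R)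
    : Prop :=
  (forall w, (0 <= sigma w)%E) /\
  forall t, 0 <= t -> M t [set w | (sigma w <= t%:E)%E].

Definition stopped_events (M : R -> set (set Omega)) (sigma : Omega -> \bar R)
    : set (set Omega) :=
  [set A | measurable A /\
    forall t, 0 <= t -> M t (A `&` [set w | (sigma w <= t%:E)%E])].

(* P_x(X_{sigma+s} in B | M_sigma) = P_{X_sigma}(X_s in B), P_x-a.s.  On
   {sigma = +oo} this is trivial since X_{+oo} is the cemetery; and it holds
   for every initial law as soon as it holds for every starting point. *)
Definition strong_markov (M : R -> set (set Omega)) : Prop :=
  forall (x : cemetery E) (sigma : Omega -> \bar R) (A : set Omega)
      (B : set (borel (cemetery E))) (s : R),
    stopping_time M sigma -> stopped_events M sigma A -> measurable B ->
    0 <= s ->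
    let A' := A `&` [set w | (sigma w < +oo)%E] in
    P x (A' `&` [set w | B (X (fine (sigma w) + s) w)]) =
    (\int[P x]_(w in A') P (X (fine (sigma w)) w) [set w' | B (X s w')])%E.

Definition quasi_left_continuous (M : R -> set (set Omega)) : Prop :=
  forall (x : cemetery E) (sigma_ : nat -> Omega -> \bar R)
      (sigma : Omega -> \bar R),
    (forall n, stopping_time M (sigma_ n)) -> stopping_time M sigma ->
    (forall n w, (sigma_ n w <= sigma_ n.+1 w)%E) ->
    (forall w, sigma_ n w @[n --> \oo] --> sigma w) ->
    {ae P x, forall w, (sigma w < +oo)%E ->
      X (fine (sigma_ n w)) w @[n --> \oo] --> X (fine (sigma w)) w}.

Definition lifetime (w : Omega) : \bar R :=
  ereal_inf [set t%:E | t in [set t | 0 <= t /\ X t w = None]].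

(* Only times t >= 0 matter. *)
Record hunt_process : Prop := {
  hunt_measurable : forall t, 0 <= t ->
    measurable_fun [set: Omega] (X t : Omega -> borel (cemetery E)) ;
  hunt_kernel : forall t (B : set (borel (cemetery E))), 0 <= t ->
    measurable B ->
    measurable_fun [set: borel E]
      ((fun x => P (Some x) (X t @^-1` B)) : borel E -> \bar R) ;
  hunt_normal : forall x : E, P (Some x) [set w | X 0 w = Some x] = 1%E ;
  hunt_cemetery : forall t, 0 <= t -> P None [set w | X t w = None] = 1%E ;
  hunt_lifetime : forall w t, 0 <= t -> (lifetime w <= t%:E)%E -> X t w = None ;
  hunt_shift : exists theta : R -> Omega -> Omega,
    forall s t w, 0 <= s -> 0 <= t -> X s (theta t w) = X (s + t) w ;
  hunt_rcont : forall w t, 0 <= t -> X s w @[s --> t^'+] --> X t w ;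
  hunt_llim : forall w t, 0 < t ->
    exists y : cemetery E, X s w @[s --> t^'-] --> y ;
  hunt_strong : exists M : R -> set (set Omega),
    [/\ right_continuous_filtration M, adapted M, strong_markov M &
        quasi_left_continuous M] }.

Definition extend0 (g : E -> R) (z : cemetery E) : R :=
  if z is Some x then g x else 0.

(* P_t g (x) = E_x g(X_t); for g in L^p(m) the expectation exists for m-almost
   every x, and this is the extension of the semigroup to L^p(m). *)
Definition semigroup (t : R) (g : E -> R) (x : E) : R :=
  \int[P (Some x)]_w extend0 g (X t w).

Definition symmetric_process (m : {measure set (borel E) -> \bar R}) : Prop :=
  forall t (f g : borel E -> R), 0 <= t ->
    measurable_fun [set: borel E] f -> measurable_fun [set: borel E] g ->
    (forall x, 0 <= f x) -> (forall x, 0 <= g x) ->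
    (\int[m]_x ((f x)%:E * \int[P (Some x)]_w (extend0 g (X t w))%:E) =
     \int[m]_x ((g x)%:E * \int[P (Some x)]_w (extend0 f (X t w))%:E))%E.

(* (D, Ef) is the form of the semigroup:
   Ef(u, v) = lim_{t -> 0+} (u - P_t u, v) / t, on the set of those u in L^2(m)
   for which the limit with v = u is finite. *)
Definition associated (m : {measure set (borel E) -> \bar R})
    (D : set (borel E -> R)) (Ef : (borel E -> R) -> (borel E -> R) -> R)
    : Prop :=
  let approx t u v := t^-1 * l2dot m (fun x => u x - semigroup t u x) v in
  (forall u, u \in Lfun m 2%:E ->
     (D u <-> cvg (approx t u u @[t --> 0^'+]))) /\
  (forall u v, D u -> D v -> approx t u v @[t --> 0^'+] --> Ef u v).

Definition chi (s t : R) : R :=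
  if `|t| < `|s| then 1 else if `|s| == `|t| then 2^-1 else 0.

Definition square_function (K : R.-ker (borel E) ~> (borel E)) (f : E -> R)
    (x : borel E) : \bar R :=
  ((\int[lebesgue_measure]_(t in `[0%R, +oo[)
      \int[K x]_(y in ~` [set x])
        ((semigroup t f y - semigroup t f x) ^+ 2 *
         chi (semigroup t f x) (semigroup t f y))%:E) `^ 2^-1)%E.

End HuntProcess.

(* Main.v *)
Require Import Defs.
From HB Require Import structures.
From mathcomp Require Import all_boot all_order all_algebra.
From mathcomp Require Import all_classical all_reals all_analysis measurable_realfun.
From mathcomp Require Import ring lra.
Set Implicit Arguments.
Unset Strict Implicit.
Unset Printing Implicit Defensive.
Import Order.TTheory GRing.Theory Num.Theory.
Import numFieldNormedType.Exports.
Local Open Scope classical_set_scope.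
Local Open Scope ring_scope.

(* Write [P_t] for the semigroup and [u_t = P_t f].

   Dissipation.  For a convex [Phi] the derivative of [t |-> int Phi(u_t) dm]
   is [- E(u_t, Phi'(u_t))], at most minus half the integral of
   [(u_t(y) - u_t(x)) (Phi'(u_t(y)) - Phi'(u_t(x)))] against [J].  For
   [Phi(a) = |a|^p / p] this integrand dominates
   [(p - 1) (u_t(y) - u_t(x))^2 max(|u_t(x)|, |u_t(y)|)^(p - 2)]; hence the
   integral [I(x)] of the latter (without [p - 1]) over [y] and [t] satisfies
   [int I dm <= 2 / (p (p - 1)) int |f|^p dm].  Since [E] is only known as a
   limit of difference quotients, the derivative is replaced by the telescoping
   sums of the entropy, [Phi] by a smooth [Phi_e] with Lipschitz derivative, and
   [f] by bounded integrable truncations; Fatou's lemma removes these.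

   Square function.  Where [chi] does not vanish the maximum is [|u_t(x)|],
   which is at most [f*(x) = sup_t |u_t(x)|].  Thus the square of the square
   function is at most [f*^(2 - p) I], and its [p]-th power at most [f*^p + I].

   Maximal function.  [int f*^p dm <= C int |f|^p dm] is Stein's maximal theorem;
   along dyadic times it follows from Doob's inequality for a reversed
   martingale, which is carried out with iterates of the kernel [P_h] instead of
   a path space.

   The semigroup of the Hunt process is given by kernels that are measurable in
   time and space because the paths are right continuous; off the diagonal and
   outside an [m]-null set [J(x, dy)] is an s-finite kernel; and regularity
   extends [E(w, w) = 1/2 int int (w(y) - w(x))^2 J] from the continuous
   functions to all bounded integrable functions of the domain. *)

(** * Maximal inequality for the iterates of a symmetric kernel *)

(** The jump formula is assumed only for quasi-continuous functions, and no such version of [u_t] is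
    constructed. Regularity provides continuous [w_n] with [E1] error below [4 ^ (- n)], fast enough
    for the whole sequence to converge [m]-almost everywhere, hence [J]-almost everywhere in both
    variables.

    No spectral theorem is used either. The function [t |-> (u, P_t u)] is nonincreasing and
    midpoint convex; this alone puts [P_t u] into the domain for [t > 0], makes [(u - P_s u, u) / s]
    converge, and gives [|u - P_s u|^2 = o(s)], which is the second-order error in the decrement of
    the entropy.

    The condition [p <= 2] makes the exponent [p / 2 - 1] nonpositive, so that weights are smallest
    at the larger of two arguments. Instead of Hoelder's inequality, the last step uses
    [r = max(f*^p, I)]: then [f*^(2 - p) I <= r^(2 / p)], hence its power [p / 2] is at most
    [r <= f*^p + I]. The final constant is the [p]-th root of [maximal_cst p + 2 / (p (p - 1))].

    The square function is never shown to be measurable: it is compared with measurable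
    majorants. *)

Section Levels.
Context {R : realType}.
Implicit Types (p q e b r : R).

(** The terms grow geometrically with ratio [2 ^ q], so the sum is controlled by its last nonzero
    term, whose level lies below [b]. *)
Lemma level_sum_le e b q n : 0 < e -> 0 < q ->
  \sum_(j < n) (if e * 2 ^+ j < b then (e * 2 ^+ j) `^ q else 0) <=
  (2 `^ q / (2 `^ q - 1)) * b `^ q.
Proof.
move=> e0 q0.
have rho1 : 1 < 2 `^ q :> R.
  by rewrite -[ltLHS](congr1 (@^~ q) (powR1 R)) gt0_ltr_powR ?nnegrE ?ltr1n.
have step j : (e * 2 ^+ j.+1) `^ q = 2 `^ q * (e * 2 ^+ j) `^ q.
  by rewrite exprSr mulrA powRM ?mulr_ge0 ?exprn_ge0 ?ltW// mulrC.
have full k : \sum_(j < k) (e * 2 ^+ j) `^ q <= (e * 2 ^+ k) `^ q / (2 `^ q - 1).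
  elim: k => [|k IH]; first by rewrite big_ord0 divr_ge0 ?powR_ge0// subr_ge0 ltW.
  rewrite big_ord_recr/= (le_trans (lerD IH (lexx _)))// step.
  by rewrite le_eqVlt; apply/orP; left; apply/eqP; field; rewrite gt_eqF// subr_gt0.
elim: n => [|n IH].
  by rewrite big_ord0 mulr_ge0 ?powR_ge0// divr_ge0 ?powR_ge0// subr_ge0 ltW.
rewrite big_ord_recr/=; case: ifPn => [nb|_]; last by rewrite addr0.
have H : \sum_(j < n.+1) (if e * 2 ^+ j < b then (e * 2 ^+ j) `^ q else 0) <=
    (e * 2 ^+ n.+1) `^ q / (2 `^ q - 1).
  apply: le_trans (full n.+1); apply: ler_sum => j _.
  by case: ifP => // _; rewrite powR_ge0.
rewrite big_ord_recr/= nb in H; apply: le_trans H _.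
rewrite step mulrAC; apply: ler_wpM2l.
  by rewrite divr_ge0 ?powR_ge0// subr_ge0 ltW.
have en0 : 0 <= e * 2 ^+ n by rewrite mulr_ge0 ?exprn_ge0 ?ltW.
have b0 : 0 <= b by exact: ltW (le_lt_trans en0 nb).
by apply: ge0_ler_powR; rewrite ?nnegrE//; exact: ltW.
Qed.

(* Levels below [r] contribute at most [2 r]; above [r], one has
   [l <= l ^ p * r ^ (1 - p)].  The choice [r ^ p = sum] balances the two. *)
Lemma level_sum_powR e p n (g : nat -> R) : 0 < e -> 1 < p ->
  (forall j, 0 <= g j <= 1) ->
  (\sum_(j < n) e * 2 ^+ j * g j) `^ p <=
  3 `^ p * \sum_(j < n) (e * 2 ^+ j) `^ p * g j.
Proof.
move=> e0 p1 g01; set Y := \sum_(j < n) _ `^ p * _.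
have p0 : 0 < p by lra.
have l0 j : 0 < e * 2 ^+ j by rewrite mulr_gt0// exprn_gt0.
have Y0 : 0 <= Y.
  by apply: sumr_ge0 => j _; rewrite mulr_ge0 ?powR_ge0//; case/andP: (g01 j).
have [Yz|Ynz] := eqVneq Y 0.
  have gz (j : 'I_n) : g j = 0.
    have /eqP := Yz; rewrite psumr_eq0; last first.
      by move=> i _; rewrite mulr_ge0 ?powR_ge0//; case/andP: (g01 i).
    move=> /allP/(_ j (mem_index_enum _))/=.
    by rewrite mulf_eq0 gt_eqF ?powR_gt0//= => /eqP.
  rewrite big1 ?powR0 ?gt_eqF ?mulr_ge0 ?powR_ge0// => j _.
  by rewrite gz mulr0.
have Ygt : 0 < Y by rewrite lt_neqAle eq_sym Ynz.
pose r := Y `^ p^-1.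
have r0 : 0 < r by rewrite powR_gt0.
have rp : r `^ p = Y by rewrite -powRrM mulVf ?gt_eqF// powRr1.
rewrite -rp -powRM ?(ltW r0)//.
apply: ge0_ler_powR; rewrite ?nnegrE ?(ltW p0) ?mulr_ge0 ?(ltW r0)//.
  by apply: sumr_ge0 => j _; rewrite mulr_ge0 ?(ltW (l0 j))//; case/andP: (g01 j).
have H : \sum_(j < n) e * 2 ^+ j * g j <=
    \sum_(j < n) (if e * 2 ^+ j < r then (e * 2 ^+ j) `^ 1 else 0) +
    r `^ (1 - p) * Y.
  rewrite mulr_sumr -big_split/=; apply: ler_sum => j _.
  have /andP[g0 g1] := g01 j.
  case: ifPn => [jr|]; rewrite -?leNgt.
    rewrite powRr1 ?(ltW (l0 j))// -[leLHS]addr0 lerD ?mulr_ge0 ?powR_ge0//.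
    by rewrite ler_piMr// (ltW (l0 j)).
  move=> rj; rewrite add0r mulrA; apply: ler_wpM2r => //.
  rewrite [leLHS](_ : _ = (e * 2 ^+ j) `^ (1 - p) * (e * 2 ^+ j) `^ p); last first.
    by rewrite -powRD ?subrK ?powRr1 ?(ltW (l0 j))// gt_eqF ?l0// implybT.
  apply: ler_wpM2r; first exact: powR_ge0.
  rewrite -opprB !powRN lef_pV2 ?posrE ?powR_gt0//.
  by apply: ge0_ler_powR; rewrite ?nnegrE ?subr_ge0 ?(ltW r0) ?(ltW p1) ?(ltW (l0 j)).
apply: le_trans H _.
have -> : r `^ (1 - p) * Y = r.
  rewrite -rp -powRD ?subrK ?powRr1 ?(ltW r0)//.
  by apply/implyP => _; rewrite gt_eqF.
(* For exponent 1 the geometric constant is 2, so the levels below [r] add up to at most [2 r].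
   Together with the [r] coming from the levels above, this is the origin of the 3. *)
have := @level_sum_le e r 1 n e0 ltr01; rewrite (powRr1 (ltW r0)) powRr1//.
have -> : (2 : R) / (2 - 1) = 2 by rewrite [X in _ / X](_ : _ = 1) ?divr1//; lra.
by move=> ?; lra.
Qed.

End Levels.

(** * Nonnegative measurable functions and sub-Markov kernels *)

Section NonnegMeasurable.
Context {d : measure_display} {T : measurableType d} {R : realType}.
Implicit Types (f g : T -> \bar R).
Local Open Scope ereal_scope.

(** The value [+oo] is allowed: integrals of such functions add, scale and compare without any
    finiteness condition. *)
Definition nnm f : Prop := measurable_fun [set: T] f /\ forall x, 0 <= f x.

Lemma nnm_le_integral (mu : {measure set T -> \bar R}) f g : nnm f -> nnm g ->
  (forall x, f x <= g x) -> \int[mu]_x f x <= \int[mu]_x g x.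
Proof. by move=> [mf f0] [mg g0] fg; apply: ge0_le_integral. Qed.

Lemma nnm_integralD (mu : {measure set T -> \bar R}) f g : nnm f -> nnm g ->
  \int[mu]_x (f x + g x) = \int[mu]_x f x + \int[mu]_x g x.
Proof. by move=> [mf f0] [mg g0]; apply: ge0_integralD. Qed.

Lemma nnm_integralZl (mu : {measure set T -> \bar R}) f c : nnm f -> 0 <= c ->
  \int[mu]_x (c * f x) = c * \int[mu]_x f x.
Proof. by move=> [mf f0] c0; apply: ge0_integralZl. Qed.

Lemma nnm_cst c : 0 <= c -> nnm (fun=> c).
Proof. by move=> c0; split => //; exact: measurable_cst. Qed.

Lemma nnmD f g : nnm f -> nnm g -> nnm (fun x => f x + g x).
Proof.
move=> [mf f0] [mg g0]; split; first exact: emeasurable_funD.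
by move=> x; rewrite adde_ge0.
Qed.

Lemma nnmM f g : nnm f -> nnm g -> nnm (fun x => f x * g x).
Proof.
move=> [mf f0] [mg g0]; split; first exact: emeasurable_funM.
by move=> x; rewrite mule_ge0.
Qed.

Lemma nnm_if (b : T -> bool) f g : measurable_fun [set: T] b ->
  nnm f -> nnm g -> nnm (fun x => if b x then f x else g x).
Proof.
move=> mb [mf f0] [mg g0]; split; first exact: measurable_fun_ifT.
by move=> x; case: ifP.
Qed.

Lemma nnm_sum (I : Type) (s : seq I) (F : I -> T -> \bar R) :
  (forall i, nnm (F i)) -> nnm (fun x => \sum_(i <- s) F i x).
Proof.
move=> F0; split; first by apply: emeasurable_sum => i; exact: (F0 i).1.
by move=> x; apply: sume_ge0 => i _; exact: (F0 i).2.
Qed.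

Lemma nnm_integral_sum (mu : {measure set T -> \bar R}) (I : Type) (s : seq I)
    (F : I -> T -> \bar R) : (forall i, nnm (F i)) ->
  \int[mu]_x (\sum_(i <- s) F i x) = \sum_(i <- s) \int[mu]_x F i x.
Proof.
move=> F0; apply: ge0_integral_sum => //.
- by move=> i; exact: (F0 i).1.
- by move=> i x _; exact: (F0 i).2.
Qed.

Lemma nnm_poweR f (p : R) : nnm f -> nnm (fun x => f x `^ p).
Proof.
move=> [mf f0]; split; last by move=> x; exact: poweR_ge0.
exact: measurableT_comp (measurable_poweR p) mf.
Qed.

End NonnegMeasurable.

Section KernelOperator.
Context {d d' : measure_display} {X : measurableType d} {Y : measurableType d'}
  {R : realType}.
Variable S : X -> {measure set Y -> \bar R}.
Hypothesis mS : forall U, measurable U -> measurable_fun [set: X] (S ^~ U).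
Hypothesis S1 : forall x, (S x [set: Y] <= 1)%E.
Implicit Types (f g : Y -> \bar R).
Local Open Scope ereal_scope.

Definition kint (g : Y -> \bar R) (x : X) : \bar R := \int[S x]_y g y.

Lemma kint_nnm g : nnm g -> nnm (kint g).
Proof.
move=> [mg g0]; split; last by move=> x; exact: integral_ge0.
exact: measurable_fun_integral_kernel.
Qed.

Lemma kint_le f g : nnm f -> nnm g -> (forall x, f x <= g x) ->
  forall x, kint f x <= kint g x.
Proof. by move=> f0 g0 fg x; exact: nnm_le_integral. Qed.

Lemma kint_cst_le c : 0 <= c -> forall x, kint (fun=> c) x <= c.
Proof.
move=> c0 x; rewrite /kint integral_cst// -[leRHS]mule1.
by apply: lee_wpmul2l.
Qed.

Lemma kint_le_cst g c : nnm g -> 0 <= c -> (forall y, g y <= c) ->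
  forall x, kint g x <= c.
Proof.
move=> g0 c0 gc x; apply: le_trans (kint_cst_le c0 x).
by apply: kint_le => //; exact: nnm_cst.
Qed.

End KernelOperator.

(** * Weak-type inequality for the iterates of a symmetric kernel *)

Section DiscreteMaximal.
Context {d : measure_display} {T : measurableType d} {R : realType}.
Variable m : {measure set T -> \bar R}.
Variable S : T -> {measure set T -> \bar R}.
Hypothesis mS : forall U, measurable U -> measurable_fun [set: T] (S ^~ U).
Hypothesis S1 : forall x, (S x [set: T] <= 1)%E.
Local Open Scope ereal_scope.
Local Notation Q := (kint S).
Hypothesis symS : forall f g, nnm f -> nnm g ->
  \int[m]_x (f x * Q g x) = \int[m]_x (g x * Q f x).

(** Symmetry against the constant 1 gives [int Q f = int f Q 1], and [Q 1 <= 1]. *)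
Lemma integral_kint_le f : nnm f -> \int[m]_x Q f x <= \int[m]_x f x.
Proof.
move=> f0.
have := symS (nnm_cst (@lee01 R)) f0.
under eq_integral do rewrite mul1e.
move=> ->; apply: nnm_le_integral => //.
  by apply: nnmM => //; apply: kint_nnm => //; exact: nnm_cst.
move=> x; rewrite -[leRHS]mule1; apply: lee_wpmul2l; first exact: f0.2.
exact: kint_cst_le.
Qed.

Lemma iter_kint_nnm k f : nnm f -> nnm (iter k Q f).
Proof. by move=> f0; elim: k => //= k IH; exact: kint_nnm. Qed.

Variable f : T -> \bar R.
Hypothesis f0 : nnm f.

Definition above (l : R) (k : nat) (x : T) : \bar R :=
  if l%:E < iter k Q f x then 1 else 0.

(* [exceed l n k x] is the probability that the chain started from [x] at time
   [k] visits, between the times [k] and [k + n], a point where the current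
   iterate of [f] exceeds [l]. *)
Fixpoint exceed (l : R) (n k : nat) (x : T) : \bar R :=
  if l%:E < iter k Q f x then 1
  else if n is n'.+1 then Q (exceed l n' k.+1) x else 0.

Lemma measurable_above l k :
  measurable_fun [set: T] (fun x => l%:E < iter k Q f x).
Proof.
by apply: measurable_fun_lte; [exact: measurable_cst|exact: (iter_kint_nnm k f0).1].
Qed.

Lemma above_nnm l k : nnm (above l k).
Proof.
by apply: nnm_if; [exact: measurable_above|exact: nnm_cst|exact: nnm_cst].
Qed.

Lemma exceed_nnm l n k : nnm (exceed l n k).
Proof.
elim: n k => [|n IH] k /=; first exact: above_nnm.
apply: nnm_if; first exact: measurable_above.
- exact: nnm_cst.
- exact: kint_nnm.
Qed.

Lemma exceed_le1 l n k x : exceed l n k x <= 1.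
Proof.
elim: n k x => [|n IH] k x /=; first by case: ifP.
by case: ifP => // _; apply: kint_le_cst => //; exact: exceed_nnm.
Qed.

Lemma kint_exceed_le l n k x : Q (exceed l n k.+1) x <= exceed l n.+1 k x.
Proof.
rewrite /=; case: ifP => // _; apply: kint_le_cst => //; first exact: exceed_nnm.
by move=> y; exact: exceed_le1.
Qed.

(** Being above the level after exactly [j <= n] steps is one of the events counted by [exceed];
    each step is paid for by [kint_exceed_le]. *)
Lemma iter_above_le l n k j x : (j <= n)%N ->
  iter j Q (above l (k + j)) x <= exceed l n k x.
Proof.
elim: j n k x => [|j IH] n k x jn.
  rewrite addn0 /= /above; case: ifP => [h|_]; last exact: (exceed_nnm _ _ _).2.
  by case: n {jn} => /=; rewrite h.
case: n jn => // n jn; apply: le_trans (kint_exceed_le l n k x).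
rewrite iterS; apply: kint_le => //.
- exact/iter_kint_nnm/above_nnm.
- exact: exceed_nnm.
- by move=> y; rewrite addnS -addSn; apply: IH.
Qed.

(** Induction on the number of steps. The function [exceed] splits into [Q e], with [e] the
    exceedance from time [k + 1], and a rest [v] living where [Q^k f > l]. On [v] the inequality is
    pointwise. For [Q e], symmetry turns [int Q^k f Q e] into [int Q^(k+1) f e], to which the
    induction hypothesis applies, and [int Q e <= int e]. *)
Lemma exceed_weak l n k : (0 <= l)%R ->
  l%:E * \int[m]_x exceed l n k x <= \int[m]_x (iter k Q f x * exceed l n k x).
Proof.
move=> l0; elim: n k => [|n IH] k.
  rewrite -nnm_integralZl ?lee_fin//; last exact: exceed_nnm.
  apply: nnm_le_integral; [apply: nnmM|apply: nnmM|].
  - by apply: nnm_cst; rewrite lee_fin.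
  - exact: exceed_nnm.
  - exact: iter_kint_nnm.
  - exact: exceed_nnm.
  - move=> x /=; case: ifPn => [lt|_]; last by rewrite !mule0.
    by rewrite !mule1 ltW.
set e := exceed l n k.+1.
have enn : nnm e by exact: exceed_nnm.
have Qenn : nnm (Q e) by exact: kint_nnm.
have Qe1 x : Q e x <= 1.
  by apply: kint_le_cst => // y; exact: exceed_le1.
have Qefin x : Q e x \is a fin_num.
  by rewrite ge0_fin_numE ?Qenn.2// (le_lt_trans (Qe1 x))// ltry.
pose v x := if l%:E < iter k Q f x then 1 - Q e x else 0.
have vnn : nnm v.
  apply: nnm_if; [exact: measurable_above| |exact: nnm_cst].
  split; last by move=> x; rewrite sube_ge0 ?Qefin ?orbT.
  by apply: emeasurable_funB; [exact: measurable_cst|exact: Qenn.1].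
have exE x : exceed l n.+1 k x = v x + Q e x.
  rewrite /= /v -/e; case: ifP => _; last by rewrite add0e.
  by rewrite subeK.
have ann : nnm (iter k Q f) by exact: iter_kint_nnm.
under eq_integral do rewrite exE.
under [in leRHS]eq_integral do rewrite exE ge0_muleDr ?vnn.2 ?Qenn.2//.
rewrite (nnm_integralD m vnn Qenn) (nnm_integralD m (nnmM ann vnn) (nnmM ann Qenn)).
rewrite ge0_muleDr; [|by apply: integral_ge0 => x _; apply vnn..|
  by apply: integral_ge0 => x _; apply Qenn].
apply: leeD.
  rewrite -nnm_integralZl ?lee_fin//.
  apply: nnm_le_integral; [apply: nnmM|apply: nnmM|] => //.
  move=> x; rewrite /v; case: ifP => [lt|_]; last by rewrite !mule0.
  by apply: lee_wpmul2r; [rewrite sube_ge0 ?Qefin|exact: ltW].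
rewrite symS//.
under [in leRHS]eq_integral do rewrite muleC -iterS.
apply: le_trans (IH k.+1); apply: lee_wpmul2l; first by rewrite lee_fin.
exact: integral_kint_le.
Qed.

(** Where [2 f <= l], the product of [f] and [exceed] is at most half of [l] times [exceed]. This
    half is absorbed into the left-hand side of [exceed_weak], whence the factor 2. *)
Lemma exceed_weak_tail l n : (0 < l)%R -> \int[m]_x f x < +oo ->
  l%:E * \int[m]_x exceed l n 0 x <=
  2%:E * \int[m]_x (if l%:E < 2%:E * f x then f x else 0).
Proof.
move=> l0 fi.
have enn := exceed_nnm l n 0.
have weak := exceed_weak n 0 (ltW l0).
have I0 : 0 <= \int[m]_x exceed l n 0 x.
  by apply: integral_ge0 => x _; exact: enn.2.
(* The absorption subtracts a multiple of this integral, which therefore has to be finite;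
   [exceed_weak] and the integrability of [f] give this for [l > 0]. *)
have Ifin : \int[m]_x exceed l n 0 x \is a fin_num.
  rewrite ge0_fin_numE//.
  have : l%:E * \int[m]_x exceed l n 0 x < +oo.
    apply: le_lt_trans weak (le_lt_trans _ fi).
    apply: nnm_le_integral => //; first exact: nnmM.
    move=> x; rewrite /= -[leRHS]mule1; apply: lee_wpmul2l; first exact: f0.2.
    exact: exceed_le1.
  by case: (integral _ _ _) I0 => [r _|_|//]; rewrite ?ltry// gt0_muley ?lte_fin// ltxx.
have tnn : nnm (fun x => if l%:E < 2%:E * f x then f x else 0).
  apply: nnm_if => //.
  apply: measurable_fun_lte; first exact: measurable_cst.
  by apply: emeasurable_funM; [exact: measurable_cst|exact: f0.1].
have hnn : 0 <= (l / 2)%:E :> \bar R by rewrite lee_fin divr_ge0// ltW.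
have H : \int[m]_x (f x * exceed l n 0 x) <=
   \int[m]_x (if l%:E < 2%:E * f x then f x else 0) +
   (l / 2)%:E * \int[m]_x exceed l n 0 x.
  rewrite -nnm_integralZl// -nnm_integralD//; last first.
    by apply: nnmM => //; exact: nnm_cst.
  apply: nnm_le_integral; first exact: nnmM.
    by apply: nnmD => //; apply: nnmM => //; exact: nnm_cst.
  move=> x; case: ifPn => [_|].
    rewrite -[leLHS]adde0; apply: leeD; last by rewrite mule_ge0// enn.2.
    rewrite -[leRHS]mule1; apply: lee_wpmul2l; first exact: f0.2.
    exact: exceed_le1.
  rewrite -leNgt add0e => fl; apply: lee_wpmul2r; first exact: enn.2.
  have : (2^-1)%:E * (2%:E * f x) <= (2^-1)%:E * l%:E by apply: lee_wpmul2l.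
  by rewrite muleA -!EFinM mulVf// mul1e mulrC.
have := le_trans weak H; rewrite /= -(fineK Ifin) -!EFinM.
have : 0 <= \int[m]_x (if l%:E < 2%:E * f x then f x else 0).
  by apply: integral_ge0 => x _; exact: tnn.2.
set r := fine _; case: (integral _ _ _) => [t|_ _|//].
- by rewrite -!EFinM -EFinD !lee_fin => t0 h; lra.
- by rewrite gt0_muley ?leey// lte_fin.
Qed.

End DiscreteMaximal.

(** * Fatou's lemma under almost everywhere lower bounds *)

Section FatouBound.
Context {d : measure_display} {T : measurableType d} {R : realType}.
Local Open Scope ereal_scope.

Lemma measurable_fun_limn_einf (F : nat -> T -> \bar R) :
  (forall n, measurable_fun [set: T] (F n)) ->
  measurable_fun [set: T] (fun x => limn_einf (F ^~ x)).
Proof.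
move=> mF; rewrite [X in measurable_fun _ X](_ : _ =
    (fun x => - limn_esup (fun n => - F n x))).
  apply: measurableT_comp => //; apply: measurable_fun_limn_esup => n.
  exact: measurableT_comp.
apply/funext => x; rewrite -limn_einfN; congr limn_einf.
by apply/funext => n /=; rewrite oppeK.
Qed.

Lemma fatou_ae (mu : {measure set T -> \bar R}) (F : nat -> T -> \bar R)
    (f : T -> \bar R) : (forall n, nnm (F n)) -> nnm f ->
  {ae mu, forall x, f x <= limn_einf (F ^~ x)} ->
  \int[mu]_x f x <= limn_einf (fun n => \int[mu]_x F n x).
Proof.
move=> F0 [mf f0] fF.
have lF0 x : 0 <= limn_einf (F ^~ x).
  have -> : 0 = limn_einf (fun _ : nat => 0 : \bar R).
    by rewrite (cvg_limn_einf_sup (cvg_cst _)).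
  rewrite !limn_einf_lim; apply: lee_lim => //; [exact: is_cvg_einfs..|].
  apply: nearW => n; apply: le_ereal_inf_tmp => _ [k nk <-].
  apply: le_trans ((F0 k).2 x); apply: ereal_inf_lbound; by exists n => /=.
apply: le_trans (_ : \int[mu]_x limn_einf (F ^~ x) <= _).
  apply: ae_ge0_le_integral => //.
  - apply: measurable_fun_limn_einf => n; exact: (F0 n).1.
  - by apply: filterS fF => x + _.
apply: fatou => //.
- by move=> n; exact: (F0 n).1.
- by move=> n x _; exact: (F0 n).2.
Qed.

Lemma limn_einf_le (u : nat -> \bar R) (c : \bar R) :
  (forall n, u n <= c) -> limn_einf u <= c.
Proof.
move=> uc; rewrite limn_einf_lim; apply: lime_le; first exact: is_cvg_einfs.
apply: nearW => n; apply: le_trans (uc n).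
by apply: ereal_inf_lbound; exists n => /=.
Qed.

Lemma fatou_le (mu : {measure set T -> \bar R}) (F : nat -> T -> \bar R)
    (f : T -> \bar R) (c : \bar R) : (forall n, nnm (F n)) -> nnm f ->
  {ae mu, forall x, f x <= limn_einf (F ^~ x)} ->
  (forall n, \int[mu]_x F n x <= c) -> \int[mu]_x f x <= c.
Proof.
by move=> F0 f0 fF Fc; apply: le_trans (fatou_ae F0 f0 fF) _; exact: limn_einf_le.
Qed.

Lemma fatou_cvg_le (mu : {measure set T -> \bar R}) (F : nat -> T -> \bar R)
    (f : T -> \bar R) (c : \bar R) : (forall n, nnm (F n)) -> nnm f ->
  {ae mu, forall x, F n x @[n --> \oo] --> f x} ->
  (forall n, \int[mu]_x F n x <= c) -> \int[mu]_x f x <= c.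
Proof.
move=> F0 f0 fF; apply: fatou_le => //.
by apply: filterS fF => x /cvg_limn_einf_sup[-> _].
Qed.

End FatouBound.

(** * From the weak-type to the strong maximal inequality *)

Section MaximalInequality.
Context {R : realType}.
Local Open Scope ereal_scope.

(** The factor [6 ^ p] is [2 ^ p] from absorbing the threshold [e] times [3 ^ p] from
    [level_sum_powR]; the first 2 comes from [exceed_weak_tail], the quotient is the geometric
    constant of [level_sum_le] for exponent [p - 1], and the last power comes from the tails being
    cut at [2 f] instead of [f]. *)
Definition maximal_cst (p : R) : R :=
  (2 * 6 `^ p * (2 `^ (p - 1) / (2 `^ (p - 1) - 1)) * 2 `^ (p - 1))%R.

Lemma maximal_cst_gt0 (p : R) : (1 < p -> 0 < maximal_cst p)%R.
Proof.
move=> p1; rewrite /maximal_cst !mulr_gt0 ?powR_gt0// invr_gt0 subr_gt0.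
rewrite -[ltLHS](congr1 (@^~ (p - 1)%R) (powR1 R)).
by rewrite gt0_ltr_powR ?nnegrE ?ltr1n ?subr_gt0.
Qed.

Lemma le_double_excess (e r s : R) :
  (2 * e <= r -> r <= e + s -> r <= 2 * s)%R.
Proof. by move=> h1 h2; lra. Qed.

(** A dyadic layer-cake formula: [e] and the levels [e 2^j], [j <= n], add up to exactly
    [e 2^(n+1)], and all these levels are counted once [a] exceeds [e 2^n]. *)
Lemma level_decomposition (e a : R) n : (0 < e -> a <= e * 2 ^+ n ->
  a <= e + \sum_(j < n) e * 2 ^+ j * (if e * 2 ^+ j < a then 1 else 0))%R.
Proof.
move=> e0; have l0 j : (0 < e * 2 ^+ j)%R by rewrite mulr_gt0 ?exprn_gt0.
have full k : (\sum_(j < k) e * 2 ^+ j = e * 2 ^+ k - e)%R.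
  elim: k => [|k IH]; first by rewrite big_ord0 expr0; ring.
  by rewrite big_ord_recr/= IH exprS; ring.
elim: n => [|n IH] an.
  by rewrite big_ord0 addr0; rewrite expr0 mulr1 in an.
have [an'|na] := leP a (e * 2 ^+ n)%R.
  apply: (le_trans (IH an')); rewrite big_ord_recr/= addrA lerDl.
  by rewrite mulr_ge0// ?(ltW (l0 n))//; case: ifP.
rewrite (eq_bigr (fun j : 'I_n.+1 => e * 2 ^+ j)%R) ?full 1?addrC ?subrK//.
move=> j _; rewrite ifT ?mulr1//; apply: le_lt_trans na.
by rewrite ler_pM2l// ler_weXn2l ?ler1n// -ltnS.
Qed.

Context {d : measure_display} {T : measurableType d}.
Variable m : {measure set T -> \bar R}.
Variable S : T -> {measure set T -> \bar R}.
Hypothesis mS : forall U, measurable U -> measurable_fun [set: T] (S ^~ U).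
Hypothesis S1 : forall x, (S x [set: T] <= 1)%E.
Local Notation Q := (kint S).
Hypothesis symS : forall f g, nnm f -> nnm g ->
  \int[m]_x (f x * Q g x) = \int[m]_x (g x * Q f x).

Lemma iter_kint_affine_le k n (c : R) (l : nat -> R) (h : nat -> T -> \bar R) :
  (0 <= c)%R -> (forall j, 0 <= l j)%R -> (forall j, nnm (h j)) -> forall x,
  iter k Q (fun y => c%:E + \sum_(j < n) (l j)%:E * h j y) x <=
  c%:E + \sum_(j < n) (l j)%:E * iter k Q (h j) x.
Proof.
move=> c0 l0 h0.
have lh0 j' (f : nat -> T -> \bar R) : (forall j, nnm (f j)) ->
    nnm (fun y => (l j')%:E * f j' y).
  by move=> f0; apply: nnmM => //; apply: nnm_cst; rewrite lee_fin.
have s0 (f : nat -> T -> \bar R) : (forall j, nnm (f j)) ->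
    nnm (fun y => \sum_(j < n) (l j)%:E * f j y).
  by move=> f0; apply: nnm_sum => j; exact: lh0.
have cE : nnm (fun _ : T => c%:E) by apply: nnm_cst; rewrite lee_fin.
elim: k => [|k IH] x //=; rewrite -/Q.
have it0 j : nnm (iter k Q (h j)) by exact: iter_kint_nnm.
apply: le_trans (_ : Q (fun y => c%:E + \sum_(j < n) (l j)%:E * iter k Q (h j) y) x <= _).
  apply: kint_le => //; [apply: iter_kint_nnm => //|]; apply: nnmD => //.
  - by apply: s0.
  - by apply: (s0 (fun j => iter k Q (h j))).
rewrite /kint (nnm_integralD _ cE (s0 (fun j => iter k Q (h j)) it0)).
apply: leeD; first by apply: kint_cst_le => //; rewrite lee_fin.
rewrite (nnm_integral_sum _ _ (fun j : 'I_n => lh0 j (fun j => iter k Q (h j)) it0)).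
apply: lee_sum => j _; rewrite (nnm_integralZl _ (it0 j)) ?lee_fin//.
Qed.

(* With [S ^ (2 k)] read as the conditional expectation of the reversed
   martingale [S ^ k f (x_k)], this is Doob's inequality in Rota's dilation;
   the path space is replaced by the functions [exceed]. *)
Lemma discrete_maximal (p : R) (f M : T -> \bar R) (L : R) (N : nat) :
  (1 < p)%R -> nnm f -> (forall x, f x <= L%:E) -> \int[m]_x f x < +oo ->
  nnm M ->
  (forall x, exists2 k, (k <= N)%N & M x <= iter k Q (iter k Q f) x) ->
  \int[m]_x (M x `^ p) <= (maximal_cst p)%:E * \int[m]_x (f x `^ p).
Proof.
move=> p1 f0 fL fi M0 Mle.
have p0 : (0 < p)%R by lra.
have L0 (x : T) : (0 <= L)%R by have := le_trans (f0.2 x) (fL x); rewrite lee_fin.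
have itL k x : iter k Q f x <= L%:E.
  elim: k x => [|k IH] x //=; apply: kint_le_cst => //.
    exact: iter_kint_nnm.
  by rewrite lee_fin (L0 x).
have itfin k x : iter k Q f x = (fine (iter k Q f x))%:E.
  rewrite fineK// ge0_fin_numE; last exact: (iter_kint_nnm _ _ _).2.
  by rewrite (le_lt_trans (itL _ _))// ltry.
have ML x : M x <= L%:E.
  have [k _ h] := Mle x; apply: (le_trans h); rewrite -iterD.
  exact: itL.
have Mfin x : M x = (fine (M x))%:E.
  by rewrite fineK// ge0_fin_numE ?M0.2// (le_lt_trans (ML x))// ltry.
(* On [M >= 2 e] the additive error [e] of the level decomposition is at most half of [M] and can be
   absorbed. Fatou's lemma lets [e] tend to 0 at the end. *)
have main (e : R) : (0 < e)%R ->
    \int[m]_x (if (2 * e)%:E <= M x then M x `^ p else 0) <=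
    (maximal_cst p)%:E * \int[m]_x (f x `^ p).
  move=> e0.
  have l0 j : (0 < e * 2 ^+ j)%R by rewrite mulr_gt0 ?exprn_gt0.
  (* The top level has to reach the bound [L], so that the level decomposition of every iterate of
     [f] is complete. *)
  have [n Ln] : exists n, (L <= e * 2 ^+ n)%R.
    exists (Num.truncn (L / e)).+1.
    rewrite mulrC -ler_pdivrMr//; apply: le_trans (ltW (truncnS_gt _)) _.
    by rewrite -natrX ler_nat ltnW// ltn_expl.
  pose l j := (e * 2 ^+ j)%R.
  pose E j := exceed S f (l j) N 0.
  have E0 j : nnm (E j) by exact: exceed_nnm.
  have E1 j x : E j x <= 1 by exact: exceed_le1.
  pose g j x := fine (E j x).
  have Eg j x : E j x = (g j x)%:E.
    by rewrite fineK// ge0_fin_numE ?(E0 j).2// (le_lt_trans (E1 _ _))// ltry.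
  have g01 x j : (0 <= g j x <= 1)%R.
    by rewrite -!lee_fin -Eg E1 (E0 j).2.
  (* [Q^k] is applied to the level decomposition of [Q^k f]; the image of each level indicator is
     bounded by the exceedance started at time 0. *)
  have Mg x : (fine (M x) <= e + \sum_(j < n) l j * g j x)%R.
    have [k kN] := Mle x; rewrite Mfin.
    have dec y : iter k Q f y <=
        e%:E + \sum_(j < n) (l j)%:E * above S f (l j) k y.
      rewrite itfin; have := @level_decomposition e (fine (iter k Q f y)) n e0.
      rewrite -lee_fin -itfin => /(_ (le_trans (itL _ _) _)).
      rewrite lee_fin => /(_ Ln) h; rewrite itfin.
      apply: le_trans (_ : (e + \sum_(j < n) e * 2 ^+ j *
        (if e * 2 ^+ j < fine (iter k Q f y) then 1 else 0))%:E <= _).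
        by rewrite lee_fin.
      rewrite EFinD -sumEFin; apply: leeD => //; apply: lee_sum => j _.
      by rewrite EFinM /above itfin lte_fin; case: ifP.
    move=> h; rewrite -lee_fin; apply: (le_trans h).
    apply: le_trans (_ : iter k Q (fun y => e%:E +
        \sum_(j < n) (l j)%:E * above S f (l j) k y) x <= _).
      have mono i (u v : T -> \bar R) : nnm u -> nnm v -> (forall y, u y <= v y) ->
          forall y, iter i Q u y <= iter i Q v y.
        move=> u0 v0 uv; elim: i => [|i IH] y //=.
        by apply: kint_le => //; exact: iter_kint_nnm.
      apply: mono => //; first exact: iter_kint_nnm.
      apply: nnmD; first by apply: nnm_cst; rewrite lee_fin ltW.
      apply: nnm_sum => j; apply: nnmM; last exact: above_nnm.
      by apply: nnm_cst; rewrite lee_fin; exact: ltW (l0 j).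
    apply: le_trans (@iter_kint_affine_le k n e l (fun j => above S f (l j) k)
      (ltW e0) (fun j => ltW (l0 j)) (fun j => above_nnm mS f0 _ _) x) _.
    rewrite EFinD -sumEFin; apply: leeD => //; apply: lee_sum => j _.
    rewrite [leRHS]EFinM -Eg; apply: lee_wpmul2l; first by rewrite lee_fin; exact: ltW (l0 j).
    by have := @iter_above_le _ _ _ S mS S1 f f0 (l j) N 0 k x kN; rewrite add0n.
  pose c6 := (6 `^ p)%R.
  have pw x : (if (2 * e)%:E <= M x then M x `^ p else 0) <=
      c6%:E * \sum_(j < n) ((l j) `^ p)%:E * E j x.
    rewrite Mfin; set r := fine (M x); rewrite lee_fin.
    have -> : \sum_(j < n) (l j `^ p)%:E * E j x =
        (\sum_(j < n) l j `^ p * g j x)%:E.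
      by rewrite -sumEFin; apply: eq_bigr => j _; rewrite Eg EFinM.
    have s0 : (0 <= \sum_(j < n) l j `^ p * g j x)%R.
      by apply: sumr_ge0 => j _; rewrite mulr_ge0 ?powR_ge0//; case/andP: (g01 x j).
    rewrite -EFinM; case: ifPn => [er|_]; last first.
      by rewrite lee_fin mulr_ge0// powR_ge0.
    rewrite poweR_EFin lee_fin.
    have r0 : (0 <= r)%R by rewrite -lee_fin -Mfin M0.2.
    have rs : (r <= 2 * \sum_(j < n) l j * g j x)%R.
      by have := Mg x; rewrite -/r; exact: le_double_excess.
    have t0 : (0 <= \sum_(j < n) l j * g j x)%R.
      by apply: sumr_ge0 => j _; rewrite mulr_ge0 ?(ltW (l0 _))//; case/andP: (g01 x j).
    have h2 : (r `^ p <= (2 * \sum_(j < n) l j * g j x) `^ p)%R.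
      by apply: ge0_ler_powR; rewrite ?nnegrE ?(ltW p0) ?mulr_ge0.
    apply: (le_trans h2); rewrite powRM//.
    have h3 := @level_sum_powR _ e p n (g ^~ x) e0 p1 (g01 x).
    apply: le_trans (ler_wpM2l (powR_ge0 2 p) h3) _.
    by rewrite mulrA -powRM// /c6 -natrM.
  have lE j : nnm (fun x => (l j `^ p)%:E * E j x).
    by apply: nnmM => //; apply: nnm_cst; rewrite lee_fin powR_ge0.
  have s0 : nnm (fun x => \sum_(j < n) (l j `^ p)%:E * E j x).
    by apply: nnm_sum => j.
  have c60 : 0 <= c6%:E by rewrite lee_fin powR_ge0.
  pose tail j x := if (l j)%:E < 2%:E * f x then f x else 0.
  have tail0 j : nnm (tail j).
    apply: nnm_if => //.
    apply: measurable_fun_lte; first exact: measurable_cst.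
    by apply: emeasurable_funM; [exact: measurable_cst|exact: f0.1].
  have lt0 j : nnm (fun x => (l j `^ (p - 1))%:E * tail j x).
    by apply: nnmM => //; apply: nnm_cst; rewrite lee_fin powR_ge0.
  apply: le_trans (_ : \int[m]_x (c6%:E * \sum_(j < n) ((l j) `^ p)%:E * E j x) <= _).
    apply: nnm_le_integral => //; last by apply: nnmM => //; exact: nnm_cst.
    apply: nnm_if; [|exact: nnm_poweR|exact: nnm_cst].
    by apply: measurable_fun_lee; [exact: measurable_cst|exact: M0.1].
  rewrite nnm_integralZl// (nnm_integral_sum m _ (fun j : 'I_n => lE j)).
  apply: le_trans (_ : c6%:E * (2%:E * \int[m]_x
      \sum_(j < n) (l j `^ (p - 1))%:E * tail j x) <= _).
    apply: lee_wpmul2l => //.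
    rewrite (nnm_integral_sum m _ (fun j : 'I_n => lt0 j)).
    rewrite ge0_sume_distrr; last by move=> j _; apply: integral_ge0 => x _; exact: (lt0 j).2.
    apply: lee_sum => j _.
    rewrite (nnm_integralZl m (E0 j)) ?lee_fin ?powR_ge0//.
    rewrite (nnm_integralZl m (tail0 j)) ?lee_fin ?powR_ge0//.
    (* One factor [l] of [l ^ p] is used up by the weak-type bound; [l ^ (p - 1)] times the tail of
       [f] remains. *)
    rewrite -(mulr_powRB1 (ltW (l0 j)) p0) EFinM -muleA [leLHS]muleCA [leRHS]muleCA.
    apply: lee_wpmul2l; first by rewrite lee_fin powR_ge0.
    exact: exceed_weak_tail.
  have fp : nnm (fun x => f x `^ p) by exact: nnm_poweR.
  rewrite /maximal_cst.
  set C := (2 `^ (p - 1) / (2 `^ (p - 1) - 1))%R.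
  have C0 : (0 <= C)%R.
    rewrite /C divr_ge0 ?powR_ge0// subr_ge0.
    rewrite -[leLHS](congr1 (@^~ (p - 1)%R) (powR1 R)).
    by apply: ge0_ler_powR; rewrite ?nnegrE ?subr_ge0 ?(ltW p1) ?ler1n.
  have C20 : (0 <= C * 2 `^ (p - 1))%R by rewrite mulr_ge0// powR_ge0.
  rewrite muleA -EFinM [X in X%:E * _]mulrC -/c6.
  rewrite -[in leRHS]mulrA [in leRHS]EFinM -muleA.
  apply: lee_wpmul2l; first by rewrite lee_fin mulr_ge0// powR_ge0.
  rewrite -(nnm_integralZl m fp) ?lee_fin//.
  apply: nnm_le_integral.
  - by apply: nnm_sum => j.
  - by apply: nnmM => //; apply: nnm_cst; rewrite lee_fin.
  - move=> x; have := itfin 0%N x; rewrite /= => fE.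
    have r0 : (0 <= fine (f x))%R by rewrite -lee_fin -fE f0.2.
    rewrite fE; set r := fine (f x) in r0 *.
    rewrite poweR_EFin -EFinM.
    rewrite (eq_bigr (fun j : 'I_n =>
      ((if e * 2 ^+ j < 2 * r then (e * 2 ^+ j) `^ (p - 1) else 0) * r)%:E)%R); last first.
      move=> j _; rewrite /tail fE -/r -EFinM lte_fin.
      rewrite -[(e * 2 ^+ j)%R]/(l j).
      by case: ifP => _; [rewrite [RHS]EFinM|rewrite mul0r mule0].
    rewrite sumEFin lee_fin -mulr_suml.
    have h := @level_sum_le _ e (2 * r) (p - 1) n e0.
    rewrite subr_gt0 in h; have {}h := h p1.
    apply: le_trans (ler_wpM2r r0 h) _.
    by rewrite powRM// -/C -(mulr_powRB1 r0 p0) le_eqVlt; apply/orP; left; apply/eqP; ring.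
apply: (@fatou_cvg_le _ _ _ m (fun i x =>
   if (2 * i.+1%:R^-1)%:E <= M x then M x `^ p else 0)).
- move=> i; apply: nnm_if; [|exact: nnm_poweR|exact: nnm_cst].
  by apply: measurable_fun_lee; [exact: measurable_cst|exact: M0.1].
- exact: nnm_poweR.
- apply: aeW => x; rewrite Mfin.
  have := M0.2 x; rewrite Mfin lee_fin le_eqVlt => /orP[/eqP <-|Mgt].
    rewrite poweR0r ?gt_eqF//.
    rewrite [X in X @ _ --> _](_ : _ = (fun=> 0)); first exact: cvg_cst.
    by apply/funext => i; case: ifP.
  have [i0 hi] : exists i0, forall i, (i0 <= i)%N -> (2 * i.+1%:R^-1 <= fine (M x))%R.
    exists (Num.truncn (2 / fine (M x))) => i hi.
    rewrite ler_pdivrMr// mulrC -ler_pdivrMr//.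
    by apply: le_trans (ltW (truncnS_gt _)) _; rewrite ler_nat ltnS.
  apply: cvg_near_cst; exists i0 => // i /= /hi h.
  by rewrite lee_fin h.
- by move=> i; apply: main; rewrite invr_gt0.
Qed.

End MaximalInequality.

(** * Symmetric sub-Markov semigroups *)

Section BoundedIntegrable.
Context {d : measure_display} {T : measurableType d} {R : realType}.
Variable m : {measure set T -> \bar R}.
Implicit Types f g h : T -> R.

(** This class is stable under products, under the semigroup and under Lipschitz maps that fix 0.
    All pairings of its members are finite, so that the form can be computed with actual functions
    instead of classes. *)
Definition bint f : Prop := [/\ measurable_fun [set: T] f,
  exists M : R, forall x, `|f x| <= M & m.-integrable [set: T] (EFin \o f)].

Lemma bint_measurable f : bint f -> measurable_fun [set: T] f.
Proof. by case. Qed.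

Lemma bint_integrable f : bint f -> m.-integrable [set: T] (EFin \o f).
Proof. by case. Qed.

Lemma bint_dom f g (c : R) : measurable_fun [set: T] g ->
  (forall x, `|g x| <= c * `|f x|) -> bint f -> bint g.
Proof.
move=> mg gf [mf [M fM] intf]; split => //.
  exists (`|c| * M) => x; apply: le_trans (gf x) _.
  apply: le_trans (ler_wpM2r (normr_ge0 _) (ler_norm c)) _.
  exact: ler_wpM2l.
apply: (@le_integrable _ _ _ _ _ measurableT _ (fun x => c%:E * (f x)%:E)%E).
- exact: measurableT_comp.
- move=> x _; rewrite -EFinM !abse_EFin lee_fin normrM.
  by apply: le_trans (gf x) _; apply: ler_wpM2r => //; exact: ler_norm.
- exact: integrableZl.
Qed.

Lemma bintD f g : bint f -> bint g -> bint (fun x => f x + g x).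
Proof.
move=> [mf [M fM] intf] [mg [N gN] intg]; split.
- exact: measurable_funD.
- exists (M + N) => x; exact: le_trans (ler_normD _ _) (lerD _ _).
- exact: (integrableD measurableT intf intg).
Qed.

Lemma bintZ (a : R) f : bint f -> bint (fun x => a * f x).
Proof.
move=> bf; apply: (bint_dom (c := `|a|)) (bf); last by move=> x; rewrite normrM.
by apply: measurable_funM => //; exact: bint_measurable.
Qed.

Lemma bintN f : bint f -> bint (fun x => - f x).
Proof.
by move=> /(bintZ (-1)); under eq_fun do rewrite mulN1r.
Qed.

Lemma bintB f g : bint f -> bint g -> bint (fun x => f x - g x).
Proof. by move=> bf /bintN; exact: bintD. Qed.

Lemma bint_norm f : bint f -> bint (fun x => `|f x|).
Proof.
move=> bf; apply: (bint_dom (c := 1)) (bf); last by move=> x; rewrite normr_id mul1r.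
by apply: measurableT_comp => //; exact: bint_measurable.
Qed.

Lemma bint_pos f : bint f -> bint f^\+.
Proof.
move=> bf; apply: (bint_dom (c := 1)) (bf).
  by apply: measurable_funrpos; exact: bint_measurable.
move=> x; rewrite mul1r ger0_norm ?funrpos_ge0//.
by rewrite /funrpos ge_max ler_norm normr_ge0.
Qed.

Lemma bint_neg f : bint f -> bint f^\-.
Proof. by move=> /bintN/bint_pos; rewrite (funrposN f). Qed.

Lemma bint_posBneg f x : f x = f^\+ x - f^\- x.
Proof. by rewrite -[in LHS](funrposBneg f). Qed.

Lemma bintM f g : bint f -> bint g -> bint (fun x => f x * g x).
Proof.
move=> bf [mg [N gN] _]; apply: (bint_dom (c := N)) (bf).
  by apply: measurable_funM => //; exact: bint_measurable.
by move=> x; rewrite normrM mulrC; apply: ler_wpM2r.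
Qed.

Lemma bint_nnm f : bint f -> (forall x, 0 <= f x) -> nnm (EFin \o f).
Proof.
move=> bf f0; split; last by move=> x; rewrite lee_fin.
by apply/measurable_EFinP; exact: bint_measurable.
Qed.

Definition dot f g : R := \int[m]_x (f x * g x).

Lemma dotE f g : dot f g = \int[m]_x (f x * g x).
Proof. by []. Qed.

Lemma dotC f g : dot f g = dot g f.
Proof. by apply: eq_Rintegral => x _; rewrite mulrC. Qed.

Lemma EFin_dot f g : bint f -> bint g ->
  (dot f g)%:E = (\int[m]_x (f x * g x)%:E)%E.
Proof.
by move=> bf bg; rewrite /dot /Rintegral fineK//;
  exact: integrable_fin_num (bint_integrable (bintM bf bg)).
Qed.

Lemma dotDl f g h : bint f -> bint g -> bint h ->
  dot (fun x => f x + g x) h = dot f h + dot g h.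
Proof.
move=> bf bg bh; rewrite /dot.
under eq_Rintegral do rewrite mulrDl.
by rewrite RintegralD//; exact: bint_integrable (bintM _ _).
Qed.

Lemma dotZl (a : R) f h : bint f -> bint h ->
  dot (fun x => a * f x) h = a * dot f h.
Proof.
move=> bf bh; rewrite /dot.
under eq_Rintegral do rewrite -mulrA.
by rewrite RintegralZl//; exact: bint_integrable (bintM _ _).
Qed.

Lemma dotNl f h : bint f -> bint h -> dot (fun x => - f x) h = - dot f h.
Proof.
by move=> bf bh; rewrite -mulN1r -dotZl//; apply: eq_Rintegral => x _;
  rewrite mulN1r.
Qed.

Lemma dotBl f g h : bint f -> bint g -> bint h ->
  dot (fun x => f x - g x) h = dot f h - dot g h.
Proof.
by move=> bf bg bh; rewrite (dotDl bf (bintN bg) bh) dotNl.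
Qed.

Lemma dotBr f g h : bint f -> bint g -> bint h ->
  dot h (fun x => f x - g x) = dot h f - dot h g.
Proof. by move=> bf bg bh; rewrite dotC dotBl// !(dotC h). Qed.

Lemma dot_ge0 f : 0 <= dot f f.
Proof. by apply: Rintegral_ge0 => x _; rewrite -expr2 sqr_ge0. Qed.

Lemma dot_sqB f g : bint f -> bint g ->
  dot (fun x => f x - g x) (fun x => f x - g x) =
  dot f f - 2 * dot f g + dot g g.
Proof.
move=> bf bg; rewrite dotBl// ?dotBr//; last exact: bintB.
by rewrite (dotC g f); ring.
Qed.

Lemma dot_AM_GM f g : bint f -> bint g -> 2 * dot f g <= dot f f + dot g g.
Proof. by move=> bf bg; have := dot_ge0 (fun x => f x - g x); rewrite dot_sqB//; lra. Qed.

End BoundedIntegrable.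

Section SubMarkovSemigroup.
Context {d : measure_display} {T : measurableType d} {R : realType}.

(** The laws are stated for extended nonnegative functions; they pass to signed functions of the
    class [bint] by positive and negative parts. Measurability is joint in time and space, as
    Tonelli's theorem in both variables requires. *)
Record symmetric_semigroup (m : {measure set T -> \bar R})
    (k : R -> T -> {measure set T -> \bar R}) : Prop := {
  sg_measurable : forall U, measurable U ->
    measurable_fun [set: R * T] (fun z => k z.1 z.2 U) ;
  sg_le1 : forall t x, (k t x [set: T] <= 1)%E ;
  sg_0 : forall g, nnm g -> forall x, kint (k 0) g x = g x ;
  sg_add : forall s t g, 0 <= s -> 0 <= t -> nnm g ->
    forall x, kint (k (s + t)) g x = kint (k s) (kint (k t) g) x ;
  sg_sym : forall t f g, 0 <= t -> nnm f -> nnm g ->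
    (\int[m]_x (f x * kint (k t) g x) = \int[m]_x (g x * kint (k t) f x))%E }.

Variable m : {measure set T -> \bar R}.
Variable k : R -> T -> {measure set T -> \bar R}.
Hypothesis kP : symmetric_semigroup m k.
Implicit Types f g : T -> R.

Lemma sg_measurable1 t U : measurable U -> measurable_fun [set: T] (k t ^~ U).
Proof.
move=> mU; rewrite [X in measurable_fun _ X](_ : _ =
  (fun z : R * T => k z.1 z.2 U) \o (fun x => (t, x))) //.
apply: measurableT_comp; first exact: (sg_measurable kP).
exact: measurable_pair1.
Qed.

Local Notation P t := (kint (k t)).

Lemma sg_nnm t (g : T -> \bar R) : nnm g -> nnm (P t g).
Proof. by apply: kint_nnm; exact: sg_measurable1. Qed.

Lemma sg_nnm2 (g : T -> \bar R) : nnm g -> nnm (fun z : R * T => P z.1 g z.2).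
Proof.
move=> g0.
have h : nnm (kint (fun z : R * T => k z.1 z.2) g).
  by apply: kint_nnm => //; exact: sg_measurable kP.
exact: h.
Qed.

Lemma sg_integral_le t (g : T -> \bar R) : 0 <= t -> nnm g ->
  (\int[m]_x P t g x <= \int[m]_x g x)%E.
Proof.
move=> t0; apply: integral_kint_le.
- by move=> U mU; exact: sg_measurable1.
- exact: sg_le1 kP _.
- by move=> f' g' f0 g0; exact: sg_sym.
Qed.

Definition psg (t : R) f (x : T) : R := \int[k t x]_y f y.

Lemma psgE t f x : psg t f x = \int[k t x]_y f y.
Proof. by []. Qed.

Lemma sg_integrable t x f : measurable_fun [set: T] f ->
  (exists M : R, forall y, `|f y| <= M) ->
  (k t x).-integrable [set: T] (EFin \o f).
Proof.
move=> mf [M fM]; apply: measurable_bounded_integrable => //.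
  by apply: le_lt_trans (sg_le1 kP t x) _; rewrite ltry.
exists M; split; first exact: num_real.
by move=> N MN y _; apply: le_trans (fM y) (ltW MN).
Qed.

Lemma bint_sg_integrable t x f : bint m f ->
  (k t x).-integrable [set: T] (EFin \o f).
Proof. by case=> mf bf _; exact: sg_integrable. Qed.
Local Hint Resolve bint_sg_integrable : core.

Lemma EFin_psg t f x : bint m f -> (psg t f x)%:E = P t (EFin \o f) x.
Proof.
by move=> bf; rewrite /psg /Rintegral fineK//;
  exact: integrable_fin_num (bint_sg_integrable t x bf).
Qed.

Lemma psg0 f x : bint m f -> psg 0 f x = f x.
Proof.
have ge0case g : bint m g -> (forall x, 0 <= g x) -> psg 0 g x = g x.
  move=> bg g0; apply: EFin_inj; rewrite EFin_psg//.
  exact: (sg_0 kP (bint_nnm bg g0)).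
move=> bf; rewrite [RHS](bint_posBneg f).
rewrite -(ge0case _ (bint_pos bf) (funrpos_ge0 f)).
rewrite -(ge0case _ (bint_neg bf) (funrneg_ge0 f)).
rewrite /psg -RintegralB//; [|exact: bint_sg_integrable (bint_pos bf)|
  exact: bint_sg_integrable (bint_neg bf)].
by apply: eq_Rintegral => y _; exact: bint_posBneg.
Qed.

Lemma psgB t f g x : bint m f -> bint m g ->
  psg t (fun x => f x - g x) x = psg t f x - psg t g x.
Proof. by move=> bf bg; rewrite /psg RintegralB//; exact: bint_sg_integrable. Qed.

Lemma psg_ge0 t f x : (forall x, 0 <= f x) -> 0 <= psg t f x.
Proof. by move=> f0; apply: Rintegral_ge0. Qed.

Lemma psg_posBneg t f x : bint m f -> psg t f x = psg t f^\+ x - psg t f^\- x.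
Proof.
move=> bf; rewrite -psgB; [|exact: bint_pos|exact: bint_neg].
by apply: eq_Rintegral => y _; exact: bint_posBneg.
Qed.

Lemma psg_norm t f x : bint m f -> `|psg t f x| <= psg t (fun x => `|f x|) x.
Proof. by move=> bf; apply: le_normr_Rintegral => //; exact: bint_sg_integrable. Qed.

Lemma psg_bound t f (M : R) x : bint m f -> (forall x, `|f x| <= M) ->
  `|psg t f x| <= M.
Proof.
move=> bf fM; apply: le_trans (psg_norm t x bf) _.
have bn := bint_norm bf.
rewrite -lee_fin EFin_psg//; apply: kint_le_cst => //.
- exact: sg_le1 kP _.
- exact: (bint_nnm bn).
- by rewrite lee_fin; apply: le_trans (fM x).
Qed.

Lemma measurable_psg2 f : bint m f ->
  measurable_fun [set: R * T] (fun z => psg z.1 f z.2).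
Proof.
move=> bf.
rewrite [X in measurable_fun _ X](_ : _ = (fun z : R * T =>
   fine (P z.1 (EFin \o f^\+) z.2) - fine (P z.1 (EFin \o f^\-) z.2))).
  apply: measurable_funB; apply: measurableT_comp => //;
    [have [] := sg_nnm2 (bint_nnm (bint_pos bf) (funrpos_ge0 f))|
     have [] := sg_nnm2 (bint_nnm (bint_neg bf) (funrneg_ge0 f))] => //.
by apply/funext => z; rewrite psg_posBneg.
Qed.

Lemma measurable_psg t f : bint m f -> measurable_fun [set: T] (psg t f).
Proof.
move=> bf; rewrite [X in measurable_fun _ X](_ : _ =
  (fun z : R * T => psg z.1 f z.2) \o (fun x => (t, x))) //.
by apply: measurableT_comp; [exact: measurable_psg2|exact: measurable_pair1].
Qed.

Lemma bint_psg t f : 0 <= t -> bint m f -> bint m (psg t f).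
Proof.
move=> t0 bf; split; first exact: measurable_psg.
  by have [_ [M fM] _] := bf; exists M => x; exact: psg_bound.
have bn := bint_norm bf.
have nn : nnm (EFin \o (fun x => `|f x|)) by exact: (bint_nnm bn).
apply/integrableP; split; first by apply/measurable_EFinP; exact: measurable_psg.
have fin : (\int[m]_x (`|f x|)%:E < +oo)%E by have [_ _ /integrableP[_]] := bf.
apply: le_lt_trans fin; apply: le_trans (sg_integral_le t0 nn).
apply: nnm_le_integral; [split => //|exact: sg_nnm|].
  apply: measurableT_comp => //; apply/measurable_EFinP.
  exact: measurable_psg.
by move=> x; rewrite -EFin_psg//= lee_fin psg_norm.
Qed.

Lemma psg_add s t f x : 0 <= s -> 0 <= t -> bint m f ->
  psg (s + t) f x = psg s (psg t f) x.
Proof.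
move=> s0 t0 bf.
have ge0case g : bint m g -> (forall x, 0 <= g x) ->
    psg (s + t) g x = psg s (psg t g) x.
  move=> bg g0; apply: EFin_inj; rewrite !EFin_psg//; last exact: bint_psg.
  rewrite (sg_add kP s0 t0 (bint_nnm bg g0)).
  by apply: eq_integral => y _ /=; rewrite EFin_psg.
have bp := bint_pos bf; have bn := bint_neg bf.
rewrite (psg_posBneg (s + t) x bf) (ge0case f^\+ bp (funrpos_ge0 f)) (ge0case f^\- bn (funrneg_ge0 f)).
rewrite -(psgB _ _ (bint_psg t0 bp) (bint_psg t0 bn)).
by apply: eq_Rintegral => y _; rewrite (psg_posBneg t y bf).
Qed.

(** Symmetry is given for nonnegative functions; both sides are expanded into four terms by positive
    and negative parts, and the mixed terms exchange places. *)
Lemma dot_psg t f g : 0 <= t -> bint m f -> bint m g ->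
  dot m f (psg t g) = dot m g (psg t f).
Proof.
move=> t0 bf bg.
have ge0case u v : bint m u -> bint m v -> (forall x, 0 <= u x) ->
    (forall x, 0 <= v x) -> dot m u (psg t v) = dot m v (psg t u).
  move=> bu bv u0 v0; apply: EFin_inj; rewrite !EFin_dot//; try exact: bint_psg.
  have := sg_sym kP t0 (bint_nnm bu u0) (bint_nnm bv v0).
  under eq_integral do rewrite -EFin_psg//.
  by under [in RHS]eq_integral do rewrite -EFin_psg//.
have bfp := bint_pos bf; have bfn := bint_neg bf.
have bgp := bint_pos bg; have bgn := bint_neg bg.
have dec u v : bint m u -> bint m v -> dot m u (psg t v) =
    dot m u^\+ (psg t v^\+) - dot m u^\+ (psg t v^\-) -
    (dot m u^\- (psg t v^\+) - dot m u^\- (psg t v^\-)).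
  move=> bu bv.
  have bup := bint_pos bu; have bun := bint_neg bu.
  have bvp := bint_pos bv; have bvn := bint_neg bv.
  have Svp := bint_psg t0 bvp; have Svn := bint_psg t0 bvn.
  rewrite -(dotBr Svp Svn bup) -(dotBr Svp Svn bun).
  rewrite -(dotBl bup bun (bintB Svp Svn)).
  by apply: eq_Rintegral => x _; rewrite (bint_posBneg u) (psg_posBneg t x bv).
have fp0 := funrpos_ge0 f; have fn0 := funrneg_ge0 f.
have gp0 := funrpos_ge0 g; have gn0 := funrneg_ge0 g.
have e1 := dec f g bf bg; have e2 := dec g f bg bf.
have h1 := ge0case _ _ bfp bgp fp0 gp0; have h2 := ge0case _ _ bfp bgn fp0 gn0.
have h3 := ge0case _ _ bfn bgp fn0 gp0; have h4 := ge0case _ _ bfn bgn fn0 gn0.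
apply: (etrans e1); apply: (etrans _ (esym e2)).
have swap (a b c e a' b' c' e' : R) : a = a' -> b = b' -> c = c' -> e = e' ->
  a - b - (c - e) = a' - c' - (b' - e') by move=> -> -> -> ->; ring.
exact: (swap _ _ _ _ _ _ _ _ h1 h2 h3 h4).
Qed.

Lemma bint_integral_psg_le t f : 0 <= t -> bint m f -> (forall x, 0 <= f x) ->
  \int[m]_x psg t f x <= \int[m]_x f x.
Proof.
move=> t0 bf f0; have bSf := bint_psg t0 bf.
rewrite -lee_fin /Rintegral.
rewrite (fineK (integrable_fin_num measurableT (bint_integrable bSf))).
rewrite (fineK (integrable_fin_num measurableT (bint_integrable bf))).
have := sg_integral_le t0 (bint_nnm bf f0).
by under eq_integral do rewrite -(EFin_psg _ _ bf).
Qed.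

End SubMarkovSemigroup.

Lemma exponent_bounds (R : realType) (p : R) : p <= 2 -> p - 1 <= 1 /\ p / 2 - 1 <= 0.
Proof. by move=> p2; split; lra. Qed.

(** * Regularized powers *)

Section RegularizedPower.
Context {R : realType}.
Variables (p e : R).
Hypotheses (p1 : 1 < p) (p2 : p <= 2) (e0 : 0 < e).
Implicit Types a b s x : R.

Lemma scaleRE a b : a *: b = a * b. Proof. by []. Qed.

Let pB1_le1 : p - 1 <= 1. Proof. by have [] := exponent_bounds p2. Qed.
Let p2B1_le0 : p / 2 - 1 <= 0. Proof. by have [] := exponent_bounds p2. Qed.

(* [pPhi] regularizes [|s| ^ p / p]: its second derivative lies between
   [(p - 1) (s ^ 2 + e ^ 2) ^ (p / 2 - 1)] and [e ^ (p - 2)]; [pphi] is its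
   first derivative. *)
Definition pweight s : R := s ^+ 2 + e ^+ 2.
Definition pphi s : R := s * pweight s `^ (p / 2 - 1).
Definition pPhi s : R := (pweight s `^ (p / 2) - e `^ p) / p.

Lemma pweight_gt0 s : 0 < pweight s.
Proof. by rewrite ltr_wpDl ?sqr_ge0// exprn_gt0. Qed.

Lemma is_derive_pweight s : is_derive s 1 pweight (2 * s).
Proof.
apply: is_derive_eq; rewrite addr0.
by rewrite scaleRE; ring.
Qed.

Lemma is_derive_pweight_powR q s :
  is_derive s 1 (fun s => pweight s `^ q) (q * pweight s `^ (q - 1) * (2 * s)).
Proof.
apply: (@is_derive1_comp _ (fun x => x `^ q) pweight).
  by apply: is_derive1_powR; exact: pweight_gt0.
exact: is_derive_pweight.
Qed.

(** The second derivative of [pPhi], with the two terms of the product rule brought to the common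
    power [p / 2 - 2] of the weight. *)
Definition pphi' s : R :=
  ((p - 1) * s ^+ 2 + e ^+ 2) * pweight s `^ (p / 2 - 2).

Lemma pweight_powRS q s : pweight s `^ q = pweight s * pweight s `^ (q - 1).
Proof.
rewrite -{2}(powRr1 (ltW (pweight_gt0 s))) -powRD ?subrKC ?addrC ?subrK//.
by rewrite (gt_eqF (pweight_gt0 s)) implybT.
Qed.

Lemma is_derive_pphi s : is_derive s 1 pphi (pphi' s).
Proof.
have h := is_derive_pweight_powR (p / 2 - 1) s.
have : is_derive s 1 (id * (fun s => pweight s `^ (p / 2 - 1)))
    (s *: ((p / 2 - 1) * pweight s `^ (p / 2 - 1 - 1) * (2 * s)) +
     pweight s `^ (p / 2 - 1) *: 1) by exact: is_deriveM.
move=> {}h; apply: (@is_derive_eq _ _ _ _ _ _ _ _ h).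
rewrite /pphi' /= !scaleRE (pweight_powRS (p / 2 - 1)).
have -> : p / 2 - 1 - 1 = p / 2 - 2 by lra.
by rewrite {2}/pweight; field.
Qed.

Lemma is_derive_pPhi s : is_derive s 1 pPhi (pphi s).
Proof.
have h := is_derive_pweight_powR (p / 2) s.
have h2 : is_derive s 1 (p^-1 \*: ((fun s => pweight s `^ (p / 2)) - cst (e `^ p)))
  (p^-1 *: (p / 2 * pweight s `^ (p / 2 - 1) * (2 * s) - 0)).
  by apply: is_deriveZ; apply: is_deriveB.
have -> : pPhi = p^-1 \*: ((fun s => pweight s `^ (p / 2)) - cst (e `^ p)).
  by apply/funext => x; rewrite /pPhi mulrC.
apply: (@is_derive_eq _ _ _ _ _ _ _ _ h2).
rewrite scaleRE subr0 /pphi; by field; rewrite gt_eqF// (lt_trans ltr01).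
Qed.

Lemma differentiable_continuous_at (f f' : R -> R) :
  (forall s, is_derive s 1 f (f' s)) -> continuous f.
Proof.
move=> fd s; apply/differentiable_continuous/derivable1_diffP.
by have [] := fd s.
Qed.

Lemma mean_value (f f' : R -> R) : (forall s, is_derive s 1 f (f' s)) ->
  forall a b, a <= b -> exists2 c, a <= c <= b & f b - f a = f' c * (b - a).
Proof.
move=> fd a b ab.
have fc : {within `[a, b], continuous f}.
  by apply: continuous_subspaceT; exact: differentiable_continuous_at fd.
have [c] := MVT_segment ab (fun x _ => fd x) fc.
by rewrite in_itv/= => cab fE; exists c.
Qed.

Lemma ler_powR_neg x y q : 0 < x -> x <= y -> q <= 0 -> y `^ q <= x `^ q.
Proof.
move=> x0 xy q0; have y0 : 0 < y by exact: lt_le_trans xy.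
rewrite -[q]opprK !(powRN _ (- q)) lef_pV2 ?posrE ?powR_gt0//.
by apply: ge0_ler_powR; rewrite ?nnegrE ?oppr_ge0// ltW.
Qed.

(** As [p - 1 <= 1], the first factor is at most the weight; the remaining power [p / 2 - 1] is
    nonpositive, so that it is largest at the minimum [e ^ 2] of the weight. *)
Lemma pphi'_le s : pphi' s <= e `^ (p - 2).
Proof.
have w0 := pweight_gt0 s.
have -> : e `^ (p - 2) = (e ^+ 2) `^ (p / 2 - 1).
  by rewrite -powR_mulrn ?(ltW e0)// -powRrM; congr (_ `^ _); field.
apply: le_trans (_ : pweight s `^ (p / 2 - 1) <= _).
  rewrite /pphi' (pweight_powRS (p / 2 - 1)).
  have -> : p / 2 - 1 - 1 = p / 2 - 2 by lra.
  apply: ler_wpM2r; first exact: powR_ge0.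
  by rewrite /pweight lerD2r ler_piMl ?sqr_ge0.
apply: ler_powR_neg; [by rewrite exprn_gt0| |exact: p2B1_le0].
by rewrite /pweight lerDr sqr_ge0.
Qed.

Lemma pphi'_ge s : (p - 1) * pweight s `^ (p / 2 - 1) <= pphi' s.
Proof.
rewrite /pphi' (pweight_powRS (p / 2 - 1)) mulrA.
have -> : p / 2 - 1 - 1 = p / 2 - 2 by lra.
apply: ler_wpM2r; first exact: powR_ge0.
by rewrite /pweight mulrDr lerD2l ler_piMl ?sqr_ge0.
Qed.

Lemma pphi'_ge0 s : 0 <= pphi' s.
Proof. by apply: le_trans (pphi'_ge s); rewrite mulr_ge0 ?powR_ge0// subr_ge0 ltW. Qed.

Lemma pphi_mono a b : a <= b -> pphi a <= pphi b.
Proof.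
move=> ab; have [c _ h] := mean_value is_derive_pphi ab.
by rewrite -subr_ge0 h mulr_ge0 ?pphi'_ge0// subr_ge0.
Qed.

Lemma measurable_pphi : measurable_fun [set: R] pphi.
Proof.
by apply: continuous_measurable_fun; exact: differentiable_continuous_at is_derive_pphi.
Qed.

Lemma measurable_pPhi : measurable_fun [set: R] pPhi.
Proof.
by apply: continuous_measurable_fun; exact: differentiable_continuous_at is_derive_pPhi.
Qed.

Lemma pphi0 : pphi 0 = 0. Proof. by rewrite /pphi mul0r. Qed.

Lemma pphi_lipschitz a b : `|pphi a - pphi b| <= e `^ (p - 2) * `|a - b|.
Proof.
wlog ab : a b / b <= a.
  move=> H; case: (leP b a) => [|/ltW] ba; first exact: H.
  by rewrite distrC (distrC a b); exact: H.
have [c _ ->] := mean_value is_derive_pphi ab.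
by rewrite normrM; apply: ler_wpM2r => //; rewrite ger0_norm ?pphi'_ge0 ?pphi'_le.
Qed.

Lemma pphi_norm a : `|pphi a| <= e `^ (p - 2) * `|a|.
Proof. by have := pphi_lipschitz a 0; rewrite pphi0 !subr0. Qed.

(** By the mean value theorem the increment of [pphi] is [pphi' c * (b - a)] with [c] between [a]
    and [b]. Hence [c ^ 2] is at most the maximum, and the nonpositive exponent reverses the
    comparison of the weights. *)
Lemma pphi_coercive a b :
  (p - 1) * ((b - a) ^+ 2 * (Num.max (a ^+ 2) (b ^+ 2) + e ^+ 2) `^ (p / 2 - 1)) <=
  (pphi b - pphi a) * (b - a).
Proof.
wlog ab : a b / a <= b.
  move=> H; case: (leP a b) => [|/ltW] ba; first exact: H.
  have := H b a ba; rewrite maxC; rewrite -[(a - b) ^+ 2]sqrrN opprB => /le_trans; apply.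
  by rewrite le_eqVlt; apply/orP; left; apply/eqP; ring.
have [c /andP[ac cb] ->] := mean_value is_derive_pphi ab.
rewrite -mulrA -expr2 mulrCA -[leRHS]mulrC; apply: ler_wpM2l; first exact: sqr_ge0.
apply: le_trans (pphi'_ge c); apply: ler_wpM2l; first by rewrite subr_ge0 ltW.
apply: ler_powR_neg; [exact: pweight_gt0| |exact: p2B1_le0].
rewrite /pweight lerD2r le_max; apply/orP.
have [c0|c0] := leP 0 c; [right|left].
  by rewrite ler_sqr ?nnegrE// (le_trans c0).
by rewrite -(sqrrN a) -(sqrrN c) ler_sqr ?nnegrE ?lerN2// oppr_ge0 ?(le_trans ac)// ltW.
Qed.

Lemma pPhi_convex a b : pphi b * (a - b) <= pPhi a - pPhi b.
Proof.
have [ab|/ltW ba] := leP a b.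
  have [c /andP[ac cb] h] := mean_value is_derive_pPhi ab.
  rewrite -(opprB b a) mulrN -(opprB (pPhi b)) h lerN2.
  by apply: ler_wpM2r; rewrite ?subr_ge0// pphi_mono.
have [c /andP[ac cb] ->] := mean_value is_derive_pPhi ba.
by apply: ler_wpM2r; rewrite ?subr_ge0// pphi_mono.
Qed.

Lemma pPhi0 : pPhi 0 = 0.
Proof.
rewrite /pPhi /pweight expr0n add0r -powR_mulrn ?(ltW e0)// -powRrM.
have -> : 2%:R * (p / 2) = p by field.
by rewrite subrr mul0r.
Qed.

Lemma pPhi_ge0 a : 0 <= pPhi a.
Proof. by have := pPhi_convex a 0; rewrite pphi0 pPhi0 mul0r subr0. Qed.

Lemma pPhi_le_sqr a : pPhi a <= e `^ (p - 2) * a ^+ 2.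
Proof.
have := pPhi_convex 0 a; rewrite pPhi0 !sub0r mulrN lerN2 => /le_trans; apply.
apply: le_trans (ler_norm _) _; rewrite normrM -real_normK ?num_real//.
by rewrite expr2 mulrA; apply: ler_wpM2r => //; exact: pphi_norm.
Qed.

(** With [q = p / 2 - 1 <= 0], the power [p / 2] of [a ^ 2 + e ^ 2] is
    [(a ^ 2 + e ^ 2) (a ^ 2 + e ^ 2) ^ q], at most [|a| ^ p + e ^ p]. The bound is uniform in [e],
    which is what the limit [e -> 0] needs. *)
Lemma pPhi_le_powR a : pPhi a <= `|a| `^ p / p.
Proof.
have p0 : 0 < p by exact: lt_trans p1.
rewrite /pPhi ler_pM2r ?invr_gt0// lerBlDr.
have [->|an] := eqVneq a 0.
  rewrite /pweight expr0n add0r -[in leLHS]powR_mulrn ?(ltW e0)// -powRrM.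
  have -> : 2%:R * (p / 2) = p by field.
  by rewrite lerDr powR_ge0.
have a0 : 0 < a ^+ 2 by rewrite exprn_even_gt0.
have ee : 0 < e ^+ 2 by rewrite exprn_gt0.
have sq (x : R) : 0 <= x -> x `^ p = x ^+ 2 * (x ^+ 2) `^ (p / 2 - 1).
  move=> x0; have [->|xn] := eqVneq x 0; first by rewrite powR0 ?gt_eqF// expr0n mul0r.
  have x2 : 0 < x ^+ 2 by rewrite exprn_even_gt0.
  rewrite -{1}[x ^+ 2](powRr1 (ltW x2)) -powRD ?(gt_eqF x2) ?implybT//.
  by rewrite -[in RHS]powR_mulrn// -powRrM; congr (_ `^ _); field.
rewrite (sq `|a|)// (sq e (ltW e0)) real_normK ?num_real//.
rewrite (pweight_powRS (p / 2)) {1}/pweight mulrDl; apply: lerD.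
  apply: ler_wpM2l; first exact: ltW.
  by apply: ler_powR_neg => //; rewrite /pweight lerDl ltW.
apply: ler_wpM2l; first exact: ltW.
by apply: ler_powR_neg => //; rewrite /pweight lerDr ltW.
Qed.

End RegularizedPower.

(** * Difference quotients of nonincreasing midpoint convex functions *)

Section ConvexSlope.
Context {R : realType}.
Variable a : R -> R.
Hypothesis a_ge0 : forall t, 0 <= t -> 0 <= a t.
Hypothesis a_nincr : forall t s, 0 <= t -> 0 <= s -> a (t + s) <= a t.
Hypothesis a_midconvex : forall t s, 0 <= t -> 0 <= s ->
  2 * a (t + s) <= a t + a (t + s + s).
Implicit Types (t s : R) (n : nat).

Let shiftS t s n : t + n.+1%:R * s = t + n%:R * s + s.
Proof. by rewrite -natr1; ring. Qed.

Let ge0S t s n : 0 <= t -> 0 <= s -> 0 <= t + n%:R * s.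
Proof. by move=> t0 s0; rewrite addr_ge0// mulr_ge0. Qed.

Lemma convex_increment_decr t s n : 0 <= t -> 0 <= s ->
  a (t + n.+1%:R * s) - a (t + n.+2%:R * s) <=
  a (t + n%:R * s) - a (t + n.+1%:R * s).
Proof.
move=> t0 s0; rewrite !shiftS; have := a_midconvex (ge0S n t0 s0) s0.
set x := a _; set y := a _; set z := a _.
by move=> h; lra.
Qed.

Lemma convex_chord t s n : 0 <= t -> 0 <= s ->
  a t - a (t + n%:R * s) <= n%:R * (a t - a (t + s)).
Proof.
move=> t0 s0.
have first k : a (t + k%:R * s) - a (t + k.+1%:R * s) <= a t - a (t + s).
  elim: k => [|k IH]; first by rewrite mul0r addr0 mul1r.
  exact: le_trans (convex_increment_decr k t0 s0) IH.
elim: n => [|n IH]; first by rewrite !mul0r addr0 subrr.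
have h := lerD IH (first n); rewrite addrA subrK in h.
by apply: le_trans h _; rewrite -natr1 mulrDl mul1r.
Qed.

Lemma convex_last_increment t s n : 0 <= t -> 0 <= s ->
  n%:R * (a (t + n%:R * s) - a (t + n%:R * s + s)) <= a t - a (t + n%:R * s).
Proof.
move=> t0 s0; elim: n => [|n IH]; first by rewrite !mul0r addr0 subrr.
have dec := convex_increment_decr n t0 s0.
have step : n%:R * (a (t + n.+1%:R * s) - a (t + n.+2%:R * s)) <=
    n%:R * (a (t + n%:R * s) - a (t + n.+1%:R * s)) by exact: ler_wpM2l.
rewrite -shiftS in IH; rewrite -shiftS.
have h := lerD (le_trans step IH) dec; rewrite [X in _ <= X]addrA subrK in h.
by apply: le_trans h; rewrite -{1}[n.+1%:R]natr1 mulrDl mul1r.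
Qed.

(** The interval [[0, 2 t]] contains [n = floor (2 t / s)] steps of length [s] ending at [2 t]. Each
    of their decrements is at least the next one, the one in the statement, and together they are at
    most [a 0]. Finally [n s >= t], because [2 t < n s + s] and [s <= t]. *)
Lemma convex_slope_bound t s : 0 < t -> 0 < s -> s <= t ->
  a (2 * t) - a (2 * t + s) <= a 0 / t * s.
Proof.
move=> t0 s0 st; pose n := Num.truncn (2 * t / s).
have ts0 : 0 <= 2 * t / s by rewrite divr_ge0 ?mulr_ge0 ?ltW.
have n1 : n%:R * s <= 2 * t by rewrite -ler_pdivlMr// truncn_le.
have n2 : 2 * t < n%:R * s + s.
  by rewrite -[ltRHS](_ : n.+1%:R * s = _) -?ltr_pdivrMr ?truncnS_gt// -natr1 mulrDl mul1r.
pose r := 2 * t - n%:R * s.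
have r0 : 0 <= r by rewrite subr_ge0.
have := convex_last_increment n r0 (ltW s0); rewrite /r subrK -/r.
set D := a (2 * t) - _ => h.
have tD : n%:R * D <= a 0.
  apply: le_trans h _; rewrite lerBlDr.
  have := a_nincr (lexx 0) r0; rewrite add0r => /le_trans; apply.
  by rewrite lerDl a_ge0// mulr_ge0 ?ltW.
have D0 : 0 <= D by rewrite subr_ge0 a_nincr ?mulr_ge0 ?ltW.
have tn : t <= n%:R * s by move: n2 st; set x := n%:R * s => h1 h2; lra.
rewrite mulrAC ler_pdivlMr//.
apply: le_trans (_ : D * (n%:R * s) <= _); first exact: ler_wpM2l.
by rewrite mulrA (mulrC D); apply: ler_wpM2r => //; exact: ltW.
Qed.

(** The limit is the supremum of the slopes over []0, 1]]. Midpoint convexity compares the slope at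
    [s] only with slopes at multiples of [s]; monotonicity reaches the other points with a loss
    [r / (r + s)], which tends to 1. *)
Lemma convex_slope_cvg (M : R) :
  (forall s, 0 < s -> s <= 1 -> a 0 - a s <= M * s) ->
  cvg (s^-1 * (a 0 - a s) @[s --> 0^'+]).
Proof.
move=> aM; pose g s := a 0 - a s.
have g_ge0 s : 0 <= s -> 0 <= g s.
  by move=> s0; rewrite subr_ge0; have := a_nincr (lexx 0) s0; rewrite add0r.
pose A := [set s^-1 * g s | s in [set s | 0 < s /\ s <= 1]].
have A1 : A (1^-1 * g 1) by exists 1.
have Aub : ubound A M.
  by move=> _ [s [s0 s1] <-]; rewrite mulrC ler_pdivrMr//; exact: aM.
have supA : has_sup A by split; [exists (1^-1 * g 1)|exists M].
apply/cvg_ex; exists (sup A); apply/cvgrPdist_le => e e0.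
have [_ [r [r0 r1] <-] rA] := sup_adherent e0 supA.
have gr0 := g_ge0 r (ltW r0).
(* with [n s] in [[r, r + s)], [g s / s >= g (n s) / (n s) >= g r / (r + s)] *)
have key s : 0 < s -> g r / (r + s) <= s^-1 * g s.
  move=> s0; pose n := (Num.truncn (r / s)).+1.
  have n1 : r <= n%:R * s by rewrite -ler_pdivrMr// ltW// truncnS_gt.
  have n2 : n%:R * s <= r + s.
    rewrite -natr1 mulrDl mul1r lerD2r -ler_pdivlMr//.
    by rewrite truncn_le divr_ge0 ?ltW.
  have grn : g r <= n%:R * g s.
    have := convex_chord n (lexx 0) (ltW s0); rewrite !add0r => h.
    apply: le_trans h; rewrite lerB//.
    have := a_nincr (ltW r0) (_ : 0 <= n%:R * s - r).
    by rewrite subrKC subr_ge0 => ->.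
  have rs0 : 0 < r + s by rewrite addr_gt0.
  rewrite ler_pdivrMr// -(ler_pM2l s0) !mulrA divff ?gt_eqF// mul1r.
  apply: le_trans (ler_wpM2l (ltW s0) grn) _.
  rewrite mulrA (mulrC s n%:R) [leLHS]mulrC; apply: ler_wpM2l => //.
  exact: g_ge0 (ltW s0).
have lim : g r / (r + s) @[s --> 0^'+] --> g r / r.
  apply: cvgMr; apply: cvgV; first by rewrite gt_eqF.
  rewrite -[X in _ --> X]addr0; apply: cvgD; first exact: cvg_cst.
  by apply: cvg_at_right_filter; exact: cvg_id.
have rA' : sup A - e < g r / r by rewrite mulrC.
have rlim : \forall s \near 0^'+, sup A - e < g r / (r + s).
  by apply: (cvgr_gt (g r / r)).
near=> s.
have s0 : 0 < s by near: s; exact: nbhs_right_gt.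
have s1 : s <= 1 by near: s; exact: nbhs_right_le.
have up : s^-1 * g s <= sup A by apply: sup_upper_bound => //; exists s.
rewrite ger0_norm ?subr_ge0// lerBlDl -lerBlDr.
apply: le_trans (key s s0).
apply: ltW; near: s; exact: rlim.
Unshelve. all: by end_near. Qed.

End ConvexSlope.

Opaque dot psg.

(** * The form domain of the semigroup *)

Section EnergyGap.
Context {d : measure_display} {T : measurableType d} {R : realType}.
Variable m : {measure set T -> \bar R}.
Variable k : R -> T -> {measure set T -> \bar R}.
Hypothesis kP : symmetric_semigroup m k.
Implicit Types u v f : T -> R.
Local Notation P t := (psg k t).
Local Notation dot := (dot m).

(** The quotient [gap u s / s] is the approximate energy at time scale [s]. In [form_domain] these
    quotients are only required to be bounded on []0, 1]]; convexity then makes them converge. *)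
Definition gap u s : R := dot u u - dot u (P s u).

Definition form_domain u : Prop :=
  bint m u /\ exists M : R, forall s, 0 < s -> s <= 1 -> gap u s <= M * s.

Let q s x : R := fine (k s x [set: T]).

Lemma sg_massE s x : k s x [set: T] = (q s x)%:E.
Proof.
rewrite fineK// ge0_fin_numE//.
by apply: le_lt_trans (sg_le1 kP s x) _; rewrite ltry.
Qed.

Lemma sg_mass_bounds s x : 0 <= q s x <= 1.
Proof. by rewrite -!lee_fin -sg_massE measure_ge0 (sg_le1 kP). Qed.

Lemma measurable_sg_mass s : measurable_fun [set: T] (q s).
Proof.
by apply: measurableT_comp => //; exact: (sg_measurable1 kP).
Qed.

Lemma sg_integrable_cst s x (c : R) : (k s x).-integrable [set: T] (EFin \o (fun=> c)).
Proof.
apply: (sg_integrable kP); first exact: measurable_cst.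
by exists `|c|.
Qed.

Lemma sg_square_expansion s x u : bint m u ->
  \int[k s x]_y ((u x - u y) ^+ 2) =
  u x ^+ 2 * q s x - 2 * u x * P s u x + P s (fun y => u y * u y) x.
Proof.
move=> bu; have buu := bintM bu bu.
have i1 := sg_integrable_cst s x (u x ^+ 2).
have i2 := bint_sg_integrable kP s x (bintZ (- (2 * u x)) bu).
have i0 := bint_sg_integrable kP s x bu.
have i3 := bint_sg_integrable kP s x buu.
transitivity (\int[k s x]_y ((u x ^+ 2 + (- (2 * u x) * u y)) + u y * u y)).
  by apply: eq_Rintegral => y _; ring.
rewrite (RintegralD measurableT (integrableD measurableT i1 i2) i3).
rewrite (RintegralD measurableT i1 i2) (RintegralZl _ measurableT i0).
by rewrite Rintegral_cst// mulNr.
Qed.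

(* A jump part plus a killing part, each decreased by a contraction of [u]. *)
Definition energy_density s u x : R :=
  2^-1 * \int[k s x]_y ((u x - u y) ^+ 2) + u x ^+ 2 * (1 - q s x).

Lemma bint_sq_mass s u : bint m u -> bint m (fun x => u x ^+ 2 * q s x).
Proof.
move=> bu; have buu := bintM bu bu.
apply: (bint_dom (c := 1)) buu.
  apply: measurable_funM; last exact: measurable_sg_mass.
  by apply: measurable_funX; exact: bint_measurable bu.
move=> x; have /andP[q0 q1] := sg_mass_bounds s x.
by rewrite normrM mul1r -expr2 ler_piMr// ger0_norm.
Qed.

Lemma energy_densityE s u x : bint m u -> energy_density s u x =
  u x * u x - u x * P s u x +
  2^-1 * (P s (fun y => u y * u y) x - u x ^+ 2 * q s x).
Proof.
by move=> bu; rewrite /energy_density sg_square_expansion//; field.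
Qed.

Lemma integral_sq_mass s u : 0 <= s -> bint m u ->
  \int[m]_x (u x ^+ 2 * q s x) = \int[m]_x P s (fun y => u y * u y) x.
Proof.
move=> s0 bu; have buu := bintM bu bu.
have u20 : nnm (EFin \o (fun y => u y * u y)).
  by apply: (bint_nnm buu) => y; rewrite -expr2 sqr_ge0.
have := sg_sym kP s0 u20 (nnm_cst (@lee01 R)) => /(congr1 fine) h.
rewrite /Rintegral.
transitivity (fine (\int[m]_x ((EFin \o (fun y => (u y * u y)%R)) x *
    kint (k s) (fun=> 1%E) x))%E).
  congr fine; apply: eq_integral => x _ /=.
  by rewrite /kint integral_cst// mul1e sg_massE -EFinM expr2.
rewrite h; congr fine; apply: eq_integral => x _.
by rewrite mul1e (EFin_psg kP).
Qed.

Lemma bint_energy_density s u : 0 <= s -> bint m u -> bint m (energy_density s u).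
Proof.
move=> s0 bu.
have -> : energy_density s u = (fun x => (u x * u x - u x * P s u x) +
  2^-1 * (P s (fun y => u y * u y) x - u x ^+ 2 * q s x)).
  by apply/funext => x; rewrite energy_densityE.
have bPu := bint_psg kP s0 bu.
apply: bintD; first by apply: bintB; exact: bintM.
apply: bintZ; apply: bintB; last exact: bint_sq_mass.
by apply: (bint_psg kP s0); exact: bintM.
Qed.

(** The correction in [energy_densityE] is half of [P_s (u ^ 2) - u ^ 2 P_s 1], whose integral
    vanishes by symmetry. *)
Lemma gap_energy s u : 0 <= s -> bint m u ->
  gap u s = \int[m]_x energy_density s u x.
Proof.
move=> s0 bu; have bPu := bint_psg kP s0 bu.
have buu := bintM bu bu; have buPu := bintM bu bPu.
have bPuu := bint_psg kP s0 buu; have bq := bint_sq_mass s bu.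
under eq_Rintegral do rewrite energy_densityE//.
rewrite RintegralD//; [|exact: bint_integrable (bintB buu buPu)|
  exact: bint_integrable (bintZ _ (bintB bPuu bq))].
rewrite RintegralB//; [|exact: bint_integrable buu|exact: bint_integrable buPu].
rewrite RintegralZl//; last exact: bint_integrable (bintB bPuu bq).
rewrite RintegralB//; [|exact: bint_integrable bPuu|exact: bint_integrable bq].
by rewrite integral_sq_mass// subrr mulr0 addr0.
Qed.

Section Lipschitz.
Variables (phi : R -> R) (L : R).
Hypotheses (mphi : measurable_fun [set: R] phi) (phi0 : phi 0 = 0).
Hypothesis phiL : forall a b, `|phi a - phi b| <= L * `|a - b|.

Lemma bint_lipschitz u : bint m u -> bint m (fun x => phi (u x)).
Proof.
move=> bu; apply: (bint_dom (c := L)) (bu).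
  by apply: measurableT_comp => //; exact: bint_measurable bu.
by move=> x; have := phiL (u x) 0; rewrite phi0 !subr0.
Qed.

Let L2 a b : (phi a - phi b) ^+ 2 <= L ^+ 2 * (a - b) ^+ 2.
Proof.
rewrite -[leLHS]real_normK ?num_real// -[(a - b) ^+ 2]real_normK ?num_real//.
rewrite -exprMn; apply: lerXn2r; rewrite ?nnegrE//.
exact: le_trans (normr_ge0 _) (phiL a b).
Qed.

Lemma gap_lipschitz s u : 0 <= s -> bint m u ->
  gap (fun x => phi (u x)) s <= L ^+ 2 * gap u s.
Proof.
move=> s0 bu; have bv := bint_lipschitz bu.
rewrite !gap_energy// -RintegralZl//; last first.
  exact: bint_integrable (bint_energy_density s0 bu).
apply: le_Rintegral => //.
- exact: bint_integrable (bint_energy_density s0 bv).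
- exact: bint_integrable (bintZ _ (bint_energy_density s0 bu)).
move=> x _; rewrite /energy_density [leRHS]mulrDr; apply: lerD; last first.
  have /andP[q0 q1] := sg_mass_bounds s x.
  rewrite mulrA; apply: ler_wpM2r; first by rewrite subr_ge0.
  by have := L2 (u x) 0; rewrite phi0 !subr0.
rewrite mulrCA; apply: ler_wpM2l; first by rewrite invr_ge0.
have sqi w : bint m w ->
    (k s x).-integrable [set: T] (fun y => ((w x - w y) ^+ 2)%:E).
  move=> [mw [M wM] _]; apply: (sg_integrable kP).
    by apply: measurable_funX; apply: measurable_funB.
  exists ((M + M) ^+ 2) => y; rewrite normrX; apply: lerXn2r.
  - by rewrite nnegrE.
  - by rewrite nnegrE (le_trans (normr_ge0 _) (ler_wpDl _ (wM x)))// (le_trans (normr_ge0 _) (wM x)).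
  - exact: le_trans (ler_normB _ _) (lerD (wM x) (wM y)).
rewrite -RintegralZl//; last exact: sqi.
apply: le_Rintegral => //; first exact: sqi bv.
  have := integrableZl measurableT (L ^+ 2) (sqi u bu).
  by apply: eq_integrable => // y _; rewrite EFinM.
Qed.

Lemma form_domain_lipschitz u : form_domain u -> form_domain (fun x => phi (u x)).
Proof.
move=> [bu [M gM]]; split; first exact: bint_lipschitz.
exists (L ^+ 2 * M) => s s0 s1.
apply: le_trans (gap_lipschitz (ltW s0) bu) _; rewrite -mulrA.
by apply: ler_wpM2l; [exact: sqr_ge0|exact: gM].
Qed.

End Lipschitz.

Definition correlation u t : R := dot u (P t u).

Lemma dot_psg_psg s t u : 0 <= s -> 0 <= t -> bint m u ->
  dot (P s u) (P t u) = correlation u (s + t).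
Proof.
move=> s0 t0 bu; rewrite /correlation.
have bPt := bint_psg kP t0 bu.
have -> : P (s + t) u = P s (P t u).
  by apply/funext => x; exact: (psg_add kP).
rewrite (dot_psg kP s0 bu bPt); exact: dotC.
Qed.

Lemma correlation0 u : bint m u -> correlation u 0 = dot u u.
Proof.
move=> bu; rewrite /correlation.
by have -> : P 0 u = u by apply/funext => x; exact: (psg0 kP x bu).
Qed.

Lemma correlation_ge0 u t : bint m u -> 0 <= t -> 0 <= correlation u t.
Proof.
move=> bu t0; have h : 0 <= t / 2 by rewrite divr_ge0.
by rewrite (splitr t) -dot_psg_psg// dot_ge0.
Qed.

Lemma gap_ge0 u s : 0 <= s -> bint m u -> 0 <= gap u s.
Proof.
move=> s0 bu; rewrite gap_energy//; apply: Rintegral_ge0 => x _.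
have /andP[q0 q1] := sg_mass_bounds s x.
rewrite addr_ge0// mulr_ge0 ?invr_ge0 ?sqr_ge0 ?subr_ge0//.
by apply: Rintegral_ge0 => y _; exact: sqr_ge0.
Qed.

Lemma gap_psg u t s : 0 <= t -> 0 <= s -> bint m u ->
  gap (P t u) s = correlation u (t + t) - correlation u (t + t + s).
Proof.
move=> t0 s0 bu; rewrite /gap dot_psg_psg//.
have -> : P s (P t u) = P (s + t) u.
  by apply/funext => x; rewrite (psg_add kP).
rewrite dot_psg_psg ?addr_ge0//; congr (_ - correlation u _); ring.
Qed.

Lemma correlation_nincr u t s : bint m u -> 0 <= t -> 0 <= s ->
  correlation u (t + s) <= correlation u t.
Proof.
move=> bu t0 s0; have h : 0 <= t / 2 by rewrite divr_ge0.
by rewrite -subr_ge0 (splitr t) -gap_psg// gap_ge0//; exact: (bint_psg kP).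
Qed.

(** The three values are [(a, b)], [(a, a)] and [(b, b)] for [a = P_(t/2) u] and
    [b = P_(t/2 + s) u]. *)
Lemma correlation_midconvex u t s : bint m u -> 0 <= t -> 0 <= s ->
  2 * correlation u (t + s) <= correlation u t + correlation u (t + s + s).
Proof.
move=> bu t0 s0; have h : 0 <= t / 2 by rewrite divr_ge0.
have hs : 0 <= t / 2 + s by rewrite addr_ge0.
have := dot_AM_GM (bint_psg kP h bu) (bint_psg kP hs bu).
rewrite !dot_psg_psg//.
have -> : t / 2 + (t / 2 + s) = t + s by rewrite addrA -splitr.
have -> : t / 2 + t / 2 = t by rewrite -splitr.
by have -> : t / 2 + s + (t / 2 + s) = t + s + s by rewrite addrACA -splitr addrA.
Qed.

Lemma form_domain_cvg u : form_domain u ->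
  cvg (s^-1 * gap u s @[s --> 0^'+]).
Proof.
move=> [bu [M gM]].
have := @convex_slope_cvg R (correlation u)
  (fun t s t0 s0 => correlation_nincr bu t0 s0)
  (fun t s t0 s0 => correlation_midconvex bu t0 s0) M.
by rewrite correlation0//; apply.
Qed.

(** Smoothing by the semigroup: the energy of [P_t u] is at most [|u|^2 / t]. For [s <= t] this is
    the slope bound for the correlation at [2 t]; for [s >= t] the trivial bound by the squared norm
    of [P_t u] suffices. *)
Lemma form_domain_psg t u : 0 < t -> bint m u -> form_domain (P t u).
Proof.
move=> t0 bu; have bPu := bint_psg kP (ltW t0) bu; split => //.
exists (correlation u 0 / t + dot (P t u) (P t u) / t) => s s0 s1.
rewrite mulrDl; have [st|/ltW ts] := leP s t.
  have := @convex_slope_bound R (correlation u) (fun t t0 => correlation_ge0 bu t0)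
    (fun t s t0 s0 => correlation_nincr bu t0 s0)
    (fun t s t0 s0 => correlation_midconvex bu t0 s0) t s t0 s0 st.
  rewrite (gap_psg (ltW t0) (ltW s0) bu) (_ : t + t = 2 * t); last by ring.
  move=> /le_trans; apply; rewrite lerDl.
  by rewrite !mulr_ge0 ?dot_ge0 ?invr_ge0 ?(ltW t0) ?(ltW s0).
apply: le_trans (_ : dot (P t u) (P t u) <= _).
  by rewrite /gap gerBl; apply: (correlation_ge0 bPu); exact: ltW.
apply: le_trans (_ : dot (P t u) (P t u) / t * s <= _).
  rewrite mulrAC ler_pdivlMr//; apply: ler_wpM2l => //; exact: dot_ge0.
by rewrite lerDr !mulr_ge0 ?correlation_ge0 ?invr_ge0 ?(ltW t0) ?(ltW s0).
Qed.

(** Divided by [s], the right-hand side is twice the difference of two approximate energies, at the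
    scales [s] and [2 s]. For [u] in [form_domain] both have the same limit, so that the squared
    increment is [o(s)]. *)
Lemma norm_increment u s : 0 <= s -> bint m u ->
  dot (fun x => u x - P s u x) (fun x => u x - P s u x) =
  2 * gap u s - gap u (s + s).
Proof.
move=> s0 bu; have bPu := bint_psg kP s0 bu.
by rewrite (dot_sqB bu bPu) dot_psg_psg// /gap /correlation; ring.
Qed.

End EnergyGap.

Opaque pphi pPhi.

(** * Dissipation of the regularized entropy *)

Section SFiniteKernelIntegral.
Context {d d' d'' : measure_display} {X : measurableType d}
  {T : measurableType d'} {Y : measurableType d''} {R : realType}.

(** A kernel in [x] read as a kernel in [(t, x)], so that measurability of kernel integrals applies
    to integrands depending on time. *)
Definition kernel_comp_snd (N : T -> {measure set Y -> \bar R}) (z : X * T) :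
  {measure set Y -> \bar R} := N z.2.

Section Instances.
Variable N : R.-ker T ~> Y.

Let measurable_kernel_comp_snd U : measurable U ->
  measurable_fun [set: X * T] (kernel_comp_snd N ^~ U).
Proof.
move=> mU; rewrite [X in measurable_fun _ X](_ : _ = (N ^~ U) \o snd) //.
by apply: measurableT_comp; [exact: measurable_kernel|exact: measurable_snd].
Qed.

HB.instance Definition _ :=
  @isKernel.Build _ _ _ _ _ (kernel_comp_snd N) measurable_kernel_comp_snd.

End Instances.

Section SFinite.
Variable N : R.-sfker T ~> Y.

Let sfinite_kernel_comp_snd : exists2 s : (R.-ker (X * T)%type ~> Y)^nat,
  forall n, measure_fam_uub (s n) &
  forall x U, measurable U -> kernel_comp_snd N x U = kseries s x U.
Proof.
have [s s_uub sE] := sfinite_kernel_subdef N.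
exists (fun n => kernel_comp_snd (s n) : R.-ker (X * T)%type ~> Y).
  by move=> n; have [r hr] := s_uub n; exists r => z; exact: hr.
by move=> x U mU; exact: sE.
Qed.

HB.instance Definition _ := @isSFiniteKernel_subdef.Build _ _ _ _ _
  (kernel_comp_snd N) sfinite_kernel_comp_snd.

Lemma nnm_integral_sfker (F : (X * T) * Y -> \bar R) : nnm F ->
  nnm (fun z : X * T => (\int[N z.2]_y F (z, y))%E).
Proof.
move=> [mF F0]; split; last by move=> z; apply: integral_ge0 => y _.
exact: (measurable_fun_integral_sfinite_kernel F (kernel_comp_snd N)).
Qed.

End SFinite.

End SFiniteKernelIntegral.

(** * Translation invariance, lower limits and telescoping integrals *)

Section LebesgueTranslation.
Context {R : realType}.
Local Notation mu := (@lebesgue_measure R).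
Local Open Scope ereal_scope.

Lemma lebesgue_measureD (s : R) (A : set R) : measurable A ->
  pushforward mu ((fun t => t + s)%R : _ -> measurableTypeR R) A = mu A.
Proof.
have ms : measurable_fun [set: measurableTypeR R]
    ((fun t => t + s)%R : measurableTypeR R -> measurableTypeR R).
  exact: measurable_funD.
move=> mA; apply/esym/lebesgue_measure_unique => //= _ [[a b]] _ <-.
rewrite /pushforward.
have -> : (fun t : R => t + s)%R @^-1` `]a, b] = `](a - s)%R, (b - s)%R]%classic.
  by apply/seteqP; split => t /=; rewrite !in_itv/= ltrBlDr lerBrDr.
rewrite !lebesgue_measure_itv/= !lte_fin ltrD2r.
by case: ifP => // _; congr EFin; ring.
Qed.

Lemma integral_translation (s : R) (f : R -> \bar R) : nnm f ->
  \int[mu]_t f (t + s)%R = \int[mu]_t f t.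
Proof.
move=> [mf f0].
have ms : measurable_fun [set: measurableTypeR R]
    ((fun t => t + s)%R : measurableTypeR R -> measurableTypeR R).
  exact: measurable_funD.
rewrite -[LHS](@ge0_integral_pushforward _ _ _ _ _ _ ms mu setT f)//.
by apply: eq_measure_integral => A mA _; exact: lebesgue_measureD.
Qed.

Lemma integral_if {d} {T : measurableType d} (m : {measure set T -> \bar R})
    (b : T -> bool) (f : T -> \bar R) :
  \int[m]_x (if b x then f x else 0) = \int[m]_(x in [set x | b x]) f x.
Proof.
rewrite [RHS]integral_mkcond; apply: eq_integral => x _; rewrite patchE.
by case: ifPn => [bx|/negP nb]; [rewrite mem_set|rewrite memNset].
Qed.

End LebesgueTranslation.

Section LiminfMonotone.
Context {R : realType}.
Local Open Scope ereal_scope.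

Lemma le_limn_einf (u v : nat -> \bar R) :
  (forall n, u n <= v n) -> limn_einf u <= limn_einf v.
Proof.
move=> uv; rewrite !limn_einf_lim; apply: lee_lim; [exact: is_cvg_einfs..|].
apply: nearW => n; apply: le_ereal_inf_tmp => _ [i ni <-].
by apply: le_trans (uv i); apply: ereal_inf_lbound; exists i.
Qed.

Lemma le_limn_einf_cvg (u : nat -> R) (v : nat -> \bar R) (l : R) :
  (u n @[n --> \oo] --> l)%R -> (forall n, (u n)%:E <= v n) ->
  l%:E <= limn_einf v.
Proof.
move=> ul uv; apply: le_trans (le_limn_einf uv).
have /cvg_limn_einf_sup[-> _] // : (u n)%:E @[n --> \oo] --> l%:E.
by apply/fine_cvgP; split; [exact: nearW|exact: ul].
Qed.

End LiminfMonotone.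

Lemma rescaled_decrement (R : realType) (s D L g g2 : R) : s != 0 ->
  s^-1 * D - L * (2 * (s^-1 * g) - 2 * ((s + s)^-1 * g2)) =
  s^-1 * (D - L * (2 * g - g2)).
Proof.
move=> s0; have -> : s + s = 2 * s by ring.
by rewrite invfM; field.
Qed.

Section DecrementIntegral.
Context {R : realType}.
Local Notation mu := (@lebesgue_measure R).
Local Notation RT := (measurableTypeR R).

(** After a translation, the integral of [h] over []0, t1]] minus that over []s, t1 + s]] is at most
    the integral over []0, s]]. The second integral is finite; it is added to both sides and
    cancelled, since extended values do not subtract freely. *)
Lemma decrement_integral (h : R -> R) (h0 s t1 : R) : 0 <= t1 -> 0 <= s ->
  0 <= h0 -> measurable_fun [set: RT] (h : RT -> RT) ->
  (forall t, 0 <= t -> 0 <= h t) -> (forall t, 0 <= t -> h t <= h0) ->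
  (forall t, 0 <= t -> h (t + s) <= h t) ->
  (\int[mu]_t (if ((0 < t) && (t <= t1))%R then (h t - h (t + s)%R)%:E else 0) <=
   (h0 * s)%:E)%E.
Proof.
move=> t10 s0 h00 mh h_ge0 h_le h_nincr.
pose b (t : RT) := (0 < t) && (t <= t1).
have b_ge0 t : b t -> 0 <= t by case/andP => /ltW.
have mle (r : R) : measurable_fun [set: RT] (fun t : RT => (0 < t) && (t <= r)).
  by apply: measurable_and; [exact: measurable_fun_ltr|exact: measurable_fun_ler].
have mb : measurable_fun [set: RT] b := mle t1.
have mD (r : R) : measurable_fun [set: RT] (fun t : RT => t + r : RT).
  exact: measurable_funD.
have mhs : measurable_fun [set: RT] (fun t : RT => h (t + s) : RT).
  exact: measurableT_comp mh (mD s).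
pose a (t : RT) : \bar R := if b t then (h t - h (t + s))%:E else 0%E.
pose c (t : RT) : \bar R := if b t then (h (t + s))%:E else 0%E.
pose i1 (t : RT) : \bar R := if (0 < t) && (t <= s) then h0%:E else 0%E.
pose hs (t : RT) : \bar R := if b (t - s) then (h t)%:E else 0%E.
have a0 : nnm a.
  split.
    apply: measurable_fun_ifT => //; apply/measurable_EFinP.
    exact: measurable_funB mh mhs.
  move=> t; rewrite /a; case: ifPn => // /b_ge0 t0.
  by rewrite lee_fin subr_ge0 h_nincr.
have c0 : nnm c.
  split; first by apply: measurable_fun_ifT => //; apply/measurable_EFinP.
  move=> t; rewrite /c; case: ifPn => // /b_ge0 t0.
  by rewrite lee_fin h_ge0// addr_ge0.
have i0 (r : R) : nnm (fun t : RT => if (0 < t) && (t <= r) then h0%:E else 0%E).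
  by apply: nnm_if; [exact: mle|exact: nnm_cst|exact: nnm_cst].
have hs0 : nnm hs.
  split.
    apply: measurable_fun_ifT => //; last by apply/measurable_EFinP.
    exact: (measurableT_comp mb (mD (- s))).
  move=> t; rewrite /hs; case: ifPn => // /b_ge0; rewrite subr_ge0 => st.
  by rewrite lee_fin h_ge0// (le_trans s0).
have itv (r : R) : 0 <= r ->
    (\int[mu]_t (if ((0 < t) && (t <= r))%R then h0%:E else 0) = (h0 * r)%:E)%E.
  move=> r0; rewrite integral_if.
  have -> : [set t | (0 < t) && (t <= r)] = `]0, r]%classic.
    by apply/seteqP; split => t /=; rewrite in_itv.
  rewrite integral_cst//= lebesgue_measure_itv/= lte_fin.
  by move: r0; rewrite le_eqVlt => /orP[/eqP <-|->];
    rewrite ?ltxx ?mulr0 ?mule0// oppr0 adde0.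
have cfin : (\int[mu]_t c t < +oo)%E.
  apply: (@le_lt_trans _ _ (h0 * t1)%:E); last exact: ltry.
  rewrite -(itv t1 t10); apply: nnm_le_integral => // t.
  rewrite /c /b; case: ifPn => // /b_ge0 t0.
  by rewrite lee_fin h_le// addr_ge0.
have cf : (\int[mu]_t c t)%E \is a fin_num.
  by rewrite ge0_fin_numE//; apply: integral_ge0 => t _; exact: c0.2.
have : (\int[mu]_t a t + \int[mu]_t c t <= (h0 * s)%:E + \int[mu]_t c t)%E.
  rewrite -nnm_integralD//.
  have -> : (\int[mu]_t c t = \int[mu]_t hs t)%E.
    rewrite -(integral_translation s hs0); apply: eq_integral => t _.
    by rewrite /hs addrK.
  rewrite -(itv s s0) -nnm_integralD//.
  apply: nnm_le_integral; [exact: nnmD|exact: nnmD|].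
  move=> t; rewrite /a /c; case: ifPn => bt; last first.
    by rewrite adde0 adde_ge0 ?(i0 s).2 ?hs0.2.
  have t0 := b_ge0 _ bt; rewrite -EFinD subrK.
  case/andP: (bt) => tgt tle; rewrite tgt/=.
  have [ts|st] := leP t s.
    by rewrite -[leLHS]adde0; apply: leeD; [rewrite lee_fin h_le|exact: hs0.2].
  rewrite add0e /hs /b subr_gt0 st/= ifT//.
  by rewrite lerBlDr (le_trans tle)// lerDl.
by rewrite leeD2rE.
Qed.

End DecrementIntegral.

(** * Entropy decrement and jump energy *)

Section Dissipation.
Context {d : measure_display} {T : measurableType d} {R : realType}.
Variable m : {sigma_finite_measure set T -> \bar R}.
Variable k : R -> T -> {measure set T -> \bar R}.
Hypothesis kP : symmetric_semigroup m k.
Variable N : R.-sfker T ~> T.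
(** The interface between the dissipation estimate and the Dirichlet form. It is applied with
    [v = phi (u)], for which the product of increments is nonnegative; only a lower bound of the
    limit is required. *)
Hypothesis energy_lower_bound : forall u v,
  form_domain m k u -> form_domain m k v ->
  (forall x y, 0 <= (u y - u x) * (v y - v x)) ->
  exists2 l : R, s^-1 * (dot m u v - dot m (psg k s u) v) @[s --> 0^'+] --> l &
    ((2^-1)%:E * \int[m]_x \int[N x]_y ((u y - u x) * (v y - v x))%:E <= l%:E)%E.
Variables (p e : R).
Hypotheses (p1 : 1 < p) (p2 : p <= 2) (e0 : 0 < e).
Implicit Types u f : T -> R.
Local Notation phi := (pphi p e).
Local Notation Phi := (pPhi p e).
Local Notation L := (e `^ (p - 2)).

Lemma bint_pphi u : bint m u -> bint m (fun x => phi (u x)).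
Proof.
apply: (bint_lipschitz (L := L)); first exact: measurable_pphi.
- exact: pphi0.
- by move=> a b; exact: pphi_lipschitz.
Qed.

Lemma bint_pPhi u : bint m u -> bint m (fun x => Phi (u x)).
Proof.
move=> bu; have [mu [M uM] _] := bu.
apply: (bint_dom (c := L * M)) (bu).
  by apply: measurableT_comp => //; exact: measurable_pPhi.
move=> x; rewrite ger0_norm ?pPhi_ge0//; apply: le_trans (pPhi_le_sqr p1 p2 e0 _) _.
rewrite -mulrA; apply: ler_wpM2l; first exact: powR_ge0.
by rewrite -real_normK ?num_real// expr2; apply: ler_wpM2r.
Qed.

(** Jensen's inequality for a kernel of mass [q <= 1]. The tangent at [c] is integrated; its
    constant term [Phi c - phi c * c] is nonpositive because [Phi 0 = 0], so that the missing mass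
    only helps. *)
Lemma pPhi_jensen t u x : bint m u ->
  Phi (psg k t u x) <= psg k t (fun y => Phi (u y)) x.
Proof.
move=> bu; have bPhi := bint_pPhi bu.
set c := psg k t u x.
have ic (a : R) := sg_integrable_cst kP t x a.
have iu := bint_sg_integrable kP t x bu.
have iZ := integrableZl measurableT (phi c) iu.
have i1 : (k t x).-integrable [set: T] (EFin \o (fun y => phi c * u y)).
  exact: (bint_sg_integrable kP t x (bintZ (phi c) bu)).
have q01 := sg_mass_bounds kP t x.
set q := fine (k t x [set: T]) in q01.
have lin : \int[k t x]_y ((Phi c - phi c * c) + phi c * u y) =
    (Phi c - phi c * c) * q + phi c * c.
  rewrite (RintegralD measurableT (ic (Phi c - phi c * c)) i1).
  by rewrite Rintegral_cst// (RintegralZl _ measurableT iu) /c psgE.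
have /andP[q0 q1] := q01.
have up : \int[k t x]_y ((Phi c - phi c * c) + phi c * u y) <=
    psg k t (fun y => Phi (u y)) x.
  rewrite psgE; apply: le_Rintegral => //.
  - exact: (integrableD measurableT (ic (Phi c - phi c * c)) i1).
  - exact: (bint_sg_integrable kP t x bPhi).
  - move=> y _; have := pPhi_convex p1 p2 e0 (u y) c.
    by rewrite mulrBr => h; lra.
apply: le_trans up; rewrite lin.
have := pPhi_convex p1 p2 e0 0 c; rewrite pPhi0// sub0r => h.
rewrite mulrN sub0r lerN2 in h.
have {}h : 0 <= phi c * c - Phi c by rewrite subr_ge0.
have := mulr_ge0 h (_ : 0 <= 1 - q); rewrite subr_ge0 => /(_ q1).
by lra.
Qed.

Definition entropy f t : R := \int[m]_x Phi (psg k t f x).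

Lemma entropy_ge0 f t : 0 <= entropy f t.
Proof. by apply: Rintegral_ge0 => x _; exact: pPhi_ge0. Qed.

Lemma entropy_nincr f t s : bint m f -> 0 <= t -> 0 <= s ->
  entropy f (t + s) <= entropy f t.
Proof.
move=> bf t0 s0; have bPf := bint_psg kP t0 bf; have bPhi := bint_pPhi bPf.
apply: le_trans (bint_integral_psg_le kP s0 bPhi (fun x => pPhi_ge0 p1 p2 e0 _)).
apply: le_Rintegral => //.
- exact: bint_integrable (bint_pPhi (bint_psg kP (addr_ge0 t0 s0) bf)).
- exact: bint_integrable (bint_psg kP s0 bPhi).
- by move=> x _; rewrite (addrC t s) (psg_add kP x s0 t0 bf); exact: pPhi_jensen.
Qed.

Lemma entropy0 f : bint m f -> entropy f 0 = \int[m]_x Phi (f x).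
Proof. by move=> bf; apply: eq_Rintegral => x _; rewrite (psg0 kP). Qed.

Lemma entropy_le f t : bint m f -> 0 <= t ->
  entropy f t <= \int[m]_x Phi (f x).
Proof.
move=> bf t0; have := entropy_nincr bf (lexx 0) t0.
by rewrite add0r (entropy0 bf).
Qed.

(** Convexity at [b = P_s u] bounds the decrement below by [phi b (a - b)] with [a = u]. Replacing
    [phi b] by [phi a] costs at most [L (a - b) ^ 2], and the integral of the squared increment is
    given by [norm_increment]. *)
Lemma entropy_decrement f t s u : bint m f -> 0 <= t -> 0 <= s ->
  u = psg k t f ->
  dot m u (fun x => phi (u x)) - dot m (psg k s u) (fun x => phi (u x)) -
    L * (2 * gap m k u s - gap m k u (s + s)) <= entropy f t - entropy f (t + s).
Proof.
move=> bf t0 s0 uE.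
have bu : bint m u by rewrite uE; exact: bint_psg.
have bPu := bint_psg kP s0 bu.
have bphi := bint_pphi bu; have bphiP := bint_pphi bPu.
have bd := bintB bu bPu.
rewrite -(norm_increment kP s0 bu) -(dotBl bu bPu bphi) -(dotZl L bd bd).
have bLd := bintZ L bd.
have -> : entropy f (t + s) = \int[m]_x Phi (psg k s u x).
  by apply: eq_Rintegral => x _; rewrite (addrC t s) (psg_add kP x s0 t0 bf) uE.
rewrite /entropy -uE.
rewrite -(RintegralB measurableT (bint_integrable (bint_pPhi bu))
  (bint_integrable (bint_pPhi bPu))) !dotE.
have i1 := bint_integrable (bintM bd bphi); have i2 := bint_integrable (bintM bLd bd).
rewrite -(RintegralB measurableT i1 i2).
apply: le_Rintegral => //.
- exact: (integrableB measurableT i1 i2).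
- exact: (bint_integrable (bintB (bint_pPhi bu) (bint_pPhi bPu))).
move=> x _; set a := u x; set b := psg k s u x.
apply: le_trans (pPhi_convex p1 p2 e0 a b).
have h : (a - b) * (phi a - phi b) <= L * (a - b) * (a - b).
  apply: le_trans (ler_norm _) _; rewrite normrM.
  apply: le_trans (ler_wpM2l (normr_ge0 _) (pphi_lipschitz p1 p2 e0 a b)) _.
  by rewrite mulrCA -mulrA -normrM -expr2 ger0_norm ?sqr_ge0.
by move: h; rewrite mulrBr; set A := phi a; set B := phi b => h; lra.
Qed.

Definition coercive_density (a b : R) : R :=
  (b - a) ^+ 2 * (Num.max (a ^+ 2) (b ^+ 2) + e ^+ 2) `^ (p / 2 - 1).

Lemma coercive_density_ge0 a b : 0 <= coercive_density a b.
Proof. by rewrite mulr_ge0 ?sqr_ge0 ?powR_ge0. Qed.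

Lemma measurable_coercive_density d' (X : measurableType d') (a b : X -> R) :
  measurable_fun [set: X] a -> measurable_fun [set: X] b ->
  measurable_fun [set: X] (fun z => coercive_density (a z) (b z)).
Proof.
move=> ma mb; apply: measurable_funM.
  by apply: measurable_funX; exact: measurable_funB.
apply: (measurableT_comp (measurable_powR (p / 2 - 1))).
apply: measurable_funD; last exact: measurable_cst.
by apply: measurable_maxr; exact: measurable_funX.
Qed.

Definition dissipated (u : T -> R) : \bar R :=
  (\int[m]_x \int[N x]_y (coercive_density (u x) (u y))%:E)%E.

Lemma nnm_dissipation_inner f : bint m f ->
  nnm (fun z : R * T => (\int[N z.2]_y
    (coercive_density (psg k z.1 f z.2) (psg k z.1 f y))%:E)%E).
Proof.
move=> bf.
pose F (z : (R * T) * T) :=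
  (coercive_density (psg k z.1.1 f z.1.2) (psg k z.1.1 f z.2))%:E.
suff F0 : nnm F by exact: (@nnm_integral_sfker _ _ _ R T T R N F F0).
split; last by move=> z; rewrite lee_fin coercive_density_ge0.
have mP := measurable_psg2 kP bf.
apply/measurable_EFinP; apply: measurable_coercive_density.
- exact: (measurableT_comp mP measurable_fst).
- apply: (measurableT_comp mP (g := fun z : (R * T) * T => (z.1.1, z.2))).
  apply: measurable_fun_pair; last exact: measurable_snd.
  exact: (measurableT_comp measurable_fst measurable_fst).
Qed.

Lemma nnm_dissipated f : bint m f -> nnm (fun t => dissipated (psg k t f)).
Proof.
move=> bf; have [mI I0] := nnm_dissipation_inner bf.
split; last by move=> t; apply: integral_ge0 => x _; exact: I0 (t, x).
exact: (measurable_fun_fubini_tonelli_F (m2 := m) _ mI I0).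
Qed.

Lemma measurable_entropy f : bint m f -> measurable_fun [set: R] (entropy f).
Proof.
move=> bf.
have F0 : nnm (fun z : R * T => (Phi (psg k z.1 f z.2))%:E).
  split; last by move=> z; rewrite lee_fin pPhi_ge0.
  apply/measurable_EFinP; apply: (measurableT_comp (measurable_pPhi p1 e0)).
  exact: (measurable_psg2 kP).
have := measurable_fun_fubini_tonelli_F (m2 := m) _ F0.1 F0.2.
by move=> h; apply: (measurableT_comp _ h).
Qed.

(** [entropy_decrement] is divided by [s = 1 / (n + 1)]. Its main term tends to the energy of [u]
    against [phi (u)], which controls the dissipation by [pphi_coercive]; its correction tends to 0.
    A lower limit suffices, and the entropy need not be differentiated. *)
Lemma dissipated_le_decrement f t : bint m f -> 0 < t ->
  (((p - 1) / 2)%:E * dissipated (psg k t f) <=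
  limn_einf (fun n => (n.+1%:R * (entropy f t - entropy f (t + n.+1%:R^-1)))%:E))%E.
Proof.
move=> bf t0; set u := psg k t f.
have du : form_domain m k u by exact: form_domain_psg.
have bu := du.1.
have dphi : form_domain m k (fun x => phi (u x)).
  apply: (form_domain_lipschitz kP (L := L)) du; first exact: measurable_pphi.
  - exact: pphi0.
  - by move=> a b; exact: pphi_lipschitz.
have mono x y : 0 <= (u y - u x) * (phi (u y) - phi (u x)).
  have [xy|/ltW yx] := leP (u x) (u y).
    by apply: mulr_ge0; rewrite subr_ge0// pphi_mono.
  by rewrite -mulrNN (opprB (u y)) opprB; apply: mulr_ge0; rewrite subr_ge0// pphi_mono.
have [l ul Il] := energy_lower_bound du dphi mono.
have mu : measurable_fun [set: T] u := bint_measurable bu.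
have cd0 : nnm (fun z : T * T => (coercive_density (u z.1) (u z.2))%:E).
  split; last by move=> z; rewrite lee_fin coercive_density_ge0.
  apply/measurable_EFinP; apply: measurable_coercive_density.
    exact: measurableT_comp measurable_fst.
  exact: measurableT_comp measurable_snd.
have pd0 : nnm (fun z : T * T => ((u z.2 - u z.1) * (phi (u z.2) - phi (u z.1)))%:E).
  split; last by move=> z; rewrite lee_fin.
  have mphi := measurable_pphi p e0.
  apply/measurable_EFinP; apply: measurable_funM; apply: measurable_funB.
  - exact: measurableT_comp measurable_snd.
  - exact: measurableT_comp measurable_fst.
  - exact: measurableT_comp mphi (measurableT_comp mu measurable_snd).
  - exact: measurableT_comp mphi (measurableT_comp mu measurable_fst).
have N2 (F : T * T -> \bar R) : nnm F -> nnm (fun x => (\int[N x]_y F (x, y))%E).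
  move=> [mF F0]; split; last by move=> x; apply: integral_ge0 => y _.
  exact: (measurable_fun_integral_sfinite_kernel F N).
have s2 (F : T * T -> \bar R) x : nnm F -> nnm (fun y => F (x, y)).
  move=> [mF F0]; split => //; exact: measurableT_comp mF (measurable_pair1 x).
have step1 : (((p - 1) / 2)%:E * dissipated u <= l%:E)%E.
  apply: le_trans Il; rewrite /dissipated mulrC EFinM -muleA.
  apply: lee_wpmul2l; first by rewrite lee_fin invr_ge0.
  have pm : (0 <= (p - 1)%:E :> \bar R)%E by rewrite lee_fin subr_ge0 ltW.
  rewrite -(nnm_integralZl m (N2 _ cd0) pm).
  apply: nnm_le_integral; [apply: nnmM; [exact: nnm_cst|exact: N2 cd0]|exact: N2 pd0|].
  move=> x; rewrite -(nnm_integralZl (N x) (s2 _ x cd0) pm).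
  apply: nnm_le_integral; [apply: nnmM; [exact: nnm_cst|exact: s2 cd0]|exact: s2 pd0|].
  move=> y /=; rewrite -EFinM lee_fin [leRHS]mulrC.
  exact: pphi_coercive.
apply: le_trans step1 _.
pose sq n : R := n.+1%:R^-1.
have sq0 n : 0 < sq n by rewrite invr_gt0.
have sqc : sq n @[n --> \oo] --> (0 : R) by exact: cvg_harmonic.
have sq2c : sq n + sq n @[n --> \oo] --> (0 : R).
  by rewrite -[X in _ --> X]addr0; exact: cvgD.
(* The approximate energies at the scales [s] and [2 s] share the limit [g0], so that the correction
   vanishes in the limit. *)
have /cvg_ex[g0 hg0] := form_domain_cvg kP du.
have c1 := (cvg_at_rightP _ _ _).1 hg0 _ (conj sq0 sqc).
have sq20 n : 0 < sq n + sq n by rewrite addr_gt0.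
have c2 := (cvg_at_rightP _ _ _).1 hg0 _ (conj sq20 sq2c).
have c3 := (cvg_at_rightP _ _ _).1 ul _ (conj sq0 sqc).
pose A n := (sq n)^-1 * (dot m u (fun x => phi (u x)) - dot m (psg k (sq n) u) (fun x => phi (u x))) -
  L * (2 * ((sq n)^-1 * gap m k u (sq n)) -
       2 * ((sq n + sq n)^-1 * gap m k u (sq n + sq n))).
have Al : A n @[n --> \oo] --> l.
  rewrite -[X in _ --> X]subr0 -[X in _ - X](mulr0 L) -[X in L * X](subrr (2 * g0)).
  by rewrite /A; apply: (cvgB c3); apply: cvgMr; apply: cvgB; apply: cvgMr;
    [exact: c1|exact: c2].
apply: (le_limn_einf_cvg Al) => n; rewrite lee_fin.
have -> : A n = n.+1%:R * (dot m u (fun x => phi (u x)) -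
    dot m (psg k (sq n) u) (fun x => phi (u x)) -
    L * (2 * gap m k u (sq n) - gap m k u (sq n + sq n))).
  have -> : A n = (sq n)^-1 * (dot m u (fun x => phi (u x)) -
    dot m (psg k (sq n) u) (fun x => phi (u x)) -
    L * (2 * gap m k u (sq n) - gap m k u (sq n + sq n))).
    by apply: rescaled_decrement; rewrite gt_eqF.
  by rewrite /sq invrK.
apply: ler_wpM2l => //.
exact: entropy_decrement bf (ltW t0) (ltW (sq0 n)) (erefl _).
Qed.

(** Fatou's lemma for the difference quotients of the entropy: by [decrement_integral] each has an
    integral of at most [(n + 1) h0 / (n + 1) = h0], whatever [t1] is. *)
Lemma dissipation_bound f (t1 : R) : bint m f -> 0 <= t1 ->
  (\int[lebesgue_measure]_t
     (if ((0 < t) && (t <= t1))%R then ((p - 1) / 2)%:E * dissipated (psg k t f)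
      else 0) <= (\int[m]_x Phi (f x))%:E)%E.
Proof.
move=> bf t10; set h0 := \int[m]_x Phi (f x).
have h00 : 0 <= h0 by apply: Rintegral_ge0 => x _; exact: pPhi_ge0.
pose b (t : R) := (0 < t) && (t <= t1).
have mb : measurable_fun [set: R] b.
  by apply: measurable_and; apply: measurable_fun_ltr || apply: measurable_fun_ler.
have pm : (0 <= ((p - 1) / 2)%:E :> \bar R)%E by rewrite lee_fin divr_ge0// subr_ge0 ltW.
have mh := measurable_entropy bf.
pose G n t : \bar R := if b t then
  (n.+1%:R * (entropy f t - entropy f (t + n.+1%:R^-1)))%:E else 0%E.
have b_ge0 t : b t -> 0 <= t by case/andP => /ltW.
have mhs (s : R) : measurable_fun [set: R] (fun t => entropy f (t + s)).
  by apply: (measurableT_comp mh); apply: measurable_funD.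
have G0 n : nnm (G n).
  split.
    apply: measurable_fun_ifT => //.
    apply/measurable_EFinP; apply: measurable_funM; first exact: measurable_cst.
    by apply: measurable_funB; [exact: mh|exact: mhs].
  move=> t; rewrite /G; case: ifPn => // /b_ge0 t0; rewrite lee_fin mulr_ge0//.
  by rewrite subr_ge0; exact: entropy_nincr.
apply: (@fatou_le _ (measurableTypeR R) R (@lebesgue_measure R) G) => //.
- apply: nnm_if => //.
  by apply: nnmM; [exact: nnm_cst|exact: nnm_dissipated].
- apply: aeW => t; rewrite -/(b t); case: ifPn => bt.
    have t0 : 0 < t by case/andP: bt.
    apply: le_trans (dissipated_le_decrement bf t0) _.
    by apply: le_limn_einf => n; rewrite /G bt.
  apply: (@le_limn_einf_cvg _ (fun=> 0)); first exact: cvg_cst.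
  by move=> n; exact: (G0 n).2.
- move=> n; pose s : R := n.+1%:R^-1.
  have s0 : 0 < s by rewrite invr_gt0.
  have := decrement_integral t10 (ltW s0) h00 mh (fun t _ => entropy_ge0 f t)
    (fun t t0 => entropy_le bf t0) (fun t t0 => entropy_nincr bf t0 (ltW s0)).
  set a := (fun t : R => if _ then _ else _ : \bar R) => ha.
  have a0 : nnm a.
    split.
      apply: measurable_fun_ifT; [exact: mb| |exact: measurable_cst].
      by apply/measurable_EFinP; apply: measurable_funB; [exact: mh|exact: mhs].
    move=> t; rewrite /a; case: ifPn => [/b_ge0 t0|_]; last exact: lexx.
    by rewrite lee_fin subr_ge0; exact: entropy_nincr bf t0 (ltW s0).
  have n0 : (0 <= n.+1%:R%:E :> \bar R)%E by rewrite lee_fin.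
  have Gna : (\int[lebesgue_measure]_t G n t = n.+1%:R%:E * \int[lebesgue_measure]_t a t)%E.
    rewrite -(@nnm_integralZl _ (measurableTypeR R) R lebesgue_measure a _ a0 n0).
    apply: eq_integral => t _.
    by rewrite /G /a /b; case: ifP => _; [exact: EFinM|rewrite mule0].
  rewrite Gna; apply: le_trans (lee_wpmul2l n0 ha) _.
  by rewrite -EFinM lee_fin mulrCA /s mulfV ?mulr1.
Qed.

End Dissipation.

Opaque entropy.

(** * Dissipation for functions in L^p *)

Section Exhaustion.
Context {d : measure_display} {T : measurableType d} {R : realType}.
Variable m : {sigma_finite_measure set T -> \bar R}.

Lemma sigma_finite_exhaustion : exists A : nat -> set T,
  [/\ forall n, measurable (A n), forall n, (m (A n) < +oo)%E,
      forall n, A n `<=` A n.+1 & forall x, exists n, A n x].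
Proof.
have [F FT Fm] := sigma_finiteT m.
pose A n := \big[setU/set0]_(i < n.+1) F i.
have mA n : measurable (A n).
  by apply: bigsetU_measurable => i _; exact: (Fm i).1.
exists A; split => //.
- elim=> [|n IH].
    by rewrite /A big_ord_recr/= big_ord0 set0U; exact: (Fm 0%N).2.
  rewrite /A big_ord_recr/= -/(A n).
  apply: le_lt_trans (measureU2 _ (mA n) (Fm _).1) _.
  by rewrite lte_add_pinfty//; exact: (Fm _).2.
- by move=> n x Anx; rewrite /A big_ord_recr/=; left.
- move=> x; have : [set: T] x by [].
  rewrite FT => -[n _ Fnx]; exists n.
  by rewrite /A big_ord_recr/=; right.
Qed.

End Exhaustion.

Section Truncation.
Context {d : measure_display} {T : measurableType d} {R : realType}.
Variable m : {measure set T -> \bar R}.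
Variable A : nat -> set T.
Hypotheses (mA : forall n, measurable (A n))
  (Afin : forall n, (m (A n) < +oo)%E)
  (Asub : forall n, A n `<=` A n.+1) (AT : forall x, exists n, A n x).
Implicit Types f : T -> R.

Definition trunc_set n f : set T := A n `&` [set x | `|f x| <= n%:R].
Definition trunc n f (x : T) : R := f x * \1_(trunc_set n f) x.

Lemma trunc_setS n n' f : (n <= n')%N -> trunc_set n f `<=` trunc_set n' f.
Proof.
move=> nn' x [Anx fx]; split; last by apply: (le_trans fx); rewrite ler_nat.
elim: n' nn' => [|n' IH]; first by rewrite leqn0 => /eqP <-.
rewrite leq_eqVlt => /orP[/eqP <-//|]; rewrite ltnS => /IH.
exact: Asub.
Qed.

Lemma trunc_set_exhausts f x : exists n, trunc_set n f x.
Proof.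
have [n An] := AT x.
pose N := maxn n (Num.truncn `|f x|).+1; exists N; split.
  have : trunc_set N (fun=> 0) x.
    by apply: (@trunc_setS n); [exact: leq_maxl|split => //=; rewrite normr0].
  by case.
rewrite /=; apply: le_trans (ltW (truncnS_gt _)) _.
by rewrite ler_nat leq_maxr.
Qed.

Lemma measurable_trunc_set n f : measurable_fun [set: T] f ->
  measurable (trunc_set n f).
Proof.
move=> mf; apply: measurableI => //.
have mnf : measurable_fun [set: T] (fun x => `|f x|).
  exact: measurableT_comp.
have -> : [set x | `|f x| <= n%:R] = (fun x => `|f x|) @^-1` `]-oo, n%:R]%classic.
  by apply/seteqP; split => x /=; rewrite in_itv.
by rewrite -[X in measurable X]setTI; apply: mnf.
Qed.

Lemma measurable_trunc n f : measurable_fun [set: T] f ->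
  measurable_fun [set: T] (trunc n f).
Proof.
move=> mf; apply: measurable_funM => //.
by apply: measurable_indic; exact: measurable_trunc_set.
Qed.

Lemma truncE n f x : trunc n f x = f x \/ trunc n f x = 0.
Proof.
by rewrite /trunc indicE; case: (_ \in _); [left; rewrite mulr1|right; rewrite mulr0].
Qed.

Lemma trunc_norm_le n f x : `|trunc n f x| <= `|f x|.
Proof. by case: (truncE n f x) => ->//; rewrite normr0. Qed.

Lemma trunc_bound n f x : `|trunc n f x| <= n%:R.
Proof.
rewrite /trunc indicE; have [|_] := boolP (x \in _); last by rewrite mulr0 normr0.
by rewrite inE => -[_ /=]; rewrite mulr1.
Qed.

Lemma trunc_eventually f x : exists n0, forall n, (n0 <= n)%N -> trunc n f x = f x.
Proof.
have [n0 h] := trunc_set_exhausts f x; exists n0 => n nn.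
by rewrite /trunc indicE mem_set ?mulr1//; exact: trunc_setS h.
Qed.

Lemma bint_trunc n f : measurable_fun [set: T] f -> bint m (trunc n f).
Proof.
move=> mf; split; [exact: measurable_trunc|by exists n%:R => x; exact: trunc_bound|].
apply: (@le_integrable _ _ _ _ _ measurableT _ (fun x => n%:R%:E * (\1_(A n) x)%:E)%E).
- by apply/measurable_EFinP; exact: measurable_trunc.
- move=> x _; rewrite -EFinM !abse_EFin lee_fin.
  rewrite [leRHS]ger0_norm; last by rewrite mulr_ge0.
  have [xA|xA] := boolP (x \in A n).
    by rewrite indicE xA mulr1 trunc_bound.
  rewrite indicE (negbTE xA) mulr0 /trunc indicE memNset ?mulr0 ?normr0// => -[].
  by move: xA => /negP; rewrite inE.
- apply: integrableZl => //; apply/integrableP; split; first exact/measurable_EFinP.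
  rewrite (eq_integral (fun x => (\1_(A n) x)%:E)); last first.
    by move=> x _; rewrite gee0_abs// lee_fin.
  by rewrite integral_indic// setIT.
Qed.

Lemma trunc_cvg f x : trunc n f x @[n --> \oo] --> f x.
Proof.
have [n0 h] := trunc_eventually f x.
by apply: cvg_near_cst; exists n0.
Qed.

End Truncation.

(** * Removing the regularization *)

Section CoerciveLimit.
Context {R : realType}.
Variable p : R.

Lemma powR_cvg (q : R) (x_ : nat -> R) (x : R) : 0 < x ->
  x_ n @[n --> \oo] --> x -> x_ n `^ q @[n --> \oo] --> x `^ q.
Proof.
move=> x0 xc.
have c : {for x, continuous (fun y : R => y `^ q)}.
  apply/differentiable_continuous/derivable1_diffP.
  by have [] := is_derive1_powR q x0.
exact: (cvg_comp x_ (fun y : R => y `^ q) xc c).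
Qed.

(** This is [coercive_density] at [e = 0]. At [a = b = 0] the power takes a default value, but the
    first factor vanishes there. *)
Definition limit_density (a b : R) : R :=
  (b - a) ^+ 2 * Num.max (a ^+ 2) (b ^+ 2) `^ (p / 2 - 1).

Lemma limit_density_ge0 a b : 0 <= limit_density a b.
Proof. by rewrite mulr_ge0 ?sqr_ge0 ?powR_ge0. Qed.

(** Away from [a = b = 0] the power is continuous and the densities converge. At that point the
    power may blow up along the sequence, but the claim is only that the lower limit is
    nonnegative. *)
Lemma limit_density_le_einf (a b : R) (a_ b_ e_ : nat -> R) :
  a_ n @[n --> \oo] --> a -> b_ n @[n --> \oo] --> b ->
  e_ n @[n --> \oo] --> (0 : R) ->
  ((limit_density a b)%:E <=
   limn_einf (fun n => (coercive_density p (e_ n) (a_ n) (b_ n))%:E))%E.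
Proof.
move=> ac bc ec; have [M0|M0] := leP (Num.max (a ^+ 2) (b ^+ 2)) 0.
  have /andP[/eqP a0 /eqP b0] : (a == 0) && (b == 0).
    move: M0; rewrite ge_max => /andP[a0 b0].
    have sq0 (c : R) : c ^+ 2 <= 0 -> c == 0.
      by rewrite -sqrf_eq0 eq_le sqr_ge0 andbT.
    by rewrite (sq0 a)// (sq0 b).
  rewrite /limit_density a0 b0 subrr expr0n mul0r.
  apply: (@le_limn_einf_cvg _ (fun=> 0)); first exact: cvg_cst.
  by move=> n; rewrite lee_fin coercive_density_ge0.
apply: (@le_limn_einf_cvg _ (fun n => coercive_density p (e_ n) (a_ n) (b_ n))) => //.
rewrite /coercive_density /limit_density.
have sq (x_ : nat -> R) (x : R) : x_ n @[n --> \oo] --> x ->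
    x_ n ^+ 2 @[n --> \oo] --> x ^+ 2.
  by move=> xc; rewrite expr2; under eq_fun do rewrite expr2; exact: cvgM.
apply: cvgM; first by apply: sq; exact: cvgB.
apply: powR_cvg => //.
rewrite -[X in _ --> X]addr0; apply: cvgD.
  rewrite maxr_absE; under eq_fun do rewrite maxr_absE.
  apply: cvgMl; apply: cvgD; first by apply: cvgD; exact: sq.
  by apply: cvg_norm; apply: cvgB; exact: sq.
by have := sq _ _ ec; rewrite expr0n.
Qed.

Lemma measurable_limit_density d (X : measurableType d) (a b : X -> R) :
  measurable_fun [set: X] a -> measurable_fun [set: X] b ->
  measurable_fun [set: X] (fun z => limit_density (a z) (b z)).
Proof.
move=> ma mb; apply: measurable_funM.
  by apply: measurable_funX; exact: measurable_funB.
apply: (measurableT_comp (measurable_powR (p / 2 - 1))).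
by apply: measurable_maxr; exact: measurable_funX.
Qed.

End CoerciveLimit.

(** * The semigroup on functions in L^p *)

Section GeneralSemigroup.
Context {d : measure_display} {T : measurableType d} {R : realType}.
Variable m : {sigma_finite_measure set T -> \bar R}.
Variable k : R -> T -> {measure set T -> \bar R}.
Hypothesis kP : symmetric_semigroup m k.
Variable p : R.
Hypotheses (p1 : 1 < p) (p2 : p <= 2).
Variable f : T -> R.
Hypothesis mf : measurable_fun [set: T] f.
Local Notation P t := (kint (k t)).

Lemma measurable_psg_joint :
  measurable_fun [set: R * T] (fun z => psg k z.1 f z.2).
Proof.
have mF : measurable_fun [set: T] (EFin \o f) by exact/measurable_EFinP.
have np : nnm (fun x => ((EFin \o f) ^\+ x)%E).
  by split; [exact: measurable_funepos|move=> x; exact: funepos_ge0].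
have nn : nnm (fun x => ((EFin \o f) ^\- x)%E).
  by split; [exact: measurable_funeneg|move=> x; exact: funeneg_ge0].
rewrite [X in measurable_fun _ X](_ : _ = (fun z : R * T =>
   fine (P z.1 (fun x => ((EFin \o f) ^\+ x)%E) z.2 -
         P z.1 (fun x => ((EFin \o f) ^\- x)%E) z.2)%E)).
  apply: measurableT_comp => //.
  apply: emeasurable_funB; [have [] := sg_nnm2 kP np|have [] := sg_nnm2 kP nn] => //.
by apply/funext => z; rewrite psgE /Rintegral integralE.
Qed.

Lemma nnm_norm : nnm (fun x => (`|f x|)%:E).
Proof.
split; last by move=> x; rewrite lee_fin.
by apply/measurable_EFinP; exact: measurableT_comp.
Qed.

Lemma nnm_norm_powR : nnm (fun x => (`|f x| `^ p)%:E).
Proof.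
split; last by move=> x; rewrite lee_fin powR_ge0.
apply/measurable_EFinP; apply: (measurableT_comp (measurable_powR p)).
exact: measurableT_comp.
Qed.

(* Where the integral defining [psg k t f] diverges, so that its value is junk. *)
Definition bad_set t : set T := [set x | P t (fun x => (`|f x|)%:E) x = +oo%E].

Lemma measurable_bad_set t : measurable (bad_set t).
Proof.
have [h _] := sg_nnm kP t nnm_norm.
have -> : bad_set t = (P t (fun x => (`|f x|)%:E)) @^-1` [set +oo%E] by [].
by rewrite -[X in measurable X]setTI; exact: h.
Qed.

Hypothesis fLp : (\int[m]_x (`|f x| `^ p)%:E < +oo)%E.

(** From [|f| <= 1 + |f| ^ p] it follows that [P_t |f| <= 1 + P_t |f| ^ p], and the last function is
    integrable by the L^1 contraction, hence finite almost everywhere. *)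
Lemma bad_set_null t : 0 <= t -> m (bad_set t) = 0%E.
Proof.
move=> t0; have Pp := sg_nnm kP t nnm_norm_powR.
have Pint : m.-integrable [set: T] (P t (fun x => (`|f x| `^ p)%:E)).
  apply/integrableP; split; first exact: Pp.1.
  apply: le_lt_trans fLp.
  under eq_integral do rewrite gee0_abs ?Pp.2//.
  exact: (sg_integral_le kP t0 nnm_norm_powR).
have [B [mB B0 Bsub]] := integrable_ae measurableT Pint.
apply: (@subset_measure0 _ _ _ m (bad_set t) B) => //.
  exact: measurable_bad_set.
apply: subset_trans Bsub => x /= bx /(_ I) fin; move: bx; rewrite /bad_set/=.
apply/eqP; rewrite -ltey.
have one : nnm (fun _ : T => 1%E : \bar R) by exact: nnm_cst.
apply: le_lt_trans (_ : (1 + P t (fun x => (`|f x| `^ p)%:E) x < +oo)%E).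
  apply: le_trans (_ : P t (fun x => 1 + (`|f x| `^ p)%:E)%E x <= _)%E.
    apply: kint_le; [exact: nnm_norm|exact: nnmD one nnm_norm_powR|].
    move=> y; rewrite -EFinD lee_fin.
    have [h|/ltW h] := leP 1 (`|f y|).
      by apply: ler_wpDl => //; rewrite le1r_powR// ltW.
    by apply: le_trans h _; rewrite lerDl powR_ge0.
  rewrite /kint (nnm_integralD _ one nnm_norm_powR); apply: leeD => //.
  apply: (kint_cst_le (S := k t)) => //; exact: sg_le1 kP _.
by rewrite lte_add_pinfty ?ltry// -ge0_fin_numE// Pp.2.
Qed.

Section Cvg.
Variable A : nat -> set T.
Hypotheses (mA : forall n, measurable (A n))
  (Afin : forall n, (m (A n) < +oo)%E)
  (Asub : forall n, A n `<=` A n.+1) (AT : forall x, exists n, A n x).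

Lemma psg_trunc_cvg t x : ~ bad_set t x ->
  psg k t (trunc A n f) x @[n --> \oo] --> psg k t f x.
Proof.
move=> nb.
have fin : (P t (fun x => (`|f x|)%:E) x < +oo)%E by rewrite ltey; apply/eqP.
have mF : measurable_fun [set: T] (EFin \o f) by exact/measurable_EFinP.
have int : (k t x).-integrable [set: T] (fun x => (`|f x|)%:E).
  apply/integrableP; split; first exact: nnm_norm.1.
  apply: le_lt_trans fin; rewrite /kint.
  by under eq_integral do rewrite gee0_abs ?lee_fin//.
have intf : (k t x).-integrable [set: T] (EFin \o f).
  by apply: le_integrable int => // y _; rewrite /= normr_id.
have c : (\int[k t x]_y (trunc A n f y)%:E)%E @[n --> \oo] -->
    (\int[k t x]_y (f y)%:E)%E.
  apply: (@dominated_cvg _ _ _ (k t x) setT measurableT _ _ (fun x => (`|f x|)%:E)) => //.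
  - by move=> n; apply/measurable_EFinP; exact: measurable_trunc.
  - by move=> y _; apply/fine_cvgP; split; [exact: nearW|exact: trunc_cvg].
  - by move=> n y _; rewrite abse_EFin lee_fin trunc_norm_le.
have fE : (\int[k t x]_y (f y)%:E = (psg k t f x)%:E)%E.
  by rewrite psgE /Rintegral fineK//; exact: integrable_fin_num intf.
rewrite fE in c.
rewrite (_ : (fun n => psg k t (trunc A n f) x) =
  (fun n => fine (\int[k t x]_y (trunc A n f y)%:E)%E)); first exact: fine_cvg c.
by apply/funext => n; rewrite psgE.
Qed.

End Cvg.

End GeneralSemigroup.

Section AlmostEverywhere.
Context {d : measure_display} {T : measurableType d} {R : realType}.
Variable m : {measure set T -> \bar R}.

Lemma le_limn_einf_eventually (u v : nat -> \bar R) n0 :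
  (forall n, (n0 <= n)%N -> u n <= v n)%E -> (limn_einf u <= limn_einf v)%E.
Proof.
move=> uv; rewrite !limn_einf_lim; apply: lee_lim; [exact: is_cvg_einfs..|].
exists n0 => // n /= nn; apply: le_ereal_inf_tmp => _ [i /= ni <-].
apply: le_trans (uv i (leq_trans nn ni)); apply: ereal_inf_lbound.
by exists i.
Qed.

(** The sum of the squares has a finite integral, so it is finite almost everywhere and its terms
    tend to 0. The geometric rate makes the whole sequence converge, without passing to a
    subsequence. *)
Lemma ae_cvg0_summable (h : nat -> T -> R) : (forall l, bint m (h l)) ->
  (forall l, dot m (h l) (h l) <= (2 ^+ l)^-1) ->
  {ae m, forall x, h l x @[l --> \oo] --> (0 : R)}.
Proof.
move=> bh hd.
pose F l x := (h l x * h l x)%:E.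
have F0 l : nnm (F l).
  by apply: (bint_nnm (bintM (bh l) (bh l))) => x; rewrite -expr2 sqr_ge0.
have S0 : nnm (fun x => \sum_(0 <= l <oo) F l x)%E.
  split; last by move=> x; apply: nneseries_ge0 => l _ _; exact: (F0 l).2.
  apply: ge0_emeasurable_sum => l; first by move=> x _ _; exact: (F0 l).2.
  by move=> _; exact: (F0 l).1.
have Sint : m.-integrable [set: T] (fun x => \sum_(0 <= l <oo) F l x)%E.
  apply/integrableP; split; first exact: S0.1.
  under eq_integral do rewrite gee0_abs ?S0.2//.
  rewrite integral_nneseries//; [|by move=> l; exact: (F0 l).1|
    by move=> l x _; exact: (F0 l).2].
  apply: (@le_lt_trans _ _ (\sum_(0 <= l <oo) (0%:E + (2 / (2 ^ l.+1)%:R)%:E))%E).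
    apply: lee_nneseries => l *; first by apply: integral_ge0 => x _; exact: (F0 l).2.
    rewrite add0e -EFin_dot// lee_fin; apply: le_trans (hd l) _.
    by rewrite natrX exprS invfM mulrA divff ?mul1r.
  have two0 : 0 <= 2 :> R by [].
  apply: le_lt_trans (@epsilon_trick R (fun=> 0%E) 2 xpredT (fun=> lexx _) two0) _.
  by rewrite eseries0// add0e ltry.
have := integrable_ae measurableT Sint; apply: filterS => x /(_ I) Sfin.
have Slt : (\sum_(0 <= l <oo) F l x < +oo)%E.
  by rewrite -ge0_fin_numE//; exact: S0.2.
have tail := nneseries_tail_cvg Slt (fun l _ => (F0 l).2 x).
have sqc : h l x * h l x @[l --> \oo] --> (0 : R).
  have c : F l x @[l --> \oo] --> (0 : R)%:E.
    apply: (@squeeze_cvge _ _ _ _ (fun=> 0%:E) _ _ _ _ _ tail); last exact: cvg_cst.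
    apply: nearW => l; rewrite (F0 l).2/=.
    apply: le_trans (_ : (\sum_(l <= i < l.+1) F i x)%E <= _)%E.
      by rewrite big_nat1.
    by apply: nneseries_lim_ge => i _ _; exact: (F0 i).2.
  exact: fine_cvg c.
apply/cvgrPdist_lt => e e0.
have e20 : 0 < e ^+ 2 by rewrite exprn_gt0.
move/cvgrPdist_lt : sqc => /(_ _ e20); apply: filterS => l.
rewrite !sub0r !normrN -expr2 normrX => h2.
by rewrite -(@ltr_pXn2r _ 2) ?nnegrE// ltW.
Qed.

End AlmostEverywhere.

(** * The dissipation estimate for L^p functions *)

Section DissipationLp.
Context {d : measure_display} {T : measurableType d} {R : realType}.
Variable m : {sigma_finite_measure set T -> \bar R}.
Variable k : R -> T -> {measure set T -> \bar R}.
Hypothesis kP : symmetric_semigroup m k.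
Variable N : R.-sfker T ~> T.
Hypothesis energy_lower_bound : forall u v,
  form_domain m k u -> form_domain m k v ->
  (forall x y, 0 <= (u y - u x) * (v y - v x)) ->
  exists2 l : R, s^-1 * (dot m u v - dot m (psg k s u) v) @[s --> 0^'+] --> l &
    ((2^-1)%:E * \int[m]_x \int[N x]_y ((u y - u x) * (v y - v x))%:E <= l%:E)%E.
(** The truncations of [P_t f] converge off an [m]-null set. As this convergence is also used at the
    second variable [y], the set has to be null for [N x] as well. *)
Hypothesis null_respecting : forall B, measurable B -> m B = 0%E ->
  {ae m, forall x, N x B = 0%E}.
Variable p : R.
Hypotheses (p1 : 1 < p) (p2 : p <= 2).

Lemma dissipated_bound (e : R) (f : T -> R) (t1 : R) : 0 < e -> bint m f -> 0 <= t1 ->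
  (\int[lebesgue_measure]_t
     (if ((0 < t) && (t <= t1))%R then dissipated m N p e (psg k t f) else 0) <=
   (2 / (p - 1) * \int[m]_x pPhi p e (f x))%:E)%E.
Proof.
move=> e0 bf t10; have c0 : 0 < (p - 1) / 2 by rewrite divr_gt0// subr_gt0.
have c00 : (0 <= ((p - 1) / 2)%:E :> \bar R)%E by rewrite lee_fin ltW.
have := dissipation_bound kP energy_lower_bound p1 p2 e0 bf t10.
set a := (fun t : R => if _ then dissipated _ _ _ _ _ else _ : \bar R).
have a0 : nnm (a : measurableTypeR R -> \bar R).
  apply: nnm_if; last exact: nnm_cst.
    by apply: measurable_and; [exact: measurable_fun_ltr|exact: measurable_fun_ler].
  exact: (nnm_dissipated kP N p e bf).
rewrite (_ : (\int[_]_t (if _ then _ * _ else _) =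
    ((p - 1) / 2)%:E * \int[lebesgue_measure]_t a t)%E); last first.
  rewrite -(@nnm_integralZl _ (measurableTypeR R) R lebesgue_measure a _ a0 c00).
  by apply: eq_integral => t _; rewrite /a; case: ifP => _ //; rewrite mule0.
move=> h; rewrite -(@lee_pmul2l _ ((p - 1) / 2)%:E)//.
rewrite -EFinM; set I := Rintegral _ _ _.
have -> // : (p - 1) / 2 * (2 / (p - 1) * I) = I.
by field; rewrite subr_eq0 gt_eqF.
Qed.

Variable f : T -> R.
Hypothesis mf : measurable_fun [set: T] f.
Hypothesis fLp : (\int[m]_x (`|f x| `^ p)%:E < +oo)%E.
Local Notation u := (fun t x => psg k t f x).

Lemma nnm_limit_inner : nnm (fun z : R * T => (\int[N z.2]_y
  (limit_density p (psg k z.1 f z.2) (psg k z.1 f y))%:E)%E).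
Proof.
pose F (z : (R * T) * T) :=
  (limit_density p (psg k z.1.1 f z.1.2) (psg k z.1.1 f z.2))%:E.
suff F0 : nnm F by exact: (@nnm_integral_sfker _ _ _ R T T R N F F0).
split; last by move=> z; rewrite lee_fin limit_density_ge0.
have mP := measurable_psg_joint kP mf.
apply/measurable_EFinP; apply: measurable_limit_density.
- exact: (measurableT_comp mP measurable_fst).
- apply: (measurableT_comp mP (g := fun z : (R * T) * T => (z.1.1, z.2))).
  apply: measurable_fun_pair; last exact: measurable_snd.
  exact: (measurableT_comp measurable_fst measurable_fst).
Qed.

Definition limit_dissipated t : \bar R := (\int[m]_x \int[N x]_y
  (limit_density p (psg k t f x) (psg k t f y))%:E)%E.

Lemma nnm_limit_dissipated : nnm limit_dissipated.
Proof.
have [mI I0] := nnm_limit_inner.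
split; last by move=> t; apply: integral_ge0 => x _; exact: I0 (t, x).
exact: (measurable_fun_fubini_tonelli_F (m2 := m) _ mI I0).
Qed.

Lemma measurable_psg1 t : measurable_fun [set: T] (psg k t f).
Proof.
exact: (measurableT_comp (measurable_psg_joint kP mf) (measurable_pair1 t)).
Qed.

(** Fatou's lemma twice: for [m] in [x], and for [N x] in [y] at those [x] for which the bad set is
    [N x]-null. *)
Lemma limit_dissipated_le (A : nat -> set T) t : 0 <= t ->
  (forall n, measurable (A n)) -> (forall n, (m (A n) < +oo)%E) ->
  (forall n, A n `<=` A n.+1) -> (forall x, exists n, A n x) ->
  (limit_dissipated t <= limn_einf (fun n =>
    dissipated m N p n.+1%:R^-1 (psg k t (trunc A n f))))%E.
Proof.
move=> t0 mA Afin Asub AT.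
have mB := measurable_bad_set kP mf t.
have B0 := bad_set_null kP p1 mf fLp t0.
have bt n : bint m (trunc A n f) by exact: bint_trunc.
have sect (g : T -> R) (D : R -> R -> R) x : measurable_fun [set: T] g ->
    (forall a b, 0 <= D a b) ->
    (forall a b : T -> R, measurable_fun [set: T] a -> measurable_fun [set: T] b ->
      measurable_fun [set: T] (fun z => D (a z) (b z))) ->
    nnm (fun y => (D (g x) (g y))%:E).
  move=> mg D0 mD; split; last by move=> y; rewrite lee_fin.
  by apply/measurable_EFinP; apply: mD => //; exact: measurable_cst.
apply: fatou_ae.
- move=> n; have [mI I0] := nnm_dissipation_inner kP N p n.+1%:R^-1 (bt n).
  split; last by move=> x; exact: I0 (t, x).
  exact: (measurableT_comp mI (measurable_pair1 t)).
- have [mI I0] := nnm_limit_inner.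
  split; last by move=> x; exact: I0 (t, x).
  exact: (measurableT_comp mI (measurable_pair1 t)).
have nB : {ae m, forall x, ~ bad_set k f t x}.
  exists (bad_set k f t); split => //.
  by move=> x /= /contrapT.
have := null_respecting mB B0; apply: filterS2 nB => x nBx NB.
apply: fatou_ae.
- move=> n; apply: (sect _ (coercive_density p n.+1%:R^-1)).
  + exact: (measurable_psg kP t (bt n)).
  + by move=> a b; exact: coercive_density_ge0.
  + by move=> a b ma mb; exact: measurable_coercive_density.
- apply: (sect _ (limit_density p)).
  + exact: measurable_psg1.
  + by move=> a b; exact: limit_density_ge0.
  + by move=> a b ma mb; exact: measurable_limit_density.
exists (bad_set k f t); split => // y /=; apply: contra_notP => nBy.
apply: limit_density_le_einf; [exact: psg_trunc_cvg|exact: psg_trunc_cvg|].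
exact: cvg_harmonic.
Qed.

(** The constant combines the coercivity factor [(p - 1) / 2] with [Phi <= |a| ^ p / p]. *)
Lemma dissipation_lp :
  (\int[lebesgue_measure]_t (if (0 < t)%R then limit_dissipated t else 0) <=
   (2 / (p - 1) / p)%:E * \int[m]_x (`|f x| `^ p)%:E)%E.
Proof.
have [A [mA Afin Asub AT]] := sigma_finite_exhaustion m.
have bt n : bint m (trunc A n f) by exact: bint_trunc.
have p0 : 0 < p by exact: lt_trans p1.
(* The time window, the truncation and the regularization share the index [n], so that a single
   limit removes all three. *)
pose G n (t : measurableTypeR R) : \bar R := if (0 < t) && (t <= n%:R) then
   dissipated m N p n.+1%:R^-1 (psg k t (trunc A n f)) else 0%E.
apply: (@fatou_le _ (measurableTypeR R) R (@lebesgue_measure R) G).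
- move=> n; apply: nnm_if; last exact: nnm_cst.
    by apply: measurable_and; [exact: measurable_fun_ltr|exact: measurable_fun_ler].
  exact: (nnm_dissipated kP N p _ (bt n)).
- apply: nnm_if; [exact: measurable_fun_ltr| |exact: nnm_cst].
  exact: nnm_limit_dissipated.
- apply: aeW => t; case: ifPn => [t0|_].
    apply: le_trans (limit_dissipated_le (ltW t0) mA Afin Asub AT) _.
    apply: (@le_limn_einf_eventually _ _ _ (Num.truncn t).+1) => n tn.
    rewrite /G t0/= ifT//; apply: le_trans (ltW (truncnS_gt _)) _.
    by rewrite ler_nat.
  apply: (@le_limn_einf_cvg _ (fun=> 0)); first exact: cvg_cst.
  move=> n; rewrite /G; case: ifP => // _.
  by apply: integral_ge0 => x _; apply: integral_ge0 => y _;
    rewrite lee_fin coercive_density_ge0.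
- move=> n; have e0 : 0 < n.+1%:R^-1 :> R by rewrite invr_gt0.
  apply: le_trans (dissipated_bound e0 (bt n) (ler0n _ n)) _.
  have bP := bint_pPhi p1 p2 e0 (bt n).
  have c0 : 0 <= 2 / (p - 1) by rewrite divr_ge0// subr_ge0 ltW.
  rewrite EFinM [(_ / p)%:E]EFinM -muleA; apply: lee_wpmul2l; first by rewrite lee_fin.
  rewrite /Rintegral fineK; last exact: integrable_fin_num (bint_integrable bP).
  rewrite -(nnm_integralZl m (nnm_norm_powR p mf)); last by rewrite lee_fin invr_ge0 ltW.
  apply: nnm_le_integral.
  + by apply: (bint_nnm bP) => x; exact: pPhi_ge0.
  + apply: nnmM; last exact: nnm_norm_powR.
    by apply: nnm_cst; rewrite lee_fin invr_ge0 ltW.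
  + move=> x; rewrite -EFinM lee_fin; apply: le_trans (pPhi_le_powR p1 p2 e0 _) _.
    rewrite mulrC; apply: ler_wpM2l; first by rewrite invr_ge0 ltW.
    by apply: ge0_ler_powR; rewrite ?nnegrE ?(ltW p0)// trunc_norm_le.
Qed.

End DissipationLp.

(** * The maximal function of the semigroup *)

Section RunningMax.
Context {d : measure_display} {T : measurableType d} {R : realType}.

Fixpoint running_max (u : nat -> T -> \bar R) n (x : T) : \bar R :=
  if n is n'.+1 then maxe (running_max u n' x) (u n x) else u 0%N x.

Lemma running_max_attained u n x :
  exists2 j, (j <= n)%N & running_max u n x = u j x.
Proof.
elim: n => [|n [j jn IH]] /=; first by exists 0%N.
rewrite IH; have [_|_] := leP (u j x) (u n.+1 x); first by exists n.+1.
by exists j => //; exact: leqW.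
Qed.

Lemma le_running_max u n j x : (j <= n)%N -> (u j x <= running_max u n x)%E.
Proof.
elim: n => [|n IH] /=; first by rewrite leqn0 => /eqP ->.
rewrite leq_eqVlt => /orP[/eqP ->|]; first by rewrite le_max lexx orbT.
by rewrite ltnS => /IH h; rewrite le_max h.
Qed.

Lemma nnm_running_max u n : (forall j, nnm (u j)) -> nnm (running_max u n).
Proof.
move=> u0; elim: n => [|n [mM M0]] //=; split.
  by apply: measurable_maxe => //; exact: (u0 _).1.
by move=> x; rewrite le_max M0.
Qed.

End RunningMax.

Lemma ge0_le_poweR {R : realType} (q : R) (x y : \bar R) : 0 <= q ->
  (0 <= x)%E -> (x <= y)%E -> (x `^ q <= y `^ q)%E.
Proof.
move=> q0 x0 xy; apply: (gt0_ler_poweR q0) => //; rewrite in_itv/= leey andbT//.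
exact: le_trans xy.
Qed.

Section MaximalFunction.
Context {d : measure_display} {T : measurableType d} {R : realType}.
Variable m : {sigma_finite_measure set T -> \bar R}.
Variable k : R -> T -> {measure set T -> \bar R}.
Hypothesis kP : symmetric_semigroup m k.
Variable p : R.
Hypotheses (p1 : 1 < p).
Local Notation P t := (kint (k t)).

Lemma iter_semigroup (s : R) j (g : T -> \bar R) : 0 <= s -> nnm g ->
  iter j (P s) g = P (j%:R * s) g.
Proof.
move=> s0 g0; elim: j => [|j IH].
  by rewrite mul0r; apply/funext => x /=; rewrite (sg_0 kP g0).
rewrite iterS IH; apply/funext => x.
by rewrite -(sg_add kP) ?mulr_ge0// -natr1 mulrDl mul1r addrC.
Qed.

(** The chain runs with step [s / 2]: then [P_(j s)] is the [j]-th iterate applied to the [j]-th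
    iterate, the form that [discrete_maximal] requires. *)
Lemma semigroup_maximal (s : R) n (g : T -> R) : 0 <= s -> bint m g ->
    (forall x, 0 <= g x) ->
  (\int[m]_x (running_max (fun j => P (j%:R * s) (EFin \o g)) n x `^ p) <=
   (maximal_cst p)%:E * \int[m]_x (`|g x| `^ p)%:E)%E.
Proof.
move=> s0 bg g0; have g0' := bint_nnm bg g0.
have s20 : 0 <= s / 2 by rewrite divr_ge0.
have [_ [L gL] ig] := bg.
have -> : (\int[m]_x (`|g x| `^ p)%:E = \int[m]_x ((EFin \o g) x `^ p))%E.
  by apply: eq_integral => x _; rewrite /= ger0_norm.
apply: (@discrete_maximal _ _ _ m (k (s / 2)) _ _ _ p (EFin \o g) _ L n) => //.
- by move=> U mU; exact: (sg_measurable1 kP).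
- by move=> x; exact: (sg_le1 kP).
- by move=> a b a0 b0; exact: (sg_sym kP).
- by move=> x; rewrite lee_fin; apply: le_trans (gL x); exact: ler_norm.
- move/integrableP : ig => [_]; apply: le_lt_trans.
  by apply: nnm_le_integral => // [|x]; [split; [apply: measurableT_comp => //; exact: g0'.1|] |exact: lee_abs].
- by apply: nnm_running_max => j; exact: (sg_nnm kP).
- move=> x; have [j jn ->] := running_max_attained (fun j => P (j%:R * s) (EFin \o g)) n x.
  exists j => //; have nQ := sg_nnm kP (j%:R * (s / 2)) g0'.
  rewrite (iter_semigroup j s20 g0') (iter_semigroup j s20 nQ).
  by rewrite -(sg_add kP) ?mulr_ge0// -mulrDr -splitr.
Qed.

Variable f : T -> R.
Hypothesis mf : measurable_fun [set: T] f.
Hypothesis fLp : (\int[m]_x (`|f x| `^ p)%:E < +oo)%E.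
Variable A : nat -> set T.
Hypotheses (mA : forall n, measurable (A n))
  (Afin : forall n, (m (A n) < +oo)%E)
  (Asub : forall n, A n `<=` A n.+1) (AT : forall x, exists n, A n x).

Let g n x := `|trunc A n f x|.

Let bg n : bint m (g n).
Proof. by apply: bint_norm; exact: bint_trunc. Qed.

Let g0 n x : 0 <= g n x. Proof. exact: normr_ge0. Qed.

Let g_mono n n' x : (n <= n')%N -> g n x <= g n' x.
Proof.
move=> nn'; rewrite /g /trunc !normrM; apply: ler_wpM2l => //.
rewrite !indicE !normr_nat ler_nat.
have [|_] := boolP (x \in trunc_set A n f) => //.
by rewrite inE => /(trunc_setS Asub nn') h; rewrite mem_set.
Qed.

(** The grid has step [2 ^ (- n)] and reaches up to time [n]. Both the grids and the truncations of
    [|f|] increase with [n]. *)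
Definition dyadic_max n : T -> \bar R :=
  running_max (fun j => P (j%:R * (2 ^+ n)^-1) (EFin \o (fun x => `|trunc A n f x|)))
    (n * 2 ^ n).

(** The [p]-th power of the maximal function; as a lower limit of [p]-th powers it is bounded by
    Fatou's lemma directly. *)
Definition maximal_function (x : T) : \bar R :=
  limn_einf (fun n => (dyadic_max n x `^ p)%E).

Lemma nnm_dyadic_max n : nnm (dyadic_max n).
Proof.
by apply: nnm_running_max => j; apply: (sg_nnm kP); exact: (bint_nnm (bg n)).
Qed.

Lemma nnm_maximal_function : nnm maximal_function.
Proof.
have nV n := nnm_poweR p (nnm_dyadic_max n).
split; first by apply: measurable_fun_limn_einf => n; exact: (nV n).1.
move=> x; apply: (@le_limn_einf_cvg _ (fun=> 0)); first exact: cvg_cst.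
by move=> n; exact: (nV n).2.
Qed.

Lemma maximal_function_le : (\int[m]_x maximal_function x <=
  (maximal_cst p)%:E * \int[m]_x (`|f x| `^ p)%:E)%E.
Proof.
have p0 : 0 <= p by rewrite ltW// (lt_trans _ p1).
have C0 := ltW (maximal_cst_gt0 p1).
apply: (@fatou_le _ _ _ m (fun n x => (dyadic_max n x `^ p)%E)).
- by move=> n; exact: nnm_poweR (nnm_dyadic_max n).
- exact: nnm_maximal_function.
- exact: aeW.
move=> n; have s0 : 0 <= (2 ^+ n)^-1 :> R by rewrite invr_ge0 exprn_ge0.
apply: le_trans (semigroup_maximal _ s0 (bg n) (@g0 n)) _.
apply: lee_wpmul2l; first by rewrite lee_fin.
apply: nnm_le_integral; [exact: (nnm_norm_powR p (bint_measurable (bg n)))|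
  exact: (nnm_norm_powR p mf)|].
move=> x; rewrite lee_fin /g normr_id; apply: ge0_ler_powR; rewrite ?nnegrE//.
exact: trunc_norm_le.
Qed.

(** For [i] at least [n], [L] and [j], the truncation at [i] dominates the one at [n], and [j / 2^L]
    is the point of index [j 2^(i - L) <= i 2^i] of the [i]-th grid. *)
Lemma dyadic_le_maximal n L j x :
  ((psg k (j%:R * (2 ^+ L)^-1) (g n) x `^ p)%:E <= maximal_function x)%E.
Proof.
have p0 : 0 <= p by rewrite ltW// (lt_trans _ p1).
have -> : (psg k (j%:R * (2 ^+ L)^-1) (g n) x `^ p)%:E =
    limn_einf (fun _ : nat => (psg k (j%:R * (2 ^+ L)^-1) (g n) x `^ p)%:E).
  by rewrite (cvg_limn_einf_sup (cvg_cst _)).1.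
apply: (@le_limn_einf_eventually _ _ _ (maxn (maxn n L) j)) => i.
rewrite !geq_max -andbA => /and3P[ni Li ji].
rewrite -poweR_EFin; apply: ge0_le_poweR => //; first by rewrite lee_fin psg_ge0.
rewrite (EFin_psg kP _ _ (bg n)).
apply: le_trans (_ : P (j%:R * (2 ^+ L)^-1) (EFin \o g i) x <= _)%E.
  apply: kint_le; [exact: (bint_nnm (bg n))|exact: (bint_nnm (bg i))|].
  by move=> y; rewrite lee_fin g_mono.
have -> : j%:R * (2 ^+ L)^-1 = (j * 2 ^ (i - L))%N%:R * (2 ^+ i)^-1 :> R.
  rewrite natrM natrX -{2}(subnK Li) exprD invfM -!mulrA; congr (_ * _).
  by rewrite mulrA divff ?mul1r// expf_neq0.
apply: le_running_max; apply: leq_mul => //.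
by rewrite leq_exp2l// leq_subr.
Qed.

(* By convexity of the correlation the increment of [P_t h] over a time [s] is
   [O(s)] in the squared norm when [t > 0], so that no continuity of the
   semigroup at time [0] is needed. *)
Lemma dyadic_approx (t : R) h (e : R) : 0 < t -> bint m h -> 0 < e ->
  exists L j, let D x := psg k (j%:R * (2 ^+ L)^-1) h x - psg k t h x in
    bint m D /\ dot m D D <= e.
Proof.
move=> t0 bh e0; have bPh := bint_psg kP (ltW t0) bh.
have [_ [M gM]] := form_domain_psg kP t0 bh.
have M0 : 0 <= M.
  by have := gM 1 ltr01 (lexx _); rewrite mulr1; apply: le_trans;
    apply: (gap_ge0 kP).
(* A time increment [s <= 1] costs at most [2 M s] in the squared norm, which [d'] keeps below [e];
   [M + 1] replaces [M], which may be 0. *)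
pose d' := Num.min 1 (e / (2 * (M + 1))).
have d0 : 0 < d' by rewrite lt_min ltr01 divr_gt0// mulr_gt0// ltr_wpDl.
pose L := Num.truncn d'^-1.
have Ld : (2 ^+ L)^-1 < d'.
  rewrite -[ltRHS]invrK ltf_pV2 ?posrE ?exprn_gt0 ?invr_gt0//.
  apply: lt_le_trans (truncnS_gt _) _.
  by rewrite -natrX ler_nat ltn_expl.
have h0 : 0 < (2 ^+ L)^-1 :> R by rewrite invr_gt0 exprn_gt0.
(* The first multiple of [2 ^ (- L)] strictly after [t], so that the increment runs forward from
   [t]. *)
pose j := (Num.truncn (t * 2 ^+ L)).+1.
have tL0 : 0 <= t * 2 ^+ L by rewrite mulr_ge0 ?exprn_ge0// ltW.
have q1 : t < j%:R * (2 ^+ L)^-1.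
  by rewrite ltr_pdivlMr ?exprn_gt0//; exact: truncnS_gt.
have q2 : j%:R * (2 ^+ L)^-1 <= t + (2 ^+ L)^-1.
  rewrite ler_pdivrMr ?exprn_gt0// mulrDl mulVf ?expf_neq0//.
  by rewrite /j -natr1 lerD2r truncn_le.
pose s := j%:R * (2 ^+ L)^-1 - t.
have s0 : 0 < s by rewrite subr_gt0.
have sd : s <= d' by apply: le_trans (ltW Ld); rewrite lerBlDl.
exists L, j; rewrite /= -(subrK t (j%:R * (2 ^+ L)^-1)) -/s.
have bD := bintB (bint_psg kP (addr_ge0 (ltW s0) (ltW t0)) bh) bPh.
split => //.
have -> : (fun x => psg k (s + t) h x - psg k t h x) =
    (fun x => - (psg k t h x - psg k s (psg k t h) x)).
  by apply/funext => x; rewrite (psg_add kP x (ltW s0) (ltW t0) bh) opprB.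
have -> (D : T -> R) : dot m (fun x => - D x) (fun x => - D x) = dot m D D.
  by rewrite !dotE; apply: eq_Rintegral => x _; rewrite mulrNN.
rewrite (norm_increment kP (ltW s0) bPh).
have s1 : s <= 1 by apply: le_trans sd _; rewrite ge_min lexx.
have G1 := gM s s0 s1.
have G2 := gap_ge0 kP (addr_ge0 (ltW s0) (ltW s0)) bPh.
have se : s * (2 * (M + 1)) <= e.
  rewrite -ler_pdivlMr ?mulr_gt0 ?ltr_wpDl//.
  by apply: le_trans sd _; rewrite ge_min lexx orbT.
apply: le_trans (_ : 2 * (M * s) <= _); last first.
  apply: le_trans se; rewrite [leRHS]mulrC -[leRHS]mulrA ler_pM2l//.
  by rewrite ler_pM2r// lerDl.
apply: le_trans (_ : 2 * gap m k (psg k t h) s <= _).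
  by rewrite gerDl oppr_le0.
by rewrite ler_pM2l.
Qed.

Lemma cvg_le_bound (u : nat -> R) (a c : R) : u l @[l --> \oo] --> a ->
  (forall l, u l <= c) -> a <= c.
Proof.
move=> ua uc; rewrite -(cvg_lim (@Rhausdorff R) ua); apply: limr_le.
  by apply/cvg_ex; exists a.
exact: nearW.
Qed.

Lemma powR_le_root (r v : R) : 0 <= r -> 0 <= v -> (v `^ p <= r) = (v <= r `^ p^-1).
Proof.
have p0 : 0 < p by rewrite (lt_trans _ p1).
have ip0 : 0 <= p^-1 by rewrite invr_ge0 ltW.
move=> r0 v0; apply/idP/idP => h.
  have := ge0_ler_powR ip0 (powR_ge0 _ _ : v `^ p \in Num.nneg) (r0 : r \in Num.nneg) h.
  by rewrite -powRrM divff ?gt_eqF// powRr1.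
have := ge0_ler_powR (ltW p0) (v0 : v \in Num.nneg) (powR_ge0 _ _ : _ \in Num.nneg) h.
by rewrite -powRrM mulVf ?gt_eqF// powRr1.
Qed.

(** For each truncation, dyadic times are chosen whose squared error is at most [2 ^ (- l)]; the
    values then converge almost everywhere, and the bound passes to time [t]. Off the bad set it
    then passes from the truncations to [f]. *)
Lemma psg_le_maximal t : 0 < t ->
  {ae m, forall x, ((`|psg k t f x| `^ p)%:E <= maximal_function x)%E}.
Proof.
move=> t0; have t0' := ltW t0.
have each n : {ae m, forall x, ((psg k t (g n) x `^ p)%:E <= maximal_function x)%E}.
  pose D L j x := psg k (j%:R * (2 ^+ L)^-1) (g n) x - psg k t (g n) x.
  have ex l : exists Lj : nat * nat, bint m (D Lj.1 Lj.2) /\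
      dot m (D Lj.1 Lj.2) (D Lj.1 Lj.2) <= (2 ^+ l)^-1.
    have e0 : 0 < (2 ^+ l)^-1 :> R by rewrite invr_gt0 exprn_gt0.
    by have [L [j h]] := dyadic_approx t0 (bg n) e0; exists (L, j).
  have [w hw] := choice ex.
  have := ae_cvg0_summable (fun l => (hw l).1) (fun l => (hw l).2).
  apply: filterS => x /subr_cvg0 c.
  case W : (maximal_function x) => [r| |]; last 2 first.
    by rewrite leey.
    by have := nnm_maximal_function.2 x; rewrite W.
  have r0 : 0 <= r by have := nnm_maximal_function.2 x; rewrite W lee_fin.
  rewrite lee_fin powR_le_root ?psg_ge0//; apply: cvg_le_bound c _ => l.
  by rewrite -powR_le_root ?psg_ge0// -lee_fin -W dyadic_le_maximal.
have nB : {ae m, forall x, ~ bad_set k f t x}.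
  exists (bad_set k f t); split; [exact: (measurable_bad_set kP)|exact: (bad_set_null kP p1)|].
  by move=> x /= /contrapT.
have := ae_foralln each; apply: filterS2 nB => x nBx le_n.
case W : (maximal_function x) => [r| |]; last 2 first.
  by rewrite leey.
  by have := nnm_maximal_function.2 x; rewrite W.
have r0 : 0 <= r by have := nnm_maximal_function.2 x; rewrite W lee_fin.
have /cvg_norm c := psg_trunc_cvg mf mA Asub AT nBx.
rewrite lee_fin powR_le_root//; apply: cvg_le_bound c _ => n.
apply: le_trans (psg_norm kP t x (bint_trunc mA Afin n mf)) _.
by rewrite -powR_le_root ?psg_ge0// -lee_fin -W; exact: le_n.
Qed.

End MaximalFunction.

Import HBNNSimple.

(** * The square function *)

Section LowerIntegral.
Context {d : measure_display} {T : measurableType d} {R : realType}.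
Variable m : {measure set T -> \bar R}.
Local Open Scope ereal_scope.

(* The integral of a nonnegative function is the supremum of the integrals of
   the simple functions below it, whether the function is measurable or not. *)
Lemma integral_le_nnm (f g : T -> \bar R) : (forall x, 0 <= f x) -> nnm g ->
  {ae m, forall x, f x <= g x} -> \int[m]_x f x <= \int[m]_x g x.
Proof.
move=> f0 [mg g0] fg; rewrite ge0_integralTE//; apply: ge_ereal_sup => _ [h hf <-].
rewrite -integralT_nnsfun; apply: ae_ge0_le_integral => //.
- by move=> x _; rewrite lee_fin; exact: fun_ge0.
- exact/measurable_EFinP.
- by apply: filterS fg => x fg _; apply: le_trans (hf x) fg.
Qed.

End LowerIntegral.

Section SquareFunction.
Context {d : measure_display} {T : measurableType d} {R : realType}.
Variable m : {sigma_finite_measure set T -> \bar R}.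
Variable k : R -> T -> {measure set T -> \bar R}.
Hypothesis kP : symmetric_semigroup m k.
Variable N : R.-sfker T ~> T.
Hypothesis energy_lower_bound : forall u v,
  form_domain m k u -> form_domain m k v ->
  (forall x y, 0 <= (u y - u x) * (v y - v x)) ->
  exists2 l : R, s^-1 * (dot m u v - dot m (psg k s u) v) @[s --> 0^'+] --> l &
    ((2^-1)%:E * \int[m]_x \int[N x]_y ((u y - u x) * (v y - v x))%:E <= l%:E)%E.
Hypothesis null_respecting : forall B, measurable B -> m B = 0%E ->
  {ae m, forall x, N x B = 0%E}.
Variable p : R.
Hypotheses (p1 : 1 < p) (p2 : p <= 2).
Let p0 : 0 < p. Proof. exact: lt_trans p1. Qed.

(* Where [chi] does not vanish the maximum in [limit_density] is [a ^+ 2]. *)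
Lemma chi_density_le (a b : R) :
  (b - a) ^+ 2 * chi a b <= `|a| `^ (2 - p) * limit_density p a b.
Proof.
have rhs0 : 0 <= `|a| `^ (2 - p) * limit_density p a b.
  by rewrite mulr_ge0 ?powR_ge0 ?limit_density_ge0.
have [ab|ba] := ltP `|a| `|b|.
  by rewrite /chi ltNge (ltW ab)/= (lt_eqF ab) mulr0.
have [a0|a0] := eqVneq a 0.
  have b0 : b = 0 by apply/eqP; rewrite -normr_le0 (le_trans ba)// a0 normr0.
  by rewrite a0 b0 subrr expr0n mul0r mulr_ge0 ?powR_ge0 ?limit_density_ge0.
have na : 0 < `|a| by rewrite normr_gt0.
rewrite /limit_density (max_idPl _); last first.
  by rewrite -(real_normK (num_real a)) -(real_normK (num_real b)) ler_pXn2r ?nnegrE.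
rewrite -(real_normK (num_real a)) -(powR_mulrn 2 (normr_ge0 a)) -powRrM.
rewrite mulrCA -powRD; last by rewrite (gt_eqF na) implybT.
have -> : 2 - p + 2%:R * (p / 2 - 1) = 0 by field.
rewrite powRr0; apply: ler_wpM2l; first exact: sqr_ge0.
by rewrite /chi; case: ifP => // _; case: ifP => // _; rewrite invf_le1// ler1n.
Qed.

Variable f : T -> R.
Hypothesis mf : measurable_fun [set: T] f.
Hypothesis fLp : (\int[m]_x (`|f x| `^ p)%:E < +oo)%E.

Definition dissipation_at (x : T) : \bar R := (\int[lebesgue_measure]_t
  (if (0 < t)%R then \int[N x]_y (limit_density p (psg k t f x) (psg k t f y))%:E
   else 0))%E.

Let G (z : measurableTypeR R * T) : \bar R := if 0 < z.1 then
  (\int[N z.2]_y (limit_density p (psg k z.1 f z.2) (psg k z.1 f y))%:E)%E else 0%E.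

Let nnm_G : nnm G.
Proof.
apply: nnm_if; last exact: nnm_cst.
  apply: (@measurable_fun_ltr _ _ _ _ (fun=> 0)) => //.
exact: (nnm_limit_inner kP N p mf).
Qed.

Lemma nnm_dissipation_at : nnm dissipation_at.
Proof.
have [mG G0] := nnm_G; split; last by move=> x; apply: integral_ge0 => t _; exact: G0 (t, x).
exact: (measurable_fun_fubini_tonelli_G (m1 := @lebesgue_measure R) _ mG G0).
Qed.

Lemma integral_dissipation_at : (\int[m]_x dissipation_at x =
  \int[lebesgue_measure]_t (if (0 < t)%R then limit_dissipated m k N p f t else 0))%E.
Proof.
have [mG G0] := nnm_G.
have := @fubini_tonelli _ _ (measurableTypeR R) T R (@lebesgue_measure R) m _ mG G0.
rewrite /dissipation_at => <-; apply: eq_integral => t _; rewrite /G/=.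
by case: ifP => // _; rewrite integral0.
Qed.

Section Bound.
Variable A : nat -> set T.
Hypotheses (mA : forall n, measurable (A n))
  (Afin : forall n, (m (A n) < +oo)%E)
  (Asub : forall n, A n `<=` A n.+1) (AT : forall x, exists n, A n x).
Local Notation W := (maximal_function k p f A).

(** The exceptional null set of [psg_le_maximal] depends on [t]. Tonelli's theorem, applied to the
    indicator of the failure set in time and space, exchanges the two quantifiers. *)
Lemma ae_le_maximal : {ae m, forall x, {ae @lebesgue_measure R, forall t,
  0 < t -> ((`|psg k t f x| `^ p)%:E <= W x)%E}}.
Proof.
pose B (z : measurableTypeR R * T) : \bar R :=
  if (0 < z.1) && (W z.2 < (`|psg k z.1 f z.2| `^ p)%:E)%E then 1%E else 0%E.
have mP := measurable_psg_joint kP mf.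
have B0 : nnm B.
  apply: nnm_if; [|exact: nnm_cst|exact: nnm_cst].
  apply: measurable_and; first exact: (@measurable_fun_ltr _ _ _ _ (fun=> 0)).
  apply: measurable_fun_lte.
    exact: (measurableT_comp (nnm_maximal_function kP p mf mA Afin).1 measurable_snd).
  apply/measurable_EFinP; apply: (measurableT_comp (measurable_powR p)).
  exact: measurableT_comp.
have := @fubini_tonelli _ _ (measurableTypeR R) T R (@lebesgue_measure R) m _ B0.1 B0.2.
rewrite (eq_integral (fun=> 0%E)) ?integral0; last first.
  move=> t _; have [t0|t0] := ltP 0 t; last first.
    by rewrite (eq_integral (fun=> 0%E)) ?integral0// => x _; rewrite /B ltNge t0.
  rewrite -(integral0 m [set: T]); apply: ae_eq_integral => //.
    exact: (measurableT_comp B0.1 (measurable_pair1 t)).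
  have := psg_le_maximal kP p1 mf fLp mA Afin Asub AT t0; apply: filterS => x h _.
  by rewrite /B/= t0/= ltNge h.
move=> /esym h.
have mH : nnm (fun x => \int[lebesgue_measure]_t B (t, x))%E.
  split; last by move=> x; apply: integral_ge0 => t _; exact: B0.2 (t, x).
  exact: (measurable_fun_fubini_tonelli_G (m1 := @lebesgue_measure R) _ B0.1 B0.2).
have : (\int[m]_x `|\int[lebesgue_measure]_t B (t, x)| = 0)%E.
  by rewrite -[RHS]h; apply: eq_integral => x _; rewrite gee0_abs// mH.2.
move/(ae_eq_integral_abs m measurableT mH.1); apply: filterS => x /(_ I) hx.
have mBx : measurable_fun [set: measurableTypeR R] (fun t => B (t, x)).
  exact: (measurableT_comp B0.1 (measurable_pair2 x)).
have : (\int[lebesgue_measure]_t `|B (t, x)| = 0)%E.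
  by rewrite -[RHS]hx; apply: eq_integral => t _; rewrite gee0_abs// B0.2.
move/(ae_eq_integral_abs _ measurableT mBx); apply: filterS => t /(_ I) + t0.
rewrite /B/= t0/=; case: ltP => // _ /eqP.
by rewrite onee_eq0.
Qed.

(** Let [r] be the maximum of [W x] and [dissipation_at x]. As [W] is already a [p]-th power,
    [|u_t(x)| ^ (2 - p) <= r ^ ((2 - p) / p)], so [S <= r ^ (2 / p)]. *)
Lemma square_function_le (x : T) (S : \bar R) : (0 <= S)%E ->
  (S <= \int[lebesgue_measure]_t (if (0 < t)%R then
    \int[N x]_y ((psg k t f y - psg k t f x) ^+ 2 *
      chi (psg k t f x) (psg k t f y))%:E else 0))%E ->
  {ae @lebesgue_measure R, forall t, 0 < t -> ((`|psg k t f x| `^ p)%:E <= W x)%E} ->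
  (S `^ (p / 2) <= W x + dissipation_at x)%E.
Proof.
move=> S0 Sle uW.
have W0 := (nnm_maximal_function kP p mf mA Afin).2 x.
have I0 := nnm_dissipation_at.2 x.
apply: le_trans (_ : maxe (W x) (dissipation_at x) <= _)%E; last first.
  by rewrite ge_max leeDl// leeDr.
case M : (maxe (W x) (dissipation_at x)) => [r| |]; last 2 first.
- by rewrite leey.
- by have : (0 <= maxe (W x) (dissipation_at x))%E; [rewrite le_max W0|rewrite M].
have r0 : 0 <= r by rewrite -lee_fin -M le_max W0.
have Wr : (W x <= r%:E)%E by rewrite -M le_max lexx.
have Ir : (dissipation_at x <= r%:E)%E by rewrite -M le_max lexx orbT.
have q0 : 0 <= (2 - p) / p by rewrite divr_ge0 ?subr_ge0// ltW.
have Sr : (S <= (r `^ ((2 - p) / p) * r)%:E)%E.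
  apply: le_trans Sle _.
  rewrite EFinM; apply: le_trans (lee_wpmul2l _ Ir); last by rewrite lee_fin powR_ge0.
  have nGx : nnm (fun t : measurableTypeR R => G (t, x)).
    split; last by move=> t; exact: nnm_G.2.
    exact: (measurableT_comp nnm_G.1 (measurable_pair2 x)).
  have c0 : (0 <= (r `^ ((2 - p) / p))%:E)%E by rewrite lee_fin powR_ge0.
  rewrite /dissipation_at -(@nnm_integralZl _ (measurableTypeR R) R lebesgue_measure
    (fun t => G (t, x)) _ nGx c0).
  apply: integral_le_nnm.
  - move=> t; case: ifP => // _; apply: integral_ge0 => y _; rewrite lee_fin.
    rewrite mulr_ge0 ?sqr_ge0// /chi; case: ifP => // _; case: ifP => // _.
  - by apply: nnmM nGx; exact: nnm_cst.
  have FF := @ae_filter_ringOfSetsType _ (measurableTypeR R) R (@lebesgue_measure R).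
  apply: (@filterS _ _ FF) uW => t; rewrite /G/=; case: ifP => [t0 /(_ isT) ut|_ _]; last by rewrite mule0.
  have mPt : nnm (fun y => (limit_density p (psg k t f x) (psg k t f y))%:E).
    split; last by move=> y; rewrite lee_fin limit_density_ge0.
    apply/measurable_EFinP; apply: measurable_limit_density; first exact: measurable_cst.
    exact: (measurable_psg1 kP mf).
  rewrite -(nnm_integralZl (N x) mPt c0); apply: integral_le_nnm.
  - move=> y; rewrite lee_fin.
    by rewrite mulr_ge0 ?sqr_ge0// /chi; case: ifP => // _; case: ifP => // _.
  - by apply: nnmM mPt; exact: nnm_cst.
  apply: aeW => y; rewrite -EFinM lee_fin; apply: le_trans (chi_density_le _ _) _.
  apply: ler_wpM2r; first exact: limit_density_ge0.
  have := le_trans ut Wr; rewrite lee_fin => ur.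
  have -> : `|psg k t f x| `^ (2 - p) = (`|psg k t f x| `^ p) `^ ((2 - p) / p).
    by rewrite -powRrM mulrCA divff ?mulr1// gt_eqF.
  by apply: ge0_ler_powR; rewrite ?nnegrE ?powR_ge0.
apply: le_trans (ge0_le_poweR _ S0 Sr) _; first by rewrite divr_ge0// ltW.
rewrite poweR_EFin lee_fin powRM ?powR_ge0// -powRrM.
have -> : (2 - p) / p * (p / 2) = 1 - p / 2 by field; rewrite gt_eqF.
have [->|rn0] := eqVneq r 0.
  by rewrite [X in _ * X]powR0 ?mulr0// mulf_neq0 ?gt_eqF.
by rewrite -powRD ?rn0 ?implybT// subrK powRr1.
Qed.

End Bound.

(** [S] stands for the square of the square function. It is compared almost everywhere with an
    integral against the s-finite kernel [N]; [integral_le_nnm] then passes to the measurable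
    majorant. *)
Lemma lp_square_function (S : T -> \bar R) : (forall x, 0 <= S x)%E ->
  {ae m, forall x, (S x <= \int[lebesgue_measure]_t (if (0 < t)%R then
    \int[N x]_y ((psg k t f y - psg k t f x) ^+ 2 *
      chi (psg k t f x) (psg k t f y))%:E else 0))%E} ->
  (\int[m]_x (S x `^ (p / 2)) <=
   (maximal_cst p + 2 / (p - 1) / p)%:E * \int[m]_x (`|f x| `^ p)%:E)%E.
Proof.
move=> S0 Sle; have [A [mA Afin Asub AT]] := sigma_finite_exhaustion m.
have nW := nnm_maximal_function kP p mf mA Afin.
have nI := nnm_dissipation_at.
apply: le_trans (_ : \int[m]_x (maximal_function k p f A x + dissipation_at x) <= _)%E.
  apply: integral_le_nnm.
  - by move=> x; exact: poweR_ge0.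
  - exact: nnmD.
  apply: filterS2 Sle (ae_le_maximal mA Afin Asub AT) => x; exact: square_function_le.
rewrite (nnm_integralD m nW nI) EFinD ge0_muleDl ?lee_fin; last 2 first.
- exact: ltW (maximal_cst_gt0 p1).
- by rewrite divr_ge0 ?(ltW p0)// divr_ge0// subr_ge0 ltW.
apply: leeD; first exact: (maximal_function_le kP p1 mf mA Afin).
rewrite integral_dissipation_at.
exact: (dissipation_lp kP energy_lower_bound null_respecting p1 p2 mf fLp).
Qed.

End SquareFunction.

(** * The transition kernels of a Hunt process *)

Section NonnegInduction.
Context {d : measure_display} {T : measurableType d} {R : realType}.
Local Open Scope ereal_scope.

Lemma nnm_approx (f : T -> \bar R) : nnm f -> exists h : nat -> {nnsfun T >-> R},
  (forall x i j, (i <= j)%N -> (h i x <= h j x)%R) /\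
  forall x, (h n x)%:E @[n --> \oo] --> f x.
Proof.
move=> [mf f0]; exists (nnsfun_approx measurableT mf); split.
  by move=> x i j ij; have /lefP := nd_nnsfun_approx measurableT mf ij; exact.
by move=> x; have := cvg_nnsfun_approx measurableT mf (fun x _ => f0 x) (x := x) I.
Qed.

Lemma nnm_cvg_integral (mu : {measure set T -> \bar R}) (F : nat -> T -> \bar R) f :
  (forall n, nnm (F n)) -> (forall x i j, (i <= j)%N -> F i x <= F j x) ->
  (forall x, F n x @[n --> \oo] --> f x) ->
  \int[mu]_x F n x @[n --> \oo] --> \int[mu]_x f x.
Proof.
move=> F0 Fnd Ff.
have -> : f = (fun x => limn (F ^~ x)).
  by apply/funext => x; exact/esym/cvg_lim.
apply: cvg_monotone_convergence => //.
- by move=> n; exact: (F0 n).1.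
- by move=> n x _; exact: (F0 n).2.
- by move=> x _ i j; exact: Fnd.
Qed.

Lemma nnm_nnsfun (h : {nnsfun T >-> R}) : nnm (EFin \o h).
Proof.
split; first exact/measurable_EFinP.
by move=> x; rewrite lee_fin; exact: fun_ge0.
Qed.

Lemma nnm_indic (U : set T) : measurable U -> nnm (fun x => (\1_U x)%:E : \bar R).
Proof.
by move=> mU; split; [apply/measurable_EFinP; exact: measurable_indic|move=> x; rewrite lee_fin].
Qed.

(** The functional monotone class principle: a nonnegative measurable function is an increasing
    limit of simple functions, which are built from indicators one value at a time. *)
Lemma nnm_ind (Q : (T -> \bar R) -> Prop) :
  (forall U, measurable U -> Q (fun x => (\1_U x)%:E)) ->
  (forall (c : R) f g, (0 <= c)%R -> nnm f -> nnm g -> Q f -> Q g ->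
     Q (fun x => c%:E * f x + g x)) ->
  (forall (F : nat -> T -> \bar R) f, (forall n, nnm (F n)) ->
     (forall x i j, (i <= j)%N -> F i x <= F j x) ->
     (forall x, F n x @[n --> \oo] --> f x) -> (forall n, Q (F n)) -> Q f) ->
  forall f, nnm f -> Q f.
Proof.
move=> Qind Qlin Qlim f f0; have [h [hnd hf]] := nnm_approx f0.
apply: (Qlim (fun n => EFin \o h n)) => //; first by move=> n; exact: nnm_nnsfun.
move=> n; set g := h n.
pose lev y : set T := g @^-1` [set y].
have mlev y : measurable (lev y) by exact: measurable_funPTI.
(* The coefficient [max y 0] is nonnegative for every real [y], as the induction over arbitrary
   lists requires; on the range of [g] it is [y]. *)
pose S s x := \sum_(y <- s) ((Num.max y 0)%:E * (\1_(lev y) x)%:E).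
have nS s : nnm (S s) /\ Q (S s).
  elim: s => [|y s [IH1 IH2]].
    have -> : S [::] = (fun x => (\1_(@set0 T) x)%:E).
      by apply/funext => x; rewrite /S big_nil indic0.
    by split; [exact: nnm_indic|exact: Qind].
  have -> : S (y :: s) = (fun x => (Num.max y 0)%:E * (\1_(lev y) x)%:E + S s x).
    by apply/funext => x; rewrite /S big_cons.
  have m0 : (0 <= Num.max y 0)%R by rewrite le_max lexx orbT.
  split; last by apply: Qlin => //; [exact: nnm_indic|exact: Qind].
  by apply: nnmD => //; apply: nnmM; [exact: nnm_cst|exact: nnm_indic].
have -> : EFin \o g = S (finmap.enum_fset (fset_set (range g))).
  apply/funext => x; rewrite /S /comp [in LHS]fimfunE fsbig_finite//=.
  rewrite -sumEFin; apply: eq_bigr => y _; rewrite -EFinM; congr (_%:E).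
  rewrite indicE; case: (boolP (x \in _)); last by rewrite !mulr0.
  rewrite inE => <-; rewrite (max_idPl _)//; exact: fun_ge0.
exact: (nS _).2.
Qed.

(** Multiplication by [+oo] is discontinuous at 0, but a nondecreasing sequence is either
    identically 0 or eventually positive. *)
Lemma cvge_mull_nondecreasing (c : \bar R) (u : nat -> \bar R) (l : \bar R) :
  0 <= c -> (forall n, 0 <= u n) -> (forall i j, (i <= j)%N -> u i <= u j) ->
  u n @[n --> \oo] --> l -> c * u n @[n --> \oo] --> c * l.
Proof.
move=> c0 u0 und ul; case: c c0 => [c| |//] c0; first exact: cvgeZl.
have ule n : u n <= l.
  rewrite -(cvg_lim _ ul)//; apply: lime_ge; first by apply/cvg_ex; exists l.
  by exists n => // i /= ni; exact: und.
have [[N uN]|] := pselect (exists N, 0 < u N); last first.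
  move=> nu; have un0 n : u n = 0.
    by apply/eqP; rewrite eq_le u0 andbT leNgt; apply/negP => h; apply: nu; exists n.
  have l0 : l = 0.
    by rewrite -(cvg_lim _ ul)//; under eq_fun do rewrite un0; rewrite lim_cst.
  by rewrite l0; under eq_fun do rewrite un0; exact: cvg_cst.
rewrite gt0_mulye; last exact: lt_le_trans (ule N).
apply: (@cvg_near_cst _ _ +oo%E); exists N => // n /= Nn.
by rewrite gt0_mulye//; exact: lt_le_trans (und _ _ Nn).
Qed.

End NonnegInduction.

(** * From indicators to nonnegative functions *)

Section KernelOnIndicators.
Context {d : measure_display} {T : measurableType d} {R : realType}.
Variable m : {measure set T -> \bar R}.
Variable k : R -> T -> {measure set T -> \bar R}.
Hypothesis mk : forall U, measurable U ->
  measurable_fun [set: R * T] (fun z => k z.1 z.2 U).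
Hypothesis k1 : forall t x, (k t x [set: T] <= 1)%E.
Hypothesis k0 : forall U x, measurable U -> k 0 x U = (\1_U x)%:E.
Hypothesis kadd : forall s t U x, 0 <= s -> 0 <= t -> measurable U ->
  k (s + t) x U = (\int[k s x]_y k t y U)%E.
Hypothesis ksym : forall t (f g : T -> R), 0 <= t ->
  measurable_fun [set: T] f -> measurable_fun [set: T] g ->
  (forall x, 0 <= f x) -> (forall x, 0 <= g x) ->
  (\int[m]_x ((f x)%:E * kint (k t) (EFin \o g) x) =
   \int[m]_x ((g x)%:E * kint (k t) (EFin \o f) x))%E.
Local Open Scope ereal_scope.
Local Notation P t := (kint (k t)).

Let P_nnm t g : nnm g -> nnm (P t g).
Proof.
move=> g0; apply: kint_nnm => // U mU.
rewrite [X in measurable_fun _ X](_ : _ = (fun z : R * T => k z.1 z.2 U) \o pair t)//.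
by apply: measurableT_comp; [exact: mk|exact: measurable_pair1].
Qed.

Lemma kint_indic t U x : measurable U -> P t (fun y => (\1_U y)%:E) x = k t x U.
Proof. by move=> mU; rewrite /kint integral_indic// setIT. Qed.

Lemma kint_lin t (c : R) f g x : (0 <= c)%R -> nnm f -> nnm g ->
  P t (fun y => c%:E * f y + g y) x = c%:E * P t f x + P t g x.
Proof.
move=> c0 f0 g0; have nc := nnm_cst (c0 : 0 <= c%:E).
by rewrite /kint (nnm_integralD _ (nnmM (nc _ _) f0) g0) nnm_integralZl.
Qed.

Lemma kint_cvg t (F : nat -> T -> \bar R) f x : (forall n, nnm (F n)) ->
  (forall x i j, (i <= j)%N -> F i x <= F j x) ->
  (forall x, F n x @[n --> \oo] --> f x) -> P t (F n) x @[n --> \oo] --> P t f x.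
Proof. exact: nnm_cvg_integral. Qed.

Let P_nd t (F : nat -> T -> \bar R) : (forall n, nnm (F n)) ->
  (forall x i j, (i <= j)%N -> F i x <= F j x) ->
  forall x i j, (i <= j)%N -> P t (F i) x <= P t (F j) x.
Proof. by move=> F0 Fnd x i j ij; apply: kint_le => // y; exact: Fnd. Qed.

Let P_sym_l t (f : {nnsfun T >-> R}) g : (0 <= t)%R -> nnm g ->
  \int[m]_x ((f x)%:E * P t g x) = \int[m]_x (g x * P t (EFin \o f) x).
Proof.
move=> t0 g0; have [h [hnd hg]] := nnm_approx g0.
have nh n := nnm_nnsfun (h n); have nf := nnm_nnsfun f.
have hnd' x i j : (i <= j)%N -> (EFin \o h i) x <= (EFin \o h j) x.
  by move=> ij; rewrite lee_fin hnd.
have L : \int[m]_x ((f x)%:E * P t (EFin \o h n) x) @[n --> \oo] -->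
    \int[m]_x ((f x)%:E * P t g x).
  apply: nnm_cvg_integral.
  - by move=> n; apply: nnmM => //; exact: P_nnm.
  - by move=> x i j ij; apply: lee_wpmul2l; [exact: nf.2|exact: (P_nd t nh hnd')].
  - move=> x; have kc := kint_cvg (t := t) (x := x) nh hnd' hg.
    apply: cvge_mull_nondecreasing kc; first exact: nf.2.
      by move=> n; exact: (P_nnm _ (nh n)).2.
    by move=> i j; exact: (P_nd t nh hnd').
have Rr : \int[m]_x ((h n x)%:E * P t (EFin \o f) x) @[n --> \oo] -->
    \int[m]_x (g x * P t (EFin \o f) x).
  apply: nnm_cvg_integral.
  - by move=> n; apply: nnmM; [exact: nh|exact: P_nnm].
  - by move=> x i j ij; apply: lee_wpmul2r; [exact: (P_nnm _ nf).2|exact: hnd'].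
  - move=> x; rewrite muleC; under eq_fun do rewrite muleC.
    apply: cvge_mull_nondecreasing; [exact: (P_nnm _ nf).2| | |exact: hg].
      by move=> n; exact: (nh n).2.
    by move=> i j; exact: hnd'.
suff E : (fun n => \int[m]_x ((f x)%:E * P t (EFin \o h n) x)) =
    (fun n => \int[m]_x ((h n x)%:E * P t (EFin \o f) x)).
  by rewrite E in L; exact: (cvg_unique (@ereal_hausdorff R) L Rr).
by apply/funext => n; apply: ksym => // x; exact: fun_ge0.
Qed.

(** The value at time 0 and the semigroup law extend from indicators by [nnm_ind]. Symmetry, given
    for real functions, extends by increasing approximation of one argument at a time, [P_sym_l]
    being the halfway stage. *)
Lemma symmetric_semigroup_indic : symmetric_semigroup m k.
Proof.
split => //.
- apply: nnm_ind => [U mU x|c f g c0 f0 g0 If Ig x|F f F0 Fnd Ff IF x].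
  + by rewrite kint_indic// k0.
  + by rewrite kint_lin// If Ig.
  + have L := kint_cvg (t := 0%R) (x := x) F0 Fnd Ff.
    have E : (fun n => P 0%R (F n) x) = F ^~ x by apply/funext => n; rewrite IF.
    by rewrite E in L; exact: (cvg_unique (@ereal_hausdorff R) L (Ff x)).
- move=> s t g s0 t0; move: g.
  apply: nnm_ind => [U mU x|c f g c0 f0 g0 If Ig x|F f F0 Fnd Ff IF x].
  + rewrite kint_indic// kadd//; apply: eq_integral => y _.
    by rewrite kint_indic.
  + rewrite kint_lin// If Ig -kint_lin//; [|exact: P_nnm..].
    by apply: eq_integral => y _; rewrite kint_lin.
  + have L := kint_cvg (t := (s + t)%R) (x := x) F0 Fnd Ff.
    have E : (fun n => P (s + t)%R (F n) x) = (fun n => P s (P t (F n)) x).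
      by apply/funext => n; rewrite IF.
    rewrite E in L; apply: (cvg_unique (@ereal_hausdorff R) L).
    apply: kint_cvg; first by move=> n; exact: P_nnm.
      exact: P_nd.
    by move=> y; exact: kint_cvg.
- move=> t f g t0 f0 g0; have [h [hnd hf]] := nnm_approx f0.
  have nh n := nnm_nnsfun (h n).
  have hnd' x i j : (i <= j)%N -> (EFin \o h i) x <= (EFin \o h j) x.
    by move=> ij; rewrite lee_fin hnd.
  have L : \int[m]_x (g x * P t (EFin \o h n) x) @[n --> \oo] -->
      \int[m]_x (g x * P t f x).
    apply: nnm_cvg_integral.
    - by move=> n; apply: nnmM => //; exact: P_nnm.
    - by move=> x i j ij; apply: lee_wpmul2l; [exact: g0.2|exact: (P_nd t nh hnd')].
    - move=> x; have kc := kint_cvg (t := t) (x := x) nh hnd' hf.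
      apply: cvge_mull_nondecreasing kc; first exact: g0.2.
        by move=> n; exact: (P_nnm _ (nh n)).2.
      by move=> i j; exact: (P_nd t nh hnd').
  apply/esym; apply: (cvg_unique (@ereal_hausdorff R) L).
  rewrite (_ : (fun n => _) = (fun n => \int[m]_x ((h n x)%:E * P t g x))); last first.
    by apply/funext => n; rewrite P_sym_l.
  apply: nnm_cvg_integral.
  - by move=> n; apply: nnmM; [exact: nh|exact: P_nnm].
  - by move=> x i j ij; apply: lee_wpmul2r; [exact: (P_nnm _ g0).2|exact: hnd'].
  - move=> x; rewrite muleC; under eq_fun do rewrite muleC.
    apply: cvge_mull_nondecreasing; [exact: (P_nnm _ g0).2| | |exact: hf].
      by move=> n; exact: (nh n).2.
    by move=> i j; exact: hnd'.
Qed.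

End KernelOnIndicators.

(** * Images of measures under partial maps *)

Section PartialImage.
Context {d d' : measure_display} {O : measurableType d} {T : measurableType d'}
  {R : realType}.

Definition extend (g : T -> \bar R) (z : option T) : \bar R :=
  if z is Some x then g x else 0%E.

Variable phi : O -> option T.
Hypothesis mphi : forall B, measurable B -> measurable (phi @^-1` (Some @` B)).

Lemma extend_indic U w :
  extend (fun x => (\1_U x)%:E) (phi w) = (\1_(phi @^-1` (Some @` U)) w)%:E.
Proof.
have mem x : phi w = Some x -> (w \in phi @^-1` (Some @` U)) = (x \in U).
  move=> E; apply/idP/idP; rewrite !inE/= E; first by move=> [y Uy [<-]].
  by move=> Ux; exists x.
rewrite /extend; case E : (phi w) => [x|]; first by rewrite !indicE (mem x E).
by rewrite indicE (_ : (w \in _) = false)//; apply/negP; rewrite inE/= E => -[].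
Qed.

Lemma extend_lin (c : R) (f h : T -> \bar R) w :
  extend (fun x => c%:E * f x + h x)%E (phi w) =
  (c%:E * extend f (phi w) + extend h (phi w))%E.
Proof. by rewrite /extend; case: (phi w) => //; rewrite mule0 adde0. Qed.

Lemma nnm_extend g : nnm g -> nnm (fun w => extend g (phi w)).
Proof.
apply: (@nnm_ind _ _ _ (fun g => nnm (fun w => extend g (phi w)))) =>
  [U mU|c f h c0 f0 h0 If Ih|F f F0 Fnd Ff IF].
- rewrite (_ : (fun _ => _) = (fun w => (\1_(phi @^-1` (Some @` U)) w)%:E)).
    by apply: nnm_indic; exact: mphi.
  by apply/funext => w; rewrite extend_indic.
- rewrite (_ : (fun _ => _) = (fun w => c%:E * extend f (phi w) + extend h (phi w))%E).
    by apply: nnmD Ih; apply: nnmM If; exact: nnm_cst.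
  by apply/funext => w; rewrite extend_lin.
- split; last first.
    move=> w; rewrite /extend; case: (phi w) => [x|] //.
    rewrite -(cvg_lim _ (Ff x))//; apply: lime_ge; first by apply/cvg_ex; exists (f x).
    by apply: nearW => n; exact: (F0 n).2.
  apply: (@emeasurable_fun_cvg _ _ _ _ (fun n w => extend (F n) (phi w))).
    by move=> n; exact: (IF n).1.
  by move=> w _; rewrite /extend; case: (phi w) => [x|]; [exact: Ff|exact: cvg_cst].
Qed.

Variable mu : {measure set O -> \bar R}.

(** The push-forward of [mu] restricted to the points sent to [Some]; the mass sent to [None] is
    lost. Additivity rests on the injectivity of [Some]. *)
Lemma partial_image_measure : exists nu : {measure set T -> \bar R},
  forall B, measurable B -> nu B = mu (phi @^-1` (Some @` B)).
Proof.
pose nu B := mu (phi @^-1` (Some @` B)).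
have nu0 : nu set0 = 0%E by rewrite /nu image_set0 preimage_set0 measure0.
have nu_ge0 B : (0 <= nu B)%E by exact: measure_ge0.
have nu_add : semi_sigma_additive nu.
  move=> F mF tF mUF; rewrite /nu image_bigcup preimage_bigcup.
  apply: measure_semi_sigma_additive => //.
  - by move=> n; exact: mphi.
  - apply/trivIsetP => i j _ _ ij; rewrite -preimage_setI.
    rewrite (_ : _ `&` _ = set0) ?preimage_set0//.
    apply/seteqP; split => // z [[x Fx <-] [y Fy [yx]]].
    have : (F i `&` F j) x by split => //; rewrite -yx.
    by move/trivIsetP : tF => /(_ _ _ I I ij) ->.
  - by rewrite -preimage_bigcup -image_bigcup; exact: mphi.
pose nuM : {measure set T -> \bar R} :=
  HB.pack nu (isMeasure.Build _ T R nu nu0 nu_ge0 nu_add).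
by exists nuM.
Qed.

Lemma integral_partial_image (nu : {measure set T -> \bar R}) :
  (forall B, measurable B -> nu B = mu (phi @^-1` (Some @` B))) ->
  forall g, nnm g -> (\int[nu]_y g y = \int[mu]_w extend g (phi w))%E.
Proof.
move=> nuE.
apply: (@nnm_ind _ _ _ (fun g => \int[nu]_y g y = \int[mu]_w extend g (phi w))%E) =>
  [U mU|c f h c0 f0 h0 If Ih|F f F0 Fnd Ff IF].
- rewrite integral_indic// setIT nuE// -[in LHS](setIT (phi @^-1` _)).
  rewrite -integral_indic//; last exact: mphi.
  by apply: eq_integral => w _; rewrite extend_indic.
- have nc := nnm_cst (c0 : (0 <= c%:E)%E).
  rewrite (nnm_integralD _ (nnmM (nc _ _) f0) h0) nnm_integralZl// If Ih.
  rewrite -(nnm_integralZl _ (nnm_extend f0))// -nnm_integralD.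
  + by apply: eq_integral => w _; rewrite extend_lin.
  + by apply: nnmM; [exact: nc|exact: nnm_extend].
  + exact: nnm_extend.
- have L := nnm_cvg_integral (mu := nu) F0 Fnd Ff.
  have E : (fun n => \int[nu]_y F n y)%E = (fun n => \int[mu]_w extend (F n) (phi w))%E.
    by apply/funext => n; rewrite IF.
  rewrite E in L; apply: (cvg_unique (@ereal_hausdorff R) L).
  apply: nnm_cvg_integral; first by move=> n; exact: nnm_extend.
  + by move=> w i j ij; rewrite /extend; case: (phi w) => // x; exact: Fnd.
  + by move=> w; rewrite /extend; case: (phi w) => [x|]; [exact: Ff|exact: cvg_cst].
Qed.

End PartialImage.

(** * Borel sets of the state space and of its compactification *)

Section BorelSets.
Context {R : realType} {E : pmetricType R}.
Local Notation C := (cemetery E).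

Lemma borel_open (U : set E) : open U -> measurable (U : set (borel E)).
Proof. by move=> oU; exact: sub_gen_smallest. Qed.

Lemma borel_closed (A : set E) : closed A -> measurable (A : set (borel E)).
Proof.
move=> cA; rewrite -[A]setCK; apply: measurableC.
by apply: borel_open; exact: closed_openC.
Qed.

Lemma continuous_borel (f : E -> R) : continuous f ->
  measurable_fun [set: borel E] (f : borel E -> R).
Proof.
move=> cf; apply: (@measurability _ _ (borel E) (measurableTypeR R) _ f _ (RGenOpens.measurableE R)).
move=> _ [_ [x [y ->]] <-]; rewrite setTI.
apply: borel_open; move/continuousP : cf; apply; exact: interval_open.
Qed.

Lemma measurable_image_some (B : set (borel E)) : measurable B ->
  measurable (Some @` B : set (borel C)).
Proof.
have oS (U : set E) : open U -> measurable (Some @` U : set (borel C)).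
  move=> oU; apply: sub_gen_smallest.
  exact: one_point_compactification_open_some.
move: B; apply: smallest_sub; last by move=> U oU; exact: oS.
split.
- by rewrite image_set0; exact: measurable0.
- move=> A mA; rewrite (_ : Some @` _ = (Some @` [set: E]) `\` (Some @` A)).
    by apply: measurableD => //; apply: oS; exact: openT.
  apply/seteqP; split => [_ [x [_ nAx] <-]|_ [[x _ <-] nAx]].
    by split; [exists x|move=> [y Ay [yx]]; apply: nAx; rewrite -yx].
  by exists x => //; split => // Ax; apply: nAx; exists x.
- by move=> F mF; rewrite image_bigcup; exact: bigcupT_measurable.
Qed.

Definition set_dist (A : set E) (x : E) : R := inf [set mdist x a | a in A].

Section SetDist.
Variable A : set E.
Hypothesis A0 : A !=set0.

Let has x : has_inf [set mdist x a | a in A].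
Proof.
have [a Aa] := A0; split; first by exists (mdist x a), a.
by exists 0 => _ [b _ <-]; exact: mdist_ge0.
Qed.

Lemma set_dist_ge0 x : 0 <= set_dist A x.
Proof.
have [a Aa] := A0; apply: lb_le_inf; first by exists (mdist x a), a.
by move=> _ [b _ <-]; exact: mdist_ge0.
Qed.

Lemma set_dist_le x y : set_dist A x <= mdist x y + set_dist A y.
Proof.
rewrite -lerBlDl; apply: lb_le_inf; first by have [a Aa] := A0; exists (mdist y a), a.
move=> _ [a Aa <-]; rewrite lerBlDl; apply: le_trans (metric_triangle x y a).
by apply: ge_inf; [exact: (has _).2|exists a].
Qed.

Lemma set_dist_in x : A x -> set_dist A x = 0.
Proof.
move=> Ax; apply/eqP; rewrite eq_le set_dist_ge0 andbT -(mdistxx x).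
by apply: ge_inf; [exact: (has _).2|exists x].
Qed.

Lemma continuous_set_dist : continuous (set_dist A).
Proof.
move=> x; apply/cvgrPdist_lt => e e0.
have : ball x e `<=` [set y | `|set_dist A x - set_dist A y| < e].
  move=> y; rewrite ballEmdist/= => xy; apply: le_lt_trans xy.
  rewrite ler_norml lerBlDr set_dist_le andbT lerNl opprB lerBlDr.
  by rewrite metric_sym set_dist_le.
by move=> h; apply: (filterS h); exact: nbhsx_ballx.
Qed.

Lemma set_dist_gt0 x : closed A -> ~ A x -> 0 < set_dist A x.
Proof.
move=> cA nAx; have : nbhs x (~` A) by apply: open_nbhs_nbhs; split => //; exact: closed_openC.
move/nbhs_ballP => [e /= e0 xe]; apply: lt_le_trans e0 _.
apply: lb_le_inf; first by have [a Aa] := A0; exists (mdist x a), a.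
move=> _ [a Aa <-]; rewrite leNgt; apply/negP => ax.
by apply: (xe a) => //; rewrite ballEmdist.
Qed.

End SetDist.

(** The functions are [min(1, n d(x, U^c))]. If the complement is empty the infimum defining the
    distance is meaningless, and the constant 1 serves. *)
Lemma open_indic_approx (U : set E) : open U -> exists g : nat -> E -> R,
  [/\ forall n, continuous (g n), forall n x, 0 <= g n x <= 1,
      forall x i j, (i <= j)%N -> g i x <= g j x &
      forall x, g n x @[n --> \oo] --> (\1_U x : R)].
Proof.
move=> oU; have [UC0|nUC0] := pselect (exists x, (~` U) x); last first.
  exists (fun _ _ => 1); split => //.
  - by move=> n x; exact: cvg_cst.
  - by move=> n x; rewrite ler01 lexx.
  - move=> x; rewrite indicE mem_set; first exact: cvg_cst.
    by apply: contrapT => nUx; apply: nUC0; exists x.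
pose D := set_dist (~` U); have D0 := set_dist_ge0 UC0.
exists (fun n => (fun=> 1) \min (fun x => n%:R * D x)); split.
- move=> n x; apply: continuous_min; first exact: cvg_cst.
  by apply: cvgM; [exact: cvg_cst|exact: continuous_set_dist].
- by move=> n x /=; rewrite ge_min lexx le_min ler01 mulr_ge0.
- move=> x i j ij /=; rewrite le_min ge_min lexx/=.
  by rewrite ge_min ler_wpM2r ?orbT// ler_nat.
move=> x; have [Ux|nUx] := pselect (U x); rewrite indicE; last first.
  have Dx : D x = 0 by exact: set_dist_in.
  rewrite memNset//; apply: cvg_near_cst; apply: nearW => n /=.
  by rewrite Dx mulr0 (min_idPr ler01).
rewrite (@mem_set _ U x Ux); have Dx : 0 < D x.
  by apply: set_dist_gt0 => //; exact: open_closedC.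
apply: cvg_near_cst; exists (Num.truncn (D x)^-1).+1 => // n /= hn.
rewrite (min_idPl _)// -ler_pdivrMr// div1r; apply: le_trans (ltW (truncnS_gt _)) _.
by rewrite ler_nat.
Qed.

End BorelSets.

(** * Discretization of time *)

Section DiscreteTime.
Context {d : measure_display} {T : measurableType d} {R : realType}.

Lemma measurable_discrete_time (phi : R -> nat) (F : nat -> T -> \bar R) :
  (forall j, measurable (phi @^-1` [set j])) ->
  (forall j, measurable_fun [set: T] (F j)) ->
  measurable_fun [set: R * T] (fun z => F (phi z.1) z.2).
Proof.
move=> mphi mF _ Y mY; rewrite setTI.
have -> : (fun z : R * T => F (phi z.1) z.2) @^-1` Y =
    \bigcup_j ((fst @^-1` (phi @^-1` [set j])) `&` (snd @^-1` (F j @^-1` Y))).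
  apply/seteqP; split => [z Yz|z [j _ [/= <-]]] //.
  by exists (phi z.1).
apply: bigcupT_measurable => j; apply: measurableI.
  by rewrite -[X in measurable X]setTI; exact: measurable_fst.
rewrite -[X in measurable X]setTI; apply: measurable_snd => //.
by rewrite -[X in measurable X]setTI; exact: mF.
Qed.

Definition time_step n (t : R) : nat := Num.truncn (Num.max t 0 * n.+1%:R).

Lemma measurable_time_step n j : measurable (time_step n @^-1` [set j]).
Proof.
have mx : measurable_fun [set: R] (fun t : R => Num.max t 0 * n.+1%:R).
  by apply: measurable_funM => //; exact: measurable_maxr.
rewrite (_ : _ @^-1` _ =
    (fun t : R => Num.max t 0 * n.+1%:R) @^-1` [set` `[j%:R, j.+1%:R[%R]).
  by rewrite -[X in measurable X]setTI; exact: mx.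
apply/seteqP; split => t /=; rewrite in_itv/= /time_step.
  by move=> <-; rewrite truncn_itv// mulr_ge0// le_max lexx orbT.
by move=> h; apply/truncn_def.
Qed.

(** The first multiple of [1 / (n + 1)] strictly after [max(t, 0)]; it approaches from the right,
    where the paths are continuous. *)
Definition next_time n (t : R) : R := (time_step n t).+1%:R / n.+1%:R.

Lemma next_time_gt n t : Num.max t 0 < next_time n t.
Proof. by rewrite /next_time ltr_pdivlMr ?ltr0n//; exact: truncnS_gt. Qed.

Lemma next_time_le n t : next_time n t <= Num.max t 0 + n.+1%:R^-1.
Proof.
rewrite /next_time ler_pdivrMr ?ltr0n// mulrDl mulVf ?pnatr_eq0//.
rewrite -[X in X <= _]natr1 lerD2r.
by rewrite truncn_le// mulr_ge0// le_max lexx orbT.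
Qed.

Lemma next_time_cvg t : next_time n t @[n --> \oo] --> Num.max t 0.
Proof.
apply: (@squeeze_cvgr _ _ _ _ (fun=> Num.max t 0) (fun n => Num.max t 0 + n.+1%:R^-1)).
- by apply: nearW => n; rewrite ltW ?next_time_gt//= next_time_le.
- exact: cvg_cst.
- rewrite -[X in _ --> X]addr0; apply: cvgD; first exact: cvg_cst.
  exact: cvg_harmonic.
Qed.

End DiscreteTime.

Section AlmostSureEvent.
Context {d : measure_display} {O : measurableType d} {R : realType}.
Variable mu : probability O R.

Lemma probability1_sub (N A : set O) : measurable N -> measurable A ->
  mu N = 1%E -> N `<=` A -> mu A = 1%E.
Proof.
move=> mN mA N1 NA; apply/eqP; rewrite eq_le probability_le1// -N1.
by apply: le_measure; rewrite ?inE.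
Qed.

Lemma probability1_disjoint (N A : set O) : measurable N -> measurable A ->
  mu N = 1%E -> N `<=` ~` A -> mu A = 0%E.
Proof.
move=> mN mA N1 NA; rewrite -[A]setCK probability_setC ?setCK; last exact: measurableC.
by rewrite (probability1_sub mN (measurableC mA) N1 NA) subee.
Qed.

End AlmostSureEvent.

(** * Transition kernels of the process *)

Section HuntKernel.
Context {R : realType} {E : pmetricType R} {d : measure_display}
  {Omega : measurableType d}.
Variables (P : cemetery E -> probability Omega R) (X : R -> Omega -> cemetery E).
Hypothesis hp : hunt_process P X.
(** The kernels are indexed by all reals, negative times being sent to 0; thus joint measurability
    makes sense on the whole line. *)
Local Notation pos t := (Num.max t 0).
Local Notation hit t B := (X (pos t) @^-1` (Some @` B)).

Let pos0 (t : R) : 0 <= pos t. Proof. by rewrite le_max lexx orbT. Qed.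

Lemma hit_measurable t (B : set (borel E)) : measurable B -> measurable (hit t B).
Proof.
move=> mB; rewrite -[X in measurable X]setTI.
by apply: (hunt_measurable hp) => //; exact: measurable_image_some.
Qed.

Lemma transition_kernel_ex : exists k : R -> borel E -> {measure set (borel E) -> \bar R},
  forall t x B, measurable B -> k t x B = P (Some x) (hit t B).
Proof.
have ex (z : R * borel E) : exists nu : {measure set (borel E) -> \bar R},
    forall B, measurable B -> nu B = P (Some z.2) (hit z.1 B).
  by apply: partial_image_measure; exact: hit_measurable.
have [k kE] := choice ex.
by exists (fun t x => k (t, x)) => t x B mB; exact: (kE (t, x)).
Qed.

Variable k : R -> borel E -> {measure set (borel E) -> \bar R}.
Hypothesis kE : forall t x B, measurable B -> k t x B = P (Some x) (hit t B).

Lemma kint_transition t (g : borel E -> \bar R) x : nnm g ->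
  (kint (k t) g x = \int[P (Some x)]_w extend g (X (pos t) w))%E.
Proof.
move=> g0; apply: (@integral_partial_image _ _ Omega (borel E) R (X (pos t)) _ (P (Some x))) => //.
- exact: hit_measurable.
- exact: kE.
Qed.

Lemma transition_le1 t x : (k t x [set: borel E] <= 1)%E.
Proof. by rewrite kE// probability_le1//; exact: hit_measurable. Qed.

Lemma measurable_transition t U : measurable U ->
  measurable_fun [set: borel E] (k t ^~ U).
Proof.
move=> mU; rewrite (_ : k t ^~ U = (fun x => P (Some x) (hit t U))).
  by apply: (hunt_kernel hp) => //; exact: measurable_image_some.
by apply/funext => x; rewrite kE.
Qed.

(* The extension of [g] by [0] may be discontinuous at the cemetery, but a path
   stays at the cemetery once it has reached it. *)
Lemma extend_right_continuous (g : E -> R) (t : R) (u : nat -> R) w :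
  continuous g -> 0 <= t -> (forall n, t < u n) -> u n @[n --> \oo] --> t ->
  extend (EFin \o (g : borel E -> R)) (X (u n) w) @[n --> \oo] -->
  extend (EFin \o (g : borel E -> R)) (X t w).
Proof.
move=> cg t0 tu ut.
have Xu : X (u n) w @[n --> \oo] --> X t w.
  apply: (cvg_comp u (fun s => X s w)); last exact: (hunt_rcont hp t0).
  move=> A [/= e e0 eA]; move/cvgrPdist_lt : ut => /(_ e e0).
  by apply: filterS => n ne; apply: eA.
case Xt : (X t w) => [y|].
  rewrite Xt in Xu => A /= Ay.
  have gA : nbhs y [set z | A (g z)%:E].
    have c : (g z)%:E @[z --> y] --> (g y)%:E by apply: cvg_EFin; [exact: nearW|exact: cg].
    exact: c.
  have h : \forall n \near \oo, [set Some x | x in [set z | A (g z)%:E]] (X (u n) w).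
    exact: Xu _ (@one_point_compactification_some_nbhs E y _ gA).
  have : \forall n \near \oo, A (extend (EFin \o (g : borel E -> R)) (X (u n) w)).
    by apply: filterS h => n [z Az /= <-].
  exact.
apply: cvg_near_cst; apply: nearW => n.
rewrite (hunt_lifetime hp (w := w) (t := u n)) ?(le_trans t0 (ltW _))//.
apply: le_trans (_ : t%:E <= _)%E; last by rewrite lee_fin ltW.
by apply: ereal_inf_lbound; exists t.
Qed.

Lemma kint_next_time (g : E -> R) t x : continuous g -> (forall y, 0 <= g y <= 1) ->
  kint (k (next_time n t)) (EFin \o (g : borel E -> R)) x @[n --> \oo] -->
  kint (k t) (EFin \o (g : borel E -> R)) x.
Proof.
move=> cg g01.
have g0 : nnm (EFin \o (g : borel E -> R)).
  split; first by apply/measurable_EFinP; exact: continuous_borel.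
  by move=> y; rewrite lee_fin; case/andP: (g01 y).
have nt n : pos (next_time n t) = next_time n t.
  by apply/max_idPl; exact: ltW (le_lt_trans (pos0 t) (next_time_gt n t)).
under eq_fun do rewrite (kint_transition _ _ g0).
rewrite (kint_transition _ _ g0).
have mX s : nnm (fun w => extend (EFin \o (g : borel E -> R)) (X (pos s) w)).
  by apply: nnm_extend => //; exact: hit_measurable.
apply: (@dominated_cvg _ _ _ _ _ measurableT _ _ (fun=> 1%E)) => //.
- by move=> n; exact: (mX _).1.
- move=> w _; under eq_fun do rewrite nt.
  apply: extend_right_continuous => //; first by move=> n; exact: next_time_gt.
  exact: next_time_cvg.
- exact: finite_measure_integrable_cst.
- move=> n w _; rewrite gee0_abs ?(mX _).2//.
  rewrite /extend; case: (X _ w) => [y|]; last exact: lee01.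
  by rewrite lee_fin; case/andP: (g01 y).
Qed.

(** Discretized times take countably many values, so that the discretized function is jointly
    measurable; the limit is taken by [kint_next_time]. *)
Lemma measurable_kint_joint (g : E -> R) : continuous g -> (forall y, 0 <= g y <= 1) ->
  measurable_fun [set: R * borel E] (fun z => kint (k z.1) (EFin \o (g : borel E -> R)) z.2).
Proof.
move=> cg g01.
have g0 : nnm (EFin \o (g : borel E -> R)).
  split; first by apply/measurable_EFinP; exact: continuous_borel.
  by move=> y; rewrite lee_fin; case/andP: (g01 y).
apply: (@emeasurable_fun_cvg _ _ _ _ (fun n (z : R * borel E) =>
    kint (k (next_time n z.1)) (EFin \o (g : borel E -> R)) z.2)).
  move=> n; apply: (@measurable_discrete_time _ (borel E) R (time_step n)
    (fun j x => kint (k (j.+1%:R / n.+1%:R)) (EFin \o (g : borel E -> R)) x)).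
    exact: measurable_time_step.
  move=> j; apply: (kint_nnm _ g0).1.
  by move=> U; exact: measurable_transition.
by move=> z _; exact: kint_next_time.
Qed.

(** Open sets are reached by continuous functions increasing to their indicators. The open sets form
    a pi-system, and Dynkin's lemma does the rest; complements use that the kernels are finite. *)
Lemma measurable_transition_joint U : measurable U ->
  measurable_fun [set: R * borel E] (fun z => k z.1 z.2 U).
Proof.
have openM (V : set E) : open V ->
    measurable_fun [set: R * borel E] (fun z => k z.1 z.2 (V : set (borel E))).
  move=> oV; have [g [cg g01 gnd gV]] := open_indic_approx oV.
  have nV : nnm (fun x : borel E => (\1_(V : set (borel E)) x)%:E : \bar R).
    by apply: nnm_indic; exact: borel_open.
  rewrite (_ : (fun _ => _) = (fun z : R * borel E =>
      kint (k z.1) (fun x => (\1_(V : set (borel E)) x)%:E) z.2)); last first.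
    by apply/funext => z; rewrite kint_indic//; exact: borel_open.
  apply: (@emeasurable_fun_cvg _ _ _ _ (fun n (z : R * borel E) =>
      kint (k z.1) (EFin \o (g n : borel E -> R)) z.2)).
    by move=> n; exact: measurable_kint_joint.
  move=> z _; apply: nnm_cvg_integral.
  - move=> n; split; first by apply/measurable_EFinP; exact: continuous_borel.
    by move=> y; rewrite lee_fin; case/andP: (g01 n y).
  - by move=> y i j ij; rewrite lee_fin gnd.
  - by move=> y; apply: cvg_EFin; [exact: nearW|exact: gV].
apply: (@dynkin_induction _ (borel E) (@open E)
  (fun U => measurable_fun [set: R * borel E] (fun z => k z.1 z.2 U))) => //.
- exact: openI.
- exact: (openM _ openT).
- move=> S mS IS; rewrite (_ : (fun _ => _) =
    (fun z : R * borel E => k z.1 z.2 [set: borel E] - k z.1 z.2 S)%E).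
    by apply: emeasurable_funB => //; exact: (openM _ openT).
  apply/funext => z; rewrite -(setUv S) measureU//; last 2 first.
  + exact: measurableC.
  + by rewrite setICr.
  rewrite addeAC subee ?add0e// ge0_fin_numE//.
  apply: le_lt_trans (_ : k z.1 z.2 [set: borel E] < +oo)%E.
    by apply: le_measure; rewrite ?inE.
  by apply: le_lt_trans (transition_le1 _ _) _; rewrite ltry.
- move=> F mF tF IF; rewrite (_ : (fun _ => _) =
    (fun z : R * borel E => \sum_(0 <= i <oo) k z.1 z.2 (F i))%E).
    by apply: ge0_emeasurable_sum => i.
  apply/funext => z; rewrite measure_bigcup//.
  by apply: eq_eseriesl => i; rewrite in_setT.
Qed.

Lemma transition0 (U : set (borel E)) x : measurable U -> k 0 x U = (\1_U x)%:E.
Proof.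
move=> mU; rewrite kE// max_l//.
have mN : measurable [set w | X 0 w = Some x].
  rewrite (_ : [set w | _] = hit 0 ([set x] : set (borel E))).
    apply: hit_measurable; apply: borel_closed.
    exact/accessible_closed_set1/hausdorff_accessible/metric_hausdorff.
  rewrite max_l//; apply/seteqP; split => w /=; first by move=> ->; exists x.
  by move=> [_ -> <-].
have mU0 : measurable (X 0 @^-1` (Some @` U)).
  by have := hit_measurable 0 mU; rewrite max_l.
have N1 := hunt_normal hp x.
have [Ux|nUx] := pselect (U x); rewrite indicE.
  rewrite mem_set//; apply: (probability1_sub mN mU0 N1).
  by move=> w /= ->; exists x.
rewrite memNset//; apply: (probability1_disjoint mN mU0 N1).
by move=> w /= -> [y Uy [yx]]; apply: nUx; rewrite -yx.
Qed.

Lemma transition_cemetery t (U : set (borel E)) : 0 <= t -> measurable U ->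
  P None (X t @^-1` (Some @` U)) = 0%E.
Proof.
move=> t0 mU; have pt : pos t = t by exact/max_idPl.
have mhit (B : set (borel E)) : measurable B -> measurable (X t @^-1` (Some @` B)).
  by move=> mB; rewrite -pt; exact: hit_measurable.
apply: (probability1_disjoint _ _ (hunt_cemetery hp t0)); [|exact: mhit|].
  rewrite (_ : [set w | _] = ~` (X t @^-1` (Some @` [set: borel E]))).
    by apply: measurableC; exact: mhit.
  apply/seteqP; split => w /=; first by move=> -> [].
  by case: (X t w) => // y; case; exists y.
by move=> w /= -> [].
Qed.

(** The strong Markov property at the constant time [s]; paths already at the cemetery contribute
    0. *)
Lemma transition_add s t (U : set (borel E)) x : 0 <= s -> 0 <= t -> measurable U ->
  k (s + t) x U = (\int[k s x]_y k t y U)%E.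
Proof.
move=> s0 t0 mU; have [M [[Ms Msub Mmono Mr] _ sm _]] := hunt_strong hp.
have ps : pos s = s by exact/max_idPl.
have pt : pos t = t by exact/max_idPl.
have pst : pos (s + t) = s + t by apply/max_idPl; rewrite addr_ge0.
pose sigma : Omega -> \bar R := fun=> s%:E.
have st : stopping_time M sigma.
  split; first by move=> w; rewrite lee_fin.
  move=> r r0; have [M0 MC _] := Ms r r0.
  have [sr|rs] := leP s r.
    rewrite (_ : [set w | _] = [set: Omega]); first by rewrite -setC0 -setTD; exact: MC.
    by apply/seteqP; split => w //= _; rewrite lee_fin.
  rewrite (_ : [set w | _] = set0)//; apply/seteqP; split => w //=.
  by rewrite lee_fin leNgt rs.
have se : stopped_events M sigma [set: Omega].
  by split => // r r0; rewrite setTI; exact: st.2.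
have := sm (Some x) sigma [set: Omega] (Some @` U) t st se (measurable_image_some mU) t0.
have -> : [set: Omega] `&` [set w | (sigma w < +oo)%E] = [set: Omega].
  by apply/seteqP; split => w //= _; split => //; rewrite ltry.
rewrite /= setTI => h.
rewrite kE// pst -[LHS]/(P (Some x) [set w | (Some @` U) (X (s + t) w)]) h.
have nk : nnm (k t ^~ U) by split; [exact: measurable_transition|].
rewrite -[RHS]/(kint (k s) (k t ^~ U) x) kint_transition// ps.
apply: eq_integral => w _; rewrite /extend; case: (X s w) => [y|].
  by rewrite kE// pt.
exact: transition_cemetery.
Qed.

Variable m : {measure set (borel E) -> \bar R}.
Hypothesis sym : symmetric_process P X m.

Lemma transition_symmetric_semigroup : symmetric_semigroup m k.
Proof.
apply: symmetric_semigroup_indic.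
- exact: measurable_transition_joint.
- exact: transition_le1.
- exact: transition0.
- exact: transition_add.
move=> t f g t0 mf mg f0 g0; have pt : pos t = t by exact/max_idPl.
have nn (h : borel E -> R) : measurable_fun [set: borel E] h -> (forall x, 0 <= h x) ->
    nnm (EFin \o h).
  by move=> mh h0; split; [exact/measurable_EFinP|move=> x; rewrite lee_fin].
have ext (h : borel E -> R) x : measurable_fun [set: borel E] h -> (forall x, 0 <= h x) ->
    (kint (k t) (EFin \o h) x = \int[P (Some x)]_w (extend0 h (X t w))%:E)%E.
  move=> mh h0; rewrite kint_transition ?pt; last exact: nn.
  by apply: eq_integral => w _; rewrite /extend /extend0; case: (X t w).
under eq_integral do rewrite ext//.
by rewrite sym//; apply: eq_integral => x _; rewrite ext.
Qed.

(** The positive and negative parts have the same integrals on both sides, so that the two values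
    also agree where they are default values of divergent integrals. *)
Lemma semigroup_psg t (f : borel E -> R) x : 0 <= t ->
  measurable_fun [set: borel E] f -> semigroup P X t f x = psg k t f x.
Proof.
move=> t0 mf; have pt : pos t = t by exact/max_idPl.
have mF : measurable_fun [set: borel E] (EFin \o f) by exact/measurable_EFinP.
have np : nnm (fun x => ((EFin \o f) ^\+ x)%E).
  by split; [exact: measurable_funepos|move=> y; exact: funepos_ge0].
have nn : nnm (fun x => ((EFin \o f) ^\- x)%E).
  by split; [exact: measurable_funeneg|move=> y; exact: funeneg_ge0].
rewrite psgE /semigroup /Rintegral; congr fine.
rewrite integralE [in RHS]integralE; congr (_ - _)%E.
  rewrite -[RHS]/(kint (k t) (fun x => ((EFin \o f) ^\+ x)%E) x) kint_transition// pt.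
  apply: eq_integral => w _; rewrite /extend /extend0 funeposE.
  by case: (X t w) => [y|]; rewrite ?funeposE//= maxxx.
rewrite -[RHS]/(kint (k t) (fun x => ((EFin \o f) ^\- x)%E) x) kint_transition// pt.
apply: eq_integral => w _; rewrite /extend /extend0 funenegE.
by case: (X t w) => [y|]; rewrite ?funenegE//= oppr0 maxxx.
Qed.

End HuntKernel.

(** * The jumping kernel off the diagonal *)

Section KernelOnRectangles.
Context {d : measure_display} {T : measurableType d} {R : realType}.
Variable K : R.-ker T ~> T.
Variables b1 b2 : nat -> set T.
Hypotheses (mb1 : forall q, measurable (b1 q)) (mb2 : forall q, measurable (b2 q)).
Local Open Scope ereal_scope.

Definition cell q : set (T * T) := seqDU (fun q => b1 q `*` b2 q) q.

Lemma measurable_cell q : measurable (cell q).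
Proof.
apply: measurableD; first exact: measurableX.
by apply: bigsetU_measurable => i _; exact: measurableX.
Qed.

Lemma cell_sub q : cell q `<=` b1 q `*` b2 q.
Proof. by move=> z []. Qed.

(* The rectangles [b1 q * b2 q] are made disjoint and then cut according to the
   size of [K x (b2 q)], which makes each piece of [K] uniformly bounded. *)
Definition level q n (x : T) : bool :=
  (x \in b1 q) && (n%:R%:E <= K x (b2 q) < n.+1%:R%:E).

Lemma measurable_level q n : measurable_fun [set: T] (level q n).
Proof.
apply: measurable_and.
  apply: (@measurable_fun_bool _ _ _ _ true); rewrite setTI.
  rewrite (_ : _ @^-1` _ = b1 q)//.
  by apply/seteqP; split => x /= => [/set_mem|/mem_set].
have mK := measurable_kernel K _ (mb2 q).
apply: measurable_and; first exact: measurable_fun_lee.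
exact: measurable_fun_lte.
Qed.

Definition level_kernel q n (x : T) : {measure set T -> \bar R} :=
  if level q n x then [the {measure set T -> \bar R} of mrestr (K x) (mb2 q)]
  else [the {measure set T -> \bar R} of mzero].

Let level_kernelE q n x B : level_kernel q n x B =
  if level q n x then K x (B `&` b2 q) else 0.
Proof. by rewrite /level_kernel; case: ifP. Qed.

Let measurable_level_kernel q n U : measurable U ->
  measurable_fun [set: T] (level_kernel q n ^~ U).
Proof.
move=> mU; rewrite [X in measurable_fun _ X](_ : _ = (fun x => if level q n x then K x (U `&` b2 q) else 0)).
  apply: measurable_fun_ifT; [exact: measurable_level| |exact: measurable_cst].
  by apply: measurable_kernel; exact: measurableI.
by apply/funext => x; rewrite level_kernelE.
Qed.

HB.instance Definition _ q n := isKernel.Build _ _ _ _ R (level_kernel q n)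
  (@measurable_level_kernel q n).

Let level_kernel_uub q n : measure_fam_uub (level_kernel q n).
Proof.
exists n.+1%:R => x; rewrite level_kernelE setTI.
by case: ifP => [/andP[_ /andP[_]]//|_]; rewrite lte_fin ltr0n.
Qed.

HB.instance Definition _ q n := Kernel_isFinite.Build _ _ _ _ R (level_kernel q n)
  (level_kernel_uub q n).

Definition cell_kernel q n (x : T) : {measure set T -> \bar R} :=
  mrestr (level_kernel q n x) (measurable_xsection x (measurable_cell q)).

Let measurable_cell_kernel q n U : measurable U ->
  measurable_fun [set: T] (cell_kernel q n ^~ U).
Proof.
move=> mU.
have mA : ([set: T] `*` U) `&` cell q \in measurable.
  by rewrite inE; apply: measurableI; [exact: measurableX|exact: measurable_cell].
rewrite [X in measurable_fun _ X](_ : _ = (fun x => level_kernel q n x (xsection (([set: T] `*` U) `&` cell q) x))).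
  exact: measurable_fun_xsection_finite_kernel.
apply/funext => x; rewrite xsectionI.
by rewrite /cell_kernel /mrestr/= in_xsectionX// in_setT.
Qed.

HB.instance Definition _ q n := isKernel.Build _ _ _ _ R (cell_kernel q n)
  (@measurable_cell_kernel q n).

Let cell_kernel_uub q n : measure_fam_uub (cell_kernel q n).
Proof.
have [r hr] := measure_uub (level_kernel q n); exists r => x.
rewrite /cell_kernel/= /mrestr; apply: le_lt_trans (hr x).
apply: le_measure; rewrite ?inE//; rewrite setTI.
exact: (measurable_xsection x (measurable_cell q)).
Qed.

HB.instance Definition _ q n := Kernel_isFinite.Build _ _ _ _ R (cell_kernel q n)
  (cell_kernel_uub q n).

Definition rect_kernel : R.-sfker T ~> T :=
  kseries (fun q => kseries (cell_kernel q)).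

(** If [K x (b2 q)] is finite, exactly one level contains [x], namely its integer part, and the sum
    over the levels restores [K] on the cell. The cells are disjoint and have the same union as the
    rectangles. *)
Lemma rect_kernelE x B : measurable B ->
  (forall q, b1 q x -> K x (b2 q) < +oo) ->
  rect_kernel x B = K x (B `&` \bigcup_q (xsection (b1 q `*` b2 q) x)).
Proof.
move=> mB Kfin.
have cellE q : kseries (cell_kernel q) x B = K x (B `&` xsection (cell q) x).
  have mS : measurable (B `&` xsection (cell q) x).
    by apply: measurableI => //; apply: measurable_xsection; exact: measurable_cell.
  have Sb : B `&` xsection (cell q) x `&` b2 q = B `&` xsection (cell q) x.
    rewrite setIidl// => y [_]; rewrite /xsection/= inE => /cell_sub[_] //.
  have cE n : cell_kernel q n x B = if level q n x then K x (B `&` xsection (cell q) x) else 0.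
    by rewrite /cell_kernel/= /mrestr level_kernelE Sb.
  rewrite /kseries/= /mseries; under eq_eseriesr do rewrite cE.
  have [bx|nbx] := pselect (b1 q x); last first.
    rewrite (_ : _ `&` _ = set0) ?measure0; last first.
      by apply/seteqP; split => // y [_]; rewrite /xsection/= inE => /cell_sub[] /nbx.
    rewrite eseries0// => n _ _; rewrite /level memNset//.
  have v0 := measure_ge0 (K x) (b2 q).
  have vfin : K x (b2 q) \is a fin_num by rewrite ge0_fin_numE// Kfin.
  have f0 : (0 <= fine (K x (b2 q)))%R by exact: fine_ge0.
  have lvl n : level q n x = (n == Num.truncn (fine (K x (b2 q)))).
    rewrite /level mem_set//= eq_sym truncn_eq//.
    by rewrite -[in LHS](fineK vfin) lee_fin lte_fin.
  rewrite (@nneseriesD1 _ _ (Num.truncn (fine (K x (b2 q)))))//; last first.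
    by move=> n _; case: ifP.
  rewrite lvl eqxx eseries0 ?adde0// => n _ /= /negbTE nn.
  by rewrite lvl nn.
rewrite /rect_kernel/= -[LHS]/(\sum_(0 <= q <oo) kseries (cell_kernel q) x B).
under eq_eseriesr do rewrite cellE.
rewrite -xsection_bigcup (seqDU_bigcup_eq (fun q => b1 q `*` b2 q)) xsection_bigcup setI_bigcupr.
rewrite measure_bigcup.
- by apply/esym/eq_eseriesl => i; rewrite in_setT.
- move=> i _; apply: measurableI => //; apply: measurable_xsection.
  exact: measurable_cell.
apply/trivIsetP => i j _ _ ij; apply/seteqP; split => // y [[_ yi] [_ yj]].
have := trivIset_seqDU (fun q => b1 q `*` b2 q).
move/trivIsetP => /(_ i j I I ij) /seteqP[+ _] => /(_ (x, y)); apply.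
by move: yi yj; rewrite /xsection/= !inE.
Qed.

End KernelOnRectangles.

(** * A countable base and rectangles covering the complement of the diagonal *)

Section CountableBase.
Context {R : realType} {E : pmetricType R}.
Hypothesis sepE : separable E.
Hypothesis lcE : locally_compact [set: E].

Lemma dense_sequence : exists s : nat -> E,
  forall U : set E, open U -> U !=set0 -> exists n, U (s n).
Proof.
have [S /countable_injP[f finj] dS] := sepE.
exists (fun n => xget point [set x | S x /\ f x = n]) => U oU U0.
have [x [Ux Sx]] := dS U U0 oU; exists (f x).
rewrite (@xget_unique _ _ _ x)// => y [Sy fyx].
by apply: finj; rewrite ?inE.
Qed.

Lemma metric_ball_open (x : E) (e : R) : open (ball x e).
Proof.
rewrite openE => y /=; rewrite ballEmdist/= => xy.
have e0 : 0 < e - mdist x y by rewrite subr_gt0.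
apply: filterS (nbhsx_ballx _ _ e0) => z; rewrite !ballEmdist/= => yz.
by apply: le_lt_trans (metric_triangle x y z) _; rewrite -ltrBrDl.
Qed.

(** Numbers that encode no pair are sent to [(0, 0)], which only repeats an index. *)
Definition code_pair (q : nat) : nat * nat := odflt (0%N, 0%N) (unpickle q).

Lemma code_pairK i j : code_pair (pickle (i, j)) = (i, j).
Proof. by rewrite /code_pair pickleK. Qed.

Variable s : nat -> E.
Hypothesis sP : forall U : set E, open U -> U !=set0 -> exists n, U (s n).

Definition base q : set E := ball (s (code_pair q).1) (code_pair q).2.+1%:R^-1.

Lemma base_open q : open (base q). Proof. exact: metric_ball_open. Qed.

Lemma base_nbhs (x : E) (U : set E) : nbhs x U -> exists q, base q x /\ base q `<=` U.
Proof.
move/nbhs_ballP => [e /= e0 eU].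
pose l := Num.truncn (2 / e).
have l0 : 0 < l.+1%:R^-1 :> R by rewrite invr_gt0.
have le : l.+1%:R^-1 + l.+1%:R^-1 <= e.
  have -> : l.+1%:R^-1 + l.+1%:R^-1 = 2 / l.+1%:R :> R by ring.
  rewrite ler_pdivrMr ?ltr0n// mulrC -ler_pdivrMr//; exact/ltW/truncnS_gt.
have [n xn] := sP (metric_ball_open x _) (ex_intro _ x (ballxx x l0)).
exists (pickle (n, l)); rewrite /base code_pairK/=; split; first exact: ball_sym.
move=> z nz; apply: eU; apply: (le_ball le).
exact: ball_triangle xn nz.
Qed.

(** A compact neighbourhood of [x] is intersected with a small closed ball; a base set around [x]
    fits into the result. *)
Lemma compact_base (x : E) (U : set E) : nbhs x U -> exists q (A : set E),
  [/\ base q x, base q `<=` A, compact A & A `<=` U].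
Proof.
move/nbhs_ballP => [e /= e0 eU].
have [V nV [cV _]] := lcE (x := x) I.
have nV' : \forall z \near x, [set: E] z -> V z by [].
have Vx : nbhs x V by apply: filterS nV' => z; exact.
have e20 : 0 < e / 2 by rewrite divr_gt0.
pose A := V `&` [set z | mdist x z <= e / 2].
have cA : compact A.
  apply: compact_closedI => //; rewrite -[X in closed X]setCK; apply: open_closedC.
  rewrite openE => y /= /negP; rewrite -ltNge => xy.
  have d0 : 0 < mdist x y - e / 2 by rewrite subr_gt0.
  apply: filterS (nbhsx_ballx _ _ d0) => z; rewrite ballEmdist/= => yz.
  apply/negP; rewrite -ltNge -(ltrD2r (mdist y z)) addrC -ltrBrDr.
  by apply: lt_le_trans yz _; rewrite lerB// (metric_sym y z) metric_triangle.
have nA : nbhs x A.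
  apply: filterI => //; apply: filterS (nbhsx_ballx _ _ e20) => z.
  by rewrite ballEmdist/= => /ltW.
have [q [qx qA]] := base_nbhs nA; exists q, A; split => // z [_ /= xz].
apply: eU; rewrite ballEmdist/=; apply: le_lt_trans xz _.
by rewrite ltr_pdivrMr// ltr_pMr// ltr1n.
Qed.

(** Sets failing a condition become empty, so that the families remain indexed by all natural
    numbers. *)
Let zero_if (b : Prop) (A : set E) : set E := if `[< b >] then A else set0.

Definition relatively_compact_base q : set (borel E) :=
  zero_if (exists2 A : set E, compact A & base q `<=` A) (base q).

Lemma relatively_compact_base_cover x : exists q, relatively_compact_base q x.
Proof.
have [q [A [qx qA cA _]]] := compact_base (@filterT _ (nbhs x) _).
exists q; rewrite /relatively_compact_base /zero_if; case: asboolP => //.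
by case; exists A.
Qed.

Lemma compact_borel (A : set E) : compact A -> measurable (A : set (borel E)).
Proof.
by move=> cA; apply: borel_closed; exact: (compact_closed (@metric_hausdorff _ E) cA).
Qed.

Lemma relatively_compact_base_fin (m : {measure set (borel E) -> \bar R}) q :
  radon m -> measurable (relatively_compact_base q) /\ (m (relatively_compact_base q) < +oo)%E.
Proof.
move=> [mfin _ _]; rewrite /relatively_compact_base /zero_if.
case: asboolP => [[A cA qA]|_]; last by rewrite measure0 ltry; split.
have mb : measurable (base q : set (borel E)) by apply: borel_open; exact: base_open.
split=> //; apply: le_lt_trans (mfin A cA).
by apply: le_measure => //; rewrite inE//; exact: compact_borel.
Qed.

Lemma radon_sigma_finite (m : {measure set (borel E) -> \bar R}) :
  radon m -> sigma_finite [set: borel E] m.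
Proof.
move=> rm; exists relatively_compact_base.
  apply/seteqP; split => // x _.
  by have [q qx] := relatively_compact_base_cover x; exists q.
by move=> q; exact: relatively_compact_base_fin.
Qed.

(** The product of two disjoint compact sets is a compact set off the diagonal, where [J] is
    finite. *)
Let separated (q : nat) : Prop := exists A B : set E,
  [/\ compact A, compact B, base (code_pair q).1 `<=` A, base (code_pair q).2 `<=` B &
      A `&` B = set0].

Definition rect_left q : set (borel E) := zero_if (separated q) (base (code_pair q).1).
Definition rect_right q : set (borel E) := zero_if (separated q) (base (code_pair q).2).

Lemma measurable_rect_left q : measurable (rect_left q).
Proof.
rewrite /rect_left /zero_if; case: asboolP => _ //.
by apply: borel_open; exact: base_open.
Qed.

Lemma measurable_rect_right q : measurable (rect_right q).
Proof.
rewrite /rect_right /zero_if; case: asboolP => _ //.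
by apply: borel_open; exact: base_open.
Qed.

Lemma rect_cover : \bigcup_q (rect_left q `*` rect_right q) = ~` [set z | z.1 = z.2].
Proof.
apply/seteqP; split => [[x y] [q _ []]|[x y] /= xy].
  rewrite /rect_left /rect_right /zero_if/=; case: asboolP => // -[A [B [_ _ qA qB AB]]].
  move=> /qA Ax /qB By /= xy; have : (A `&` B) y by split => //; rewrite -xy.
  by rewrite AB.
have e0 : 0 < mdist x y / 2 by rewrite divr_gt0// mdist_gt0; apply/eqP.
have [i [A [ix iA cA AU]]] := compact_base (nbhsx_ballx x _ e0).
have [j [B [jy jB cB BU]]] := compact_base (nbhsx_ballx y _ e0).
have sep : separated (pickle (i, j)).
  exists A, B; rewrite code_pairK/=; split => //; apply/seteqP; split => // z [/AU Az /BU Bz].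
  have := ball_triangle Az (ball_sym Bz).
  by rewrite -splitr ballEmdist/= ltxx.
exists (pickle (i, j)) => //; rewrite /rect_left /rect_right /zero_if.
by case: asboolP => //= _; rewrite code_pairK.
Qed.

Lemma measurable_diagE : measurable (@diagE R E).
Proof.
rewrite /diagE -[X in measurable X]setCK -rect_cover; apply: measurableC.
apply: bigcupT_measurable => q.
exact: (measurableX (measurable_rect_left q) (measurable_rect_right q)).
Qed.

Lemma jump_rect_fin (J : {measure set (borel E * borel E) -> \bar R}) q :
  jumping_measure J -> (J (rect_left q `*` rect_right q) < +oo)%E.
Proof.
move=> [_ Jfin]; rewrite /rect_left /rect_right /zero_if.
case: asboolP => [[A [B [cA cB qA qB AB]]]|_]; last by rewrite set0X measure0 ltry.
have mb i : measurable (base i : set (borel E)) by apply: borel_open; exact: base_open.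
apply: le_lt_trans (Jfin _ (compact_setX cA cB) _); last first.
  move=> [x y] [/= Ax By]; rewrite /diagE/= => xy.
  have : (A `&` B) y by split => //; rewrite -xy.
  by rewrite AB.
apply: le_measure.
- by rewrite inE; exact: measurableX.
- by rewrite inE; exact: (measurableX (compact_borel cA) (compact_borel cB)).
- by move=> z [/qA ? /qB].
Qed.

End CountableBase.

(** * Integral comparison without measurability of the majorant *)

Section LowerIntegralGe.
Context {d : measure_display} {T : measurableType d} {R : realType}.
Variable m : {measure set T -> \bar R}.
Local Open Scope ereal_scope.

Lemma le_integral_pointwise (D : set T) (f g : T -> \bar R) : measurable D ->
  (forall x, 0 <= f x) -> (forall x, f x <= g x) ->
  \int[m]_(x in D) f x <= \int[m]_(x in D) g x.
Proof.
move=> mD f0 fg; rewrite integral_mkcond [leRHS]integral_mkcond.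
have f0' x : 0 <= (f \_ D) x by rewrite /patch; case: ifP.
have fg' x : (f \_ D) x <= (g \_ D) x by rewrite /patch; case: ifP.
rewrite !ge0_integralTE//; last by move=> x; exact: le_trans (fg' x).
apply: le_ereal_sup => _ [h hf <-]; exists h => // x.
exact: le_trans (hf x) (fg' x).
Qed.

(** The measurable function is set to 0 on the exceptional null set, which makes the comparison
    pointwise. It serves for [g x = K x (xsection C x)], with [K] a general kernel for which
    measurability of this function is not established. *)
Lemma nnm_le_integral_ae (f g : T -> \bar R) : nnm f -> (forall x, 0 <= g x) ->
  {ae m, forall x, f x <= g x} -> \int[m]_x f x <= \int[m]_x g x.
Proof.
move=> f0 g0 [Z [mZ Z0 Zsub]].
pose f' x := (\1_(~` Z) x)%:E * f x.
have nf' : nnm f' by apply: nnmM f0; apply: nnm_indic; exact: measurableC.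
have -> : \int[m]_x f x = \int[m]_x f' x.
  apply: ae_eq_integral => //; [exact: f0.1|exact: nf'.1|].
  exists Z; split => // x; apply: contra_notP => /= nZx _.
  by rewrite /f' indicE mem_set ?mul1e.
apply: le_integral_pointwise => //; first exact: nf'.2.
move=> x; rewrite /f' indicE; have [xZ|xZ] := boolP (x \in ~` Z).
  rewrite mul1e; move: xZ; rewrite inE /= => nZ.
  by apply: contrapT => h; apply: nZ; exact: Zsub.
by rewrite mul0e.
Qed.

Lemma nnm_integral_restr (nu : {measure set T -> \bar R}) (D : set T) :
  measurable D -> (forall B, measurable B -> nu B = m (B `&` D)) ->
  forall g, nnm g -> \int[nu]_x g x = \int[m]_(x in D) g x.
Proof.
move=> mD nuE.
apply: (@nnm_ind _ _ _ (fun g => \int[nu]_y g y = \int[m]_(y in D) g y)) =>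
    [U mU|c f h c0 f0 h0 If Ih|F f F0 Fnd Ff IF].
- by rewrite !integral_indic// setIT nuE.
- have nc := nnm_cst (c0 : 0 <= c%:E).
  rewrite (nnm_integralD _ (nnmM (nc _ _) f0) h0) nnm_integralZl// If Ih.
  rewrite [RHS]ge0_integralD//.
  + rewrite [in RHS]ge0_integralZl_EFin//.
    * by move=> y _; exact: f0.2.
    * exact: measurable_funTS f0.1.
  + by move=> y _; exact: (nnmM (nc _ _) f0).2.
  + exact: measurable_funTS (nnmM (nc _ _) f0).1.
  + by move=> y _; exact: h0.2.
  + exact: measurable_funTS h0.1.
- have L := nnm_cvg_integral (mu := nu) F0 Fnd Ff.
  have E1 : (fun n => \int[nu]_y F n y) = (fun n => \int[m]_(y in D) F n y).
    by apply/funext => n; rewrite IF.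
  rewrite E1 in L; apply: (cvg_unique (@ereal_hausdorff R) L).
  have -> : f = (fun x => limn (F ^~ x)) by apply/funext => y; exact/esym/cvg_lim.
  apply: cvg_monotone_convergence => //.
  + by move=> n; exact: measurable_funTS (F0 n).1.
  + by move=> n y _; exact: (F0 n).2.
  + by move=> y _ i j; exact: Fnd.
Qed.

End LowerIntegralGe.

(** * The jumping kernel as an s-finite kernel *)

Section JumpKernel.
Context {R : realType} {E : pmetricType R}.
Hypothesis sepE : separable E.
Hypothesis lcE : locally_compact [set: E].
Variables (m : {measure set (borel E) -> \bar R})
  (J : {measure set (borel E * borel E) -> \bar R})
  (K : R.-ker (borel E) ~> (borel E)).
Hypotheses (jm : jumping_measure J) (hk : has_kernel m J K).
Local Notation T := (borel E).

Definition off_diagonal_kernel (N : T -> {measure set T -> \bar R}) : Prop :=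
  {ae m, forall x, forall B, measurable B -> N x B = K x (B `&` ~` [set x])}.

(** On each rectangle, [J (b1 * b2)] is the integral of [K x (b2)] over [b1] and is finite; so
    [K x (b2)] is finite for almost every [x] in [b1], for all the countably many rectangles at
    once. *)
Lemma off_diagonal_kernel_ex : exists N : R.-sfker T ~> T, off_diagonal_kernel N.
Proof.
have [s sP] := dense_sequence sepE.
pose b1 := rect_left s; pose b2 := rect_right s.
have mb1 q : measurable (b1 q) by exact: measurable_rect_left.
have mb2 q : measurable (b2 q) by exact: measurable_rect_right.
exists (rect_kernel K mb1 mb2).
have cover : \bigcup_q (b1 q `*` b2 q) = ~` [set z | z.1 = z.2] := rect_cover lcE sP.
have fin q : {ae m, forall x, b1 q x -> (K x (b2 q) < +oo)%E}.
  have sub : b1 q `*` b2 q `<=` ~` diagE.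
    by rewrite -[~` diagE]cover => z zq; exists q.
  have JE := hk (measurableX (mb1 q) (mb2 q)) sub.
  pose h x := ((\1_(b1 q) x)%:E * K x (b2 q))%E.
  have nh : nnm h.
    apply: nnmM; first exact: nnm_indic.
    by split; [exact: measurable_kernel|].
  have hE : (\int[m]_x K x (xsection (b1 q `*` b2 q) x) = \int[m]_x h x)%E.
    apply: eq_integral => x _; rewrite /h indicE.
    have [xb|xb] := boolP (x \in b1 q); first by rewrite mul1e in_xsectionX.
    by rewrite mul0e notin_xsectionX// measure0.
  have ih : m.-integrable [set: T] h.
    apply/integrableP; split; first exact: nh.1.
    under eq_integral do rewrite gee0_abs ?nh.2//.
    by rewrite -hE -JE; exact: jump_rect_fin.
  have := integrable_ae measurableT ih; apply: filterS => x /(_ I) hfin bx.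
  by move: hfin; rewrite /h indicE mem_set// mul1e ge0_fin_numE.
have := ae_foralln fin; apply: filterS => x Kfin B mB.
rewrite rect_kernelE// -xsection_bigcup cover; congr (K x (_ `&` _)).
by apply/seteqP; split => y; rewrite /xsection/= inE/= => xy yx; apply: xy.
Qed.

Variable N : R.-sfker T ~> T.
Hypothesis NK : off_diagonal_kernel N.

Lemma off_diagonal_integral : {ae m, forall x, forall g : T -> \bar R, nnm g ->
  (\int[N x]_y g y = \int[K x]_(y in ~` [set x]) g y)%E}.
Proof.
apply: filterS NK => x NxE.
have mx : measurable (~` [set x] : set T).
  apply: measurableC; apply: borel_closed.
  exact/accessible_closed_set1/hausdorff_accessible/metric_hausdorff.
by apply: nnm_integral_restr => // B mB; exact: NxE.
Qed.

Lemma nnm_sfker_section (C : set (T * T)) : measurable C ->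
  nnm (fun x => N x (xsection C x)).
Proof.
move=> mC; split => //.
rewrite (_ : (fun _ => _) = (fun x => \int[N x]_y (\1_C (x, y))%:E)%E).
  apply: (measurable_fun_integral_sfinite_kernel (fun z => (\1_C z)%:E) N) => //.
  by apply/measurable_EFinP; exact: measurable_indic.
apply/funext => x; rewrite -[in LHS](setIT (xsection C x)) -integral_indic//; last first.
  exact: measurable_xsection.
by apply: eq_integral => y _; rewrite !indicE mem_xsection.
Qed.

Let mdiag : measurable (@diagE R E).
Proof. by have [s sP] := dense_sequence sepE; exact: (measurable_diagE lcE sP). Qed.

Lemma sfker_section_le (C : set (T * T)) : measurable C -> C `<=` ~` diagE ->
  (\int[m]_x N x (xsection C x) <= J C)%E.
Proof.
move=> mC Cd; rewrite (hk mC Cd); apply: nnm_le_integral_ae => //.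
  exact: nnm_sfker_section.
apply: filterS NK => x NxE; rewrite NxE; last exact: measurable_xsection.
rewrite setIidl// => y; rewrite /xsection/= inE => Cxy yx.
by apply: (Cd _ Cxy); rewrite /diagE/= yx.
Qed.

Lemma sfker_integral_le (F : T * T -> \bar R) : nnm F ->
  (\int[m]_x \int[N x]_y F (x, y) <= \int[J]_(z in ~` diagE) F z)%E.
Proof.
have mnd : measurable (~` @diagE R E) by exact: measurableC.
have sec (G : T * T -> \bar R) : nnm G -> nnm (fun x => \int[N x]_y G (x, y))%E.
  move=> [mG G0]; split; last by move=> x; apply: integral_ge0.
  exact: (measurable_fun_integral_sfinite_kernel G N).
have row (G : T * T -> \bar R) x : nnm G -> nnm (fun y => G (x, y)).
  move=> [mG G0]; split; last by move=> y.
  exact: (measurableT_comp mG (measurable_pair1 x)).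
apply: (@nnm_ind _ _ _ (fun F => (\int[m]_x \int[N x]_y F (x, y) <=
    \int[J]_(z in ~` diagE) F z)%E)) =>
    [C mC|c f h c0 f0 h0 If Ih|G f G0 Gnd Gf IG].
- rewrite integral_indic//.
  have mCd : measurable (C `&` ~` @diagE R E) by exact: measurableI.
  apply: le_trans (sfker_section_le mCd (@subIsetr _ _ _)).
  rewrite le_eqVlt; apply/orP; left; apply/eqP; apply: ae_eq_integral => //.
  + exact: (sec _ (nnm_indic mC)).1.
  + exact: (nnm_sfker_section mCd).1.
  apply: filterS NK => x NxE _.
  rewrite (_ : \int[N x]_y _ = N x (xsection C x))%E; last first.
    rewrite -[in RHS](setIT (xsection C x)) -integral_indic//; last exact: measurable_xsection.
    by apply: eq_integral => y _; rewrite !indicE mem_xsection.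
  rewrite !NxE; [|exact: measurable_xsection..]; congr (K x _).
  rewrite xsectionI -setIA; congr (_ `&` _); apply/seteqP; split => y //=.
    by move=> yx; split => //; rewrite /xsection/= inE/diagE/= => xy; apply: yx.
  by case.
- have nc d' (X : measurableType d') : nnm (fun _ : X => c%:E) by exact: nnm_cst.
  have cf0 := nnmM (nc _ _) f0.
  rewrite (_ : (\int[m]_x _) = (\int[m]_x (c%:E * \int[N x]_y f (x, y) +
      \int[N x]_y h (x, y))))%E; last first.
    apply: eq_integral => x _.
    rewrite (nnm_integralD _ (row _ x cf0) (row _ x h0)).
    by rewrite (nnm_integralZl _ (row _ x f0)).
  rewrite (nnm_integralD _ (nnmM (nc _ _) (sec _ f0)) (sec _ h0)).
  rewrite (nnm_integralZl _ (sec _ f0))//.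
  have -> : (\int[J]_(z in ~` diagE) (c%:E * f z + h z) =
      c%:E * \int[J]_(z in ~` diagE) f z + \int[J]_(z in ~` diagE) h z)%E.
    rewrite ge0_integralD//.
    + rewrite ge0_integralZl_EFin//; first by move=> y _; exact: f0.2.
      exact: measurable_funTS f0.1.
    + by move=> y _; exact: cf0.2.
    + exact: measurable_funTS cf0.1.
    + by move=> y _; exact: h0.2.
    + exact: measurable_funTS h0.1.
  by apply: leeD => //; apply: lee_wpmul2l.
- have L : (\int[m]_x \int[N x]_y G n (x, y) @[n --> \oo] -->
      \int[m]_x \int[N x]_y f (x, y))%E.
    apply: nnm_cvg_integral; first by move=> n; exact: sec.
      move=> x i j ij; apply: nnm_le_integral; [exact: row|exact: row|].
      by move=> y; exact: Gnd.
    move=> x; apply: nnm_cvg_integral; first by move=> n; exact: row.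
      by move=> y i j ij; exact: Gnd.
    by move=> y; exact: Gf.
  rewrite -(cvg_lim (@ereal_hausdorff R) L); apply: lime_le; first by apply/cvg_ex; eexists; exact: L.
  apply: nearW => n; apply: le_trans (IG n) _; apply: le_integral_pointwise => //.
    exact: (G0 n).2.
  move=> z; rewrite -(cvg_lim (@ereal_hausdorff R) (Gf z)); apply: lime_ge.
    by apply/cvg_ex; exists (f z).
  by exists n => // i /= ni; exact: Gnd.
Qed.

(** For a null first coordinate this is the disintegration by [K]; the symmetry of [J] exchanges the
    coordinates. *)
Lemma jump_null B : measurable B -> m B = 0%E ->
  J (([set: T] `*` B) `&` ~` diagE) = 0%E /\ J ((B `*` [set: T]) `&` ~` diagE) = 0%E.
Proof.
move=> mB B0; pose C : set (T * T) := ([set: T] `*` B) `&` ~` diagE.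
have mC : measurable C by apply: measurableI; [exact: measurableX|exact: measurableC].
pose C' : set (T * T) := (B `*` [set: T]) `&` ~` diagE.
have mC' : measurable C' by apply: measurableI; [exact: measurableX|exact: measurableC].
have JC' : J C' = 0%E.
  rewrite (hk mC' (@subIsetr _ _ _)); apply/eqP; rewrite eq_le integral_ge0// andbT.
  apply: le_trans (_ : (\int[m]_x (0 : \bar R) <= _)%E); last by rewrite integral0.
  apply: integral_le_nnm => //.
  exists B; split => // x /=; apply: contra_notP => nBx.
  rewrite (_ : xsection C' x = set0) ?measure0//.
  by apply/seteqP; split => // y; rewrite /xsection/= inE => -[[/nBx]].
split => //; rewrite -(jm.1 C mC (@subIsetr _ _ _)).
rewrite (_ : [set z | C (z.2, z.1)] = C')//.
apply/seteqP; split => -[x y] [[/= h1 h2] xy].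
  by split; [split|move=> /= e; apply: xy; rewrite /diagE/=].
by split; [split|move=> /= e; apply: xy; rewrite /diagE/=].
Qed.

(** The integral of [N x B] over [x] is at most the [J]-measure of the pairs off the diagonal whose
    second point lies in [B]. *)
Lemma sfker_null_respecting B : measurable B -> m B = 0%E ->
  {ae m, forall x, N x B = 0%E}.
Proof.
move=> mB B0; pose C : set (T * T) := ([set: T] `*` B) `&` ~` diagE.
have mC : measurable C by apply: measurableI; [exact: measurableX|exact: measurableC].
have [JC _] := jump_null mB B0.
have I0 : (\int[m]_x `|N x (xsection C x)| = 0)%E.
  apply/eqP; rewrite eq_le integral_ge0// andbT -JC.
  under eq_integral do rewrite gee0_abs//.
  exact: sfker_section_le mC (@subIsetr _ _ _).
have := (ae_eq_integral_abs m measurableT (nnm_sfker_section mC).1).1 I0.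
apply: filterS2 NK => x NxE /(_ I) /= <-.
rewrite !NxE//; last exact: measurable_xsection.
congr (K x _); apply/seteqP; split => y [/= By yx]; split => //.
  rewrite /xsection/= inE; split; first by split.
  by rewrite /diagE/= => xy; apply: yx.
by move: By; rewrite /xsection/= inE => -[[]].
Qed.

End JumpKernel.

(** * The form on bounded integrable functions *)

Section WeightedSquares.
Context {R : realType}.

Lemma weighted_expansion_le (d X Y Z : R) : 0 < d ->
  0 <= d ^+ 2 * X - 2 * d * Y + Z ->
  X + 2 * Y + Z <= (1 + d) * X + (1 + d^-1) * Z.
Proof.
move=> d0 h; have dn : d != 0 by rewrite gt_eqF.
rewrite -subr_ge0 (_ : _ - _ = (d ^+ 2 * X - 2 * d * Y + Z) / d); last by field.
by rewrite divr_ge0// ltW.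
Qed.

Lemma weighted_square_le (d p q : R) : 0 < d ->
  (p + q) ^+ 2 <= (1 + d) * p ^+ 2 + (1 + d^-1) * q ^+ 2.
Proof.
move=> d0; have := @weighted_expansion_le d (p ^+ 2) (p * q) (q ^+ 2) d0.
have -> : d ^+ 2 * p ^+ 2 - 2 * d * (p * q) + q ^+ 2 = (d * p - q) ^+ 2 by ring.
have -> : p ^+ 2 + 2 * (p * q) + q ^+ 2 = (p + q) ^+ 2 by ring.
by apply; exact: sqr_ge0.
Qed.

Lemma le_of_dyadic (a b c : R) : (forall n, a <= b + (2 ^+ n)^-1 * c) -> a <= b.
Proof.
move=> h; apply/ler_addgt0Pl => e e0.
pose n := Num.truncn (`|c| / e).
apply: le_trans (h n) _; rewrite addrC lerD2r.
have p0 : 0 < 2 ^+ n :> R by rewrite exprn_gt0.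
rewrite ler_pdivrMl// mulrC.
apply: le_trans (ler_norm c) _; rewrite -ler_pdivrMl// mulrC.
apply: le_trans (ltW (truncnS_gt _)) _.
by rewrite -natrX ler_nat ltn_expl.
Qed.

(** Here [d = 2 ^ (- n)], [I] is the jump integral of [w], [E] is twice its energy, and [e] is their
    common value for the [n]-th approximation. The errors are of order [d ^ 2 = 4 ^ (- n)], so that
    the large weight [1 + 1 / d] leaves a remainder of order [d]. *)
Lemma dyadic_chain (d I e E : R) : 0 < d -> d <= 1 -> 0 <= I -> 0 <= E ->
  I <= (1 + d) * e + (1 + d^-1) * (8 * d ^+ 2) ->
  e <= (1 + d) * I + (1 + d^-1) * (8 * d ^+ 2) ->
  e <= (1 + d) * E + (1 + d^-1) * (2 * d ^+ 2) ->
  E <= (1 + d) * e + (1 + d^-1) * (2 * d ^+ 2) ->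
  I <= E + d * (3 * E + 24) /\ E <= I + d * (3 * I + 36).
Proof.
move=> d0 d1 I0 E0.
have dn : d != 0 by rewrite gt_eqF.
have -> : (1 + d^-1) * (8 * d ^+ 2) = 8 * (d ^+ 2 + d) by field.
have -> : (1 + d^-1) * (2 * d ^+ 2) = 2 * (d ^+ 2 + d) by field.
by move=> h1 h2 h3 h4; split; nra.
Qed.

Lemma cvg_sqB (a_ b_ : nat -> R) (a b : R) : a_ n @[n --> \oo] --> a ->
  b_ n @[n --> \oo] --> b -> (a_ n - b_ n) ^+ 2 @[n --> \oo] --> (a - b) ^+ 2.
Proof.
move=> ac bc; rewrite expr2; under eq_fun do rewrite expr2.
by apply: cvgM; exact: cvgB.
Qed.

End WeightedSquares.

Section CompactSupport.
Context {R : realType} {E : pmetricType R}.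
Variable m : {measure set (borel E) -> \bar R}.

Lemma Cc_bint (u : E -> R) : radon m -> Cc u -> bint m (u : borel E -> R).
Proof.
move=> [mfin _ _] [cu cpt]; set A := closure _ in cpt.
have mu : measurable_fun [set: borel E] (u : borel E -> R) by exact: continuous_borel.
have mA : measurable (A : set (borel E)) by apply: borel_closed; exact: closed_closure.
have uA x : ~ A x -> u x = 0.
  by apply: contra_notP => /eqP ux; apply: subset_closure.
have [M [_ hM]] : bounded_set (u @` A).
  by apply: compact_bounded; apply: continuous_compact => //; exact: continuous_subspaceT.
have M0 : 0 <= `|M| + 1 by rewrite addr_ge0.
have uM x : `|u x| <= `|M| + 1.
  have [Ax|/uA ->] := pselect (A x); last by rewrite normr0.
  by apply: (hM (`|M| + 1)); [rewrite ltr_pwDr// ler_norm|exists x].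
split=> //; first by exists (`|M| + 1).
apply: (@le_integrable _ _ _ _ _ measurableT _
  (fun x => (`|M| + 1)%:E * (\1_(A : set (borel E)) x)%:E)%E).
- exact/measurable_EFinP.
- move=> x _; rewrite -EFinM !abse_EFin lee_fin [leRHS]ger0_norm ?mulr_ge0//.
  have [Ax|nAx] := pselect (A x); first by rewrite indicE mem_set// mulr1.
  by rewrite uA// normr0 mulr_ge0.
- apply: integrableZl => //; apply/integrableP; split.
    by apply/measurable_EFinP; exact: measurable_indic.
  rewrite (eq_integral (fun x => (\1_(A : set (borel E)) x)%:E)); last first.
    by move=> x _; rewrite gee0_abs// lee_fin.
  by rewrite integral_indic// setIT; exact: mfin.
Qed.

End CompactSupport.

(** * The jump formula for the energy *)

Section EnergyIdentity.
Context {R : realType} {E : pmetricType R}.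
Local Notation T := (borel E).
Variables (m : {measure set T -> \bar R}) (J J0 : {measure set (T * T) -> \bar R}).
Hypothesis J0E : forall F : T * T -> \bar R, nnm F ->
  (\int[J0]_z F z = \int[J]_(z in ~` diagE) F z)%E.
Hypothesis J0null : forall B : set T, measurable B -> m B = 0%E ->
  J0 ([set: T] `*` B) = 0%E /\ J0 (B `*` [set: T]) = 0%E.
Variables (D : set (T -> R)) (Ef : (T -> R) -> (T -> R) -> R).
Hypotheses (rm : radon m) (df : dirichlet_form m D Ef) (rf : regular_form m D Ef)
  (pj : pure_jump m D Ef J).
Implicit Types u v w : T -> R.

Lemma form_quad (a : R) u v : D u -> D v ->
  Ef (fun x => a * u x + v x) (fun x => a * u x + v x) =
  a ^+ 2 * Ef u u + 2 * a * Ef u v + Ef v v.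
Proof.
move=> Du Dv; have Dl := form_Dlin df a Du Dv.
rewrite (form_lin df a Du Dv Dl) (form_sym df Du Dl) (form_sym df Dv Dl).
by rewrite !(form_lin df a Du Dv)// (form_sym df Dv Du); ring.
Qed.

Lemma form_Dsub u v : D u -> D v -> D (fun x => u x - v x).
Proof.
move=> Du Dv; have := form_Dlin df (-1) Dv Du.
by congr D; apply/funext => x; rewrite mulN1r addrC.
Qed.

Lemma form_Dadd u v : D u -> D v -> D (fun x => u x + v x).
Proof.
move=> Du Dv; have := form_Dlin df 1 Du Dv.
by congr D; apply/funext => x; rewrite mul1r.
Qed.

Lemma form_sub u v : D u -> D v ->
  Ef (fun x => u x - v x) (fun x => u x - v x) = Ef u u - 2 * Ef u v + Ef v v.
Proof.
move=> Du Dv; have -> : (fun x => u x - v x) = (fun x => (-1) * v x + u x).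
  by apply/funext => x; rewrite mulN1r addrC.
by rewrite form_quad// (form_sym df Dv Du); ring.
Qed.

Lemma form_add u v : D u -> D v ->
  Ef (fun x => u x + v x) (fun x => u x + v x) = Ef u u + 2 * Ef u v + Ef v v.
Proof.
move=> Du Dv; have -> : (fun x => u x + v x) = (fun x => 1 * u x + v x).
  by apply/funext => x; rewrite mul1r.
by rewrite form_quad//; ring.
Qed.

Lemma form_weighted_le (d : R) u v : 0 < d -> D u -> D v ->
  Ef u u <= (1 + d) * Ef v v +
    (1 + d^-1) * Ef (fun x => u x - v x) (fun x => u x - v x).
Proof.
move=> d0 Du Dv; set h := fun x => u x - v x.
have Dh : D h by exact: form_Dsub.
have -> : u = (fun x => v x + h x) by apply/funext => x; rewrite addrC subrK.
rewrite form_add//; apply: weighted_expansion_le => //.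
have := form_ge0 df (form_Dlin df (- d) Dv Dh).
by rewrite form_quad// sqrrN mulrN mulNr.
Qed.

Lemma form_add_le u v : D u -> D v ->
  Ef (fun x => u x - v x) (fun x => u x - v x) <= 2 * (Ef u u + Ef v v).
Proof.
move=> Du Dv; have := form_ge0 df (form_Dadd Du Dv).
by rewrite form_add// form_sub//; lra.
Qed.

Lemma form00 : Ef (fun=> 0) (fun=> 0) = 0.
Proof.
have D0 := form_D0 df; have := form_lin df 1 D0 D0 D0.
have -> : (fun x : T => 1 * 0 + 0) = (fun=> 0 : R) by apply/funext => x; rewrite mulr0 addr0.
by move=> h; lra.
Qed.

(** The exceptional set is empty; its capacity is bounded by the energy of the zero function. *)
Lemma continuous_quasi_continuous (u : E -> R) : continuous u -> quasi_continuous m D Ef u.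
Proof.
move=> cu e e0; exists set0; split; first exact: open0.
  apply: le_lt_trans (_ : 0 < e%:E)%E; last by rewrite lte_fin.
  apply: ereal_inf_lbound; exists (fun=> 0).
    by split; [exact: form_D0 df|exact: aeW].
  rewrite /E1 form00 /l2dot add0r; congr (_%:E).
  by under eq_Rintegral do rewrite mulr0; rewrite Rintegral_cst// mul0r.
exact: continuous_subspaceT.
Qed.

Definition sqdiff w (z : T * T) : \bar R := ((w z.2 - w z.1) ^+ 2)%:E.

Lemma nnm_sqdiff w : measurable_fun [set: T] w -> nnm (sqdiff w).
Proof.
move=> mw; split; last by move=> z; rewrite lee_fin sqr_ge0.
apply/measurable_EFinP; apply: measurable_funX; apply: measurable_funB.
  exact: measurableT_comp mw measurable_snd.
exact: measurableT_comp mw measurable_fst.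
Qed.

Lemma jump_form_continuous w : D w -> continuous (w : E -> R) ->
  (\int[J0]_z sqdiff w z = (2 * Ef w w)%:E)%E.
Proof.
move=> Dw cw; have qw := continuous_quasi_continuous cw.
have mw : measurable_fun [set: T] w by exact: continuous_borel.
rewrite EFinM (pj Dw Dw qw qw) muleA -EFinM divff// mul1e.
by rewrite J0E//; exact: nnm_sqdiff.
Qed.

Lemma ae_jump (Q : T -> Prop) : {ae m, forall x, Q x} ->
  {ae J0, forall z, Q z.1 /\ Q z.2}.
Proof.
move=> [B [mB B0 QB]]; have [J1 J2] := J0null mB B0.
have h1 : {ae J0, forall z, ~ B z.1}.
  exists (B `*` [set: T]); split => //; first exact: measurableX.
  by move=> z /= /contrapT.
have h2 : {ae J0, forall z, ~ B z.2}.
  exists ([set: T] `*` B); split => //; first exact: measurableX.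
  by move=> z /= /contrapT.
apply: filterS2 h1 h2 => z n1 n2.
by split; apply: contrapT => h; [apply: n1|apply: n2]; exact: QB.
Qed.

Section Approximation.
Variables (w : T -> R) (w_ : nat -> T -> R).
Hypotheses (Dw : D w) (bw : bint m w).
Hypotheses (Dw_ : forall n, D (w_ n)) (Cw_ : forall n, Cc (w_ n : E -> R)).
Hypothesis w_close : forall n,
  E1 m Ef (fun x => w x - w_ n x) (fun x => w x - w_ n x) < (4 ^+ n)^-1.

Let bw_ n : bint m (w_ n). Proof. exact: Cc_bint. Qed.

Let close n : Ef (fun x => w x - w_ n x) (fun x => w x - w_ n x) <= (4 ^+ n)^-1 /\
  dot m (fun x => w x - w_ n x) (fun x => w x - w_ n x) <= (4 ^+ n)^-1.
Proof.
have := w_close n; rewrite /E1 /l2dot -dotE => h.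
have := form_ge0 df (form_Dsub Dw (Dw_ n)).
have := dot_ge0 m (fun x => w x - w_ n x).
by move: h; move: (Ef _ _) (dot _ _ _) => a b; split; lra.
Qed.

(** Fatou's lemma along [w_(n + l) - w_n], which converges almost everywhere for [m], hence for [J0]
    in both variables. These continuous functions have energy at most [2 (4 ^ (- n) + 4 ^ (- n))],
    and the jump integral doubles this. *)
Lemma jump_form_tail n :
  (\int[J0]_z sqdiff (fun x => w x - w_ n x)%R z <= (8 * (4 ^+ n)^-1)%:E)%E.
Proof.
have mB u v : bint m u -> bint m v -> measurable_fun [set: T] (fun x => u x - v x).
  by move=> bu bv; exact: bint_measurable (bintB bu bv).
apply: (@fatou_cvg_le _ _ _ J0 (fun l => sqdiff (fun x => w_ (n + l)%N x - w_ n x))).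
- by move=> l; apply: nnm_sqdiff; exact: mB.
- by apply: nnm_sqdiff; exact: mB.
- have c : {ae m, forall x, w x - w_ (n + l)%N x @[l --> \oo] --> (0 : R)}.
    apply: ae_cvg0_summable; first by move=> l; exact: bintB.
    move=> l; apply: le_trans (close _).2 _.
    rewrite lef_pV2 ?posrE ?exprn_gt0//.
    apply: le_trans (_ : 4 ^+ l <= _); first by apply: lerXn2r; rewrite ?nnegrE ?ler_nat.
    by apply: ler_weXn2l; [rewrite ler1n|exact: leq_addl].
  have := ae_jump c; apply: filterS => z [c1 c2].
  have toW y : w y - w_ (n + l)%N y @[l --> \oo] --> (0 : R) ->
      w_ (n + l)%N y - w_ n y @[l --> \oo] --> w y - w_ n y.
    move=> cy; have -> : (fun l => w_ (n + l)%N y - w_ n y) =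
        (fun l => w y - w_ n y - (w y - w_ (n + l)%N y)).
      by apply/funext => l; ring.
    by rewrite -[X in _ --> X]subr0; apply: cvgB => //; exact: cvg_cst.
  have hh := cvg_sqB (toW _ c2) (toW _ c1).
  by apply: cvg_EFin => //; exact: nearW.
move=> l; rewrite jump_form_continuous; last first.
- move=> x; apply: cvgB; [exact: (Cw_ (n + l)).1|exact: (Cw_ n).1].
- exact: form_Dsub.
rewrite lee_fin.
have -> : (fun x => w_ (n + l)%N x - w_ n x) =
    (fun x => (w x - w_ n x) - (w x - w_ (n + l)%N x)) by apply/funext => x; ring.
have D1 := form_Dsub Dw (Dw_ n); have D2 := form_Dsub Dw (Dw_ (n + l)).
have h1 := form_add_le D1 D2; have h2 := (close n).1.
have h3 : Ef (fun x => w x - w_ (n + l)%N x) (fun x => w x - w_ (n + l)%N x) <= (4 ^+ n)^-1.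
  apply: le_trans (close _).1 _; rewrite lef_pV2 ?posrE ?exprn_gt0//.
  by apply: ler_weXn2l; [rewrite ler1n|exact: leq_addr].
by move: h1 h2 h3; set a := Ef _ _; set b := Ef _ _; set c := Ef _ _; lra.
Qed.

Lemma sqdiff_integral_le (d c : R) u v : 0 < d -> 0 <= c -> bint m u -> bint m v ->
  (\int[J0]_z sqdiff (fun x => u x - v x)%R z <= c%:E)%E ->
  (\int[J0]_z sqdiff u z <=
   (1 + d)%:E * \int[J0]_z sqdiff v z + ((1 + d^-1) * c)%:E)%E.
Proof.
move=> d0 c0 bu bv hc.
have nu := nnm_sqdiff (bint_measurable bu); have nv := nnm_sqdiff (bint_measurable bv).
have nuv := nnm_sqdiff (bint_measurable (bintB bu bv)).
have d1 : (0 <= (1 + d)%:E :> \bar R)%E by rewrite lee_fin addr_ge0// ltW.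
have d2 : (0 <= (1 + d^-1)%:E :> \bar R)%E by rewrite lee_fin addr_ge0// invr_ge0 ltW.
have n1 : nnm (fun z => (1 + d)%:E * sqdiff v z)%E by apply: nnmM => //; exact: nnm_cst.
have n2 : nnm (fun z => (1 + d^-1)%:E * sqdiff (fun x => u x - v x)%R z)%E.
  by apply: nnmM => //; exact: nnm_cst.
apply: le_trans (_ : \int[J0]_z ((1 + d)%:E * sqdiff v z +
    (1 + d^-1)%:E * sqdiff (fun x => u x - v x)%R z) <= _)%E.
  apply: nnm_le_integral => //; first exact: nnmD.
  move=> z; rewrite /sqdiff -!EFinM -EFinD lee_fin.
  apply: le_trans (weighted_square_le _ _ d0).
  by rewrite [in leRHS](_ : _ + _ = u z.2 - u z.1)//; ring.
rewrite (nnm_integralD _ n1 n2) (nnm_integralZl _ nv d1) (nnm_integralZl _ nuv d2).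
by apply: leeD => //; rewrite EFinM; apply: lee_wpmul2l.
Qed.

(** Both sides are compared with their common value at [w_n] by the weighted square inequality with
    [d = 2 ^ (- n)]. The jump formula is used only for continuous functions. *)
Lemma approximated_jump_form : (\int[J0]_z sqdiff w z = (2 * Ef w w)%:E)%E.
Proof.
pose I := (\int[J0]_z sqdiff w z)%E.
have I0 : (0 <= I)%E by apply: integral_ge0 => z _; rewrite lee_fin sqr_ge0.
have four n : (4 ^+ n)^-1 = ((2 ^+ n)^-1) ^+ 2 :> R.
  by rewrite exprVn -exprM mulnC exprM (_ : 2 ^+ 2 = 4)//; ring.
have dn0 n : 0 < (2 ^+ n)^-1 :> R by rewrite invr_gt0 exprn_gt0.
have dn1 n : (2 ^+ n)^-1 <= 1 :> R.
  by rewrite invf_le1 ?exprn_gt0// exprn_ege1// ler1n.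
have c0 n : 0 <= 8 * (4 ^+ n)^-1 :> R by rewrite mulr_ge0// invr_ge0 exprn_ge0.
have up n := sqdiff_integral_le (dn0 n) (c0 n) bw (bw_ n) (jump_form_tail n).
have dwn n : (\int[J0]_z sqdiff (w_ n) z = (2 * Ef (w_ n) (w_ n))%:E)%E.
  exact: jump_form_continuous (Dw_ n) (Cw_ n).1.
have tail' n : (\int[J0]_z sqdiff (fun x => w_ n x - w x)%R z <= (8 * (4 ^+ n)^-1)%:E)%E.
  apply: le_trans (jump_form_tail n); rewrite le_eqVlt; apply/orP; left; apply/eqP.
  by apply: eq_integral => z _; rewrite /sqdiff; congr (_%:E); ring.
have down n := sqdiff_integral_le (dn0 n) (c0 n) (bw_ n) bw (tail' n).
have fI : I \is a fin_num.
  rewrite ge0_fin_numE//; apply: le_lt_trans (up 0%N) _.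
  by rewrite dwn -EFinM -EFinD ltry.
have [r rE] : exists r, I = r%:E by exists (fine I); rewrite fineK.
have r0 : 0 <= r by rewrite -lee_fin -rE.
have Ew0 : 0 <= 2 * Ef w w by rewrite mulr_ge0// (form_ge0 df).
have chain n : r <= 2 * Ef w w + (2 ^+ n)^-1 * (3 * (2 * Ef w w) + 24) /\
    2 * Ef w w <= r + (2 ^+ n)^-1 * (3 * r + 36).
  apply: (@dyadic_chain _ _ _ (2 * Ef (w_ n) (w_ n))) => //.
  - have := up n; rewrite -/I rE dwn -EFinM -EFinD lee_fin four; exact.
  - have := down n; rewrite -/I rE dwn -EFinM -EFinD lee_fin four; exact.
  - have := form_weighted_le (dn0 n) (Dw_ n) Dw; rewrite invrK.
    have -> : Ef (fun x => w_ n x - w x) (fun x => w_ n x - w x) =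
        Ef (fun x => w x - w_ n x) (fun x => w x - w_ n x).
      by rewrite !form_sub// (form_sym df (Dw_ n) Dw); ring.
    have := (close n).1; rewrite four.
    have p0 : 0 <= 1 + 2 ^+ n :> R by rewrite addr_ge0// exprn_ge0.
    move=> h1 h2; have := ler_wpM2l p0 h1; move: h2.
    by move: (Ef _ _) (Ef _ _) (Ef _ _) ((2 ^+ n)^-1 ^+ 2) => A B C' Q; lra.
  - have := form_weighted_le (dn0 n) Dw (Dw_ n); rewrite invrK.
    have := (close n).1; rewrite four.
    have p0 : 0 <= 1 + 2 ^+ n :> R by rewrite addr_ge0// exprn_ge0.
    move=> h1 h2; have := ler_wpM2l p0 h1; move: h2.
    by move: (Ef _ _) (Ef _ _) (Ef _ _) ((2 ^+ n)^-1 ^+ 2) => A B C' Q; lra.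
rewrite -/I rE; congr (_%:E); apply/eqP; rewrite eq_le.
by rewrite (le_of_dyadic (fun n => (chain n).1)) (le_of_dyadic (fun n => (chain n).2)).
Qed.

End Approximation.

Lemma jump_form w : D w -> bint m w -> (\int[J0]_z sqdiff w z = (2 * Ef w w)%:E)%E.
Proof.
move=> Dw bw.
have ex n : exists v, [/\ D v, Cc (v : E -> R) &
    E1 m Ef (fun x => w x - v x) (fun x => w x - v x) < (4 ^+ n)^-1].
  have e0 : 0 < (4 ^+ n)^-1 :> R by rewrite invr_gt0 exprn_gt0.
  by have [v [Dv Cv] h] := regular_E1 rf Dw e0; exists v.
have [w_ h] := choice ex.
apply: (@approximated_jump_form w w_) => // n; first by have [] := h n.
  by have [] := h n.
by have [] := h n.
Qed.

(** Polarization arranged as [(a + b) ^ 2 = 4 a b + (a - b) ^ 2], where all integrands are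
    nonnegative. The total is finite, which excludes an infinite integral of the product. *)
Lemma jump_form_product u v : D u -> D v -> bint m u -> bint m v ->
  (forall x y, 0 <= (u y - u x) * (v y - v x)) ->
  (\int[J0]_z ((u z.2 - u z.1) * (v z.2 - v z.1))%:E = (2 * Ef u v)%:E)%E.
Proof.
move=> Du Dv bu bv uv0.
have mu := bint_measurable bu; have mv := bint_measurable bv.
have np : nnm (fun z : T * T => ((u z.2 - u z.1) * (v z.2 - v z.1))%:E).
  split; last by move=> z; rewrite lee_fin uv0.
  by apply/measurable_EFinP; apply: measurable_funM; apply: measurable_funB;
    apply: (measurableT_comp (f := _)) => //; exact: measurable_fst || exact: measurable_snd.
have ns := nnm_sqdiff (bint_measurable (bintB bu bv)).
have e4 : (0 <= 4%:E :> \bar R)%E by rewrite lee_fin.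
have n4 : nnm (fun z : T * T => 4%:E * ((u z.2 - u z.1) * (v z.2 - v z.1))%:E)%E.
  by apply: nnmM => //; exact: nnm_cst.
have := jump_form (form_Dadd Du Dv) (bintD bu bv).
rewrite (_ : (\int[J0]_z _) = (\int[J0]_z (4%:E * ((u z.2 - u z.1) * (v z.2 - v z.1))%:E +
    sqdiff (fun x => u x - v x)%R z)))%E; last first.
  by apply: eq_integral => z _; rewrite /sqdiff -EFinM -EFinD; congr (_%:E); ring.
rewrite (nnm_integralD _ n4 ns) (nnm_integralZl _ np e4).
rewrite (jump_form (form_Dsub Du Dv) (bintB bu bv)) (form_sub Du Dv) (form_add Du Dv).
case: (\int[J0]_z _)%E => [r| |].
- by rewrite -EFinM -EFinD => -[h]; congr (_%:E); lra.
- by rewrite gt0_muley ?lte_fin.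
- by rewrite gt0_muleNy ?lte_fin.
Qed.

End EnergyIdentity.

Section SigmaFinitePack.
Context {d : measure_display} {T : measurableType d} {R : realType}.

(** An alias whose argument [sf] lets the same measure carry the sigma-finite structure. *)
Definition sigma_finite_copy (m : {measure set T -> \bar R})
  (sf : sigma_finite [set: T] m) : set T -> \bar R := m.

Section Instances.
Variables (m : {measure set T -> \bar R}) (sf : sigma_finite [set: T] m).
HB.instance Definition _ := Measure.on (sigma_finite_copy sf).
HB.instance Definition _ :=
  Measure_isSigmaFinite.Build _ T R (sigma_finite_copy sf) sf.
End Instances.

Lemma sigma_finite_pack (m : {measure set T -> \bar R}) : sigma_finite [set: T] m ->
  exists mS : {sigma_finite_measure set T -> \bar R}, m = mS :> {measure set T -> \bar R}.
Proof.
move=> sf; exists [the {sigma_finite_measure set T -> \bar R} of sigma_finite_copy sf].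
exact: eq_measure.
Qed.

Lemma measurable_chi (a b : T -> R) :
  measurable_fun [set: T] a -> measurable_fun [set: T] b ->
  measurable_fun [set: T] (fun z => chi (a z) (b z)).
Proof.
move=> ma mb; have na : measurable_fun [set: T] (fun z => `|a z|) by exact: measurableT_comp.
have nb : measurable_fun [set: T] (fun z => `|b z|) by exact: measurableT_comp.
apply: measurable_fun_ifT; [exact: measurable_fun_ltr|exact: measurable_cst|].
by apply: measurable_fun_ifT; [exact: measurable_fun_eqr|exact: measurable_cst..].
Qed.

Lemma bint_Lfun2 (m : {measure set T -> \bar R}) (u : T -> R) :
  bint m u -> u \in Lfun m 2%:E.
Proof.
move=> bu; rewrite inE; apply/andP; split.
  by rewrite inE/=; exact: bint_measurable bu.
rewrite inE/= /finite_norm unlock; apply: poweR_lty.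
rewrite (_ : (\int[m]_x _) = (dot m u u)%:E)%E ?ltry// EFin_dot//.
by apply: eq_integral => x _; rewrite -[(EFin \o u) x]/((u x)%:E) abse_EFin poweR_EFin powR_mulrn// -normrX expr2 ger0_norm// -expr2 sqr_ge0.
Qed.

End SigmaFinitePack.

(** * The Dirichlet form and the approximate energies *)

Section FormOfSemigroup.
Context {R : realType} {E : pmetricType R} {d : measure_display}
  {Omega : measurableType d}.
Local Notation T := (borel E).
Variables (P : cemetery E -> probability Omega R) (X : R -> Omega -> cemetery E).
Hypothesis hp : hunt_process P X.
Variable k : R -> T -> {measure set T -> \bar R}.
Hypothesis kE : forall t x B, measurable B ->
  k t x B = P (Some x) (X (Num.max t 0) @^-1` (Some @` B)).
Variable m : {measure set T -> \bar R}.
Hypothesis kP : symmetric_semigroup m k.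
Variables (D : set (T -> R)) (Ef : (T -> R) -> (T -> R) -> R).
Hypothesis assoc : associated P X m D Ef.
Implicit Types u v : T -> R.

Lemma approximate_form u v : bint m u -> bint m v ->
  \forall t \near (0 : R)^'+, t^-1 * l2dot m (fun x => u x - semigroup P X t u x) v =
    t^-1 * (dot m u v - dot m (psg k t u) v).
Proof.
move=> bu bv; near=> t; have t0 : 0 <= t by near: t; exact: nbhs_right_ge.
congr (_ * _); rewrite -(dotBl bu (bint_psg kP t0 bu) bv) dotE /l2dot.
apply: eq_Rintegral => x _; rewrite (semigroup_psg hp kE x t0)//.
exact: bint_measurable bu.
Unshelve. all: by end_near. Qed.

Lemma form_domain_D u : form_domain m k u -> D u.
Proof.
move=> fu; have bu := fu.1; apply/(assoc.1 u (bint_Lfun2 bu)).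
have /cvg_ex[l hl] := form_domain_cvg kP fu; apply/cvg_ex; exists l.
apply: cvg_trans hl; apply: near_eq_cvg.
apply: filterS (approximate_form bu bu) => t ->.
by rewrite /gap (dotC _ u (psg k t u)).
Qed.

Lemma form_domain_form u v : form_domain m k u -> form_domain m k v ->
  t^-1 * (dot m u v - dot m (psg k t u) v) @[t --> 0^'+] --> Ef u v.
Proof.
move=> fu fv; have := assoc.2 u v (form_domain_D fu) (form_domain_D fv).
apply: cvg_trans; apply: near_eq_cvg.
by apply: filterS (approximate_form fu.1 fv.1) => t ->.
Qed.

End FormOfSemigroup.

(** * The L^p bound for the square function of the Hunt process *)

Theorem theorem4p2 (R : realType) (p : R) :
  1 < p -> p <= 2 ->
  exists2 C : R, 0 < C &
  forall (E : pmetricType R) (m : {measure set (borel E) -> \bar R})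
    (D : set (borel E -> R)) (Ef : (borel E -> R) -> (borel E -> R) -> R)
    (J : {measure set (borel E * borel E) -> \bar R})
    (K : R.-ker (borel E) ~> (borel E))
    (d : measure_display) (Omega : measurableType d)
    (P : cemetery E -> probability Omega R) (X : R -> Omega -> cemetery E),
  locally_compact [set: E] -> separable E ->
  radon m -> full_support m ->
  dirichlet_form m D Ef -> regular_form m D Ef ->
  jumping_measure J -> has_kernel m J K -> pure_jump m D Ef J ->
  hunt_process P X -> symmetric_process P X m -> associated P X m D Ef ->
  forall f : borel E -> R, f \in Lfun m p%:E ->
  ('N[m]_p%:E[square_function P X K f] <= C%:E * 'N[m]_p%:E[EFin \o f])%E.
Proof.
move=> p1 p2; have p0 : 0 < p by exact: lt_trans p1.
pose c := maximal_cst p + 2 / (p - 1) / p.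
have c0 : 0 < c.
  by rewrite addr_gt0 ?maximal_cst_gt0// divr_gt0// divr_gt0// subr_gt0.
(* The constant [c] compares the integrals of [p]-th powers; norms require its [p]-th root. *)
exists (c `^ p^-1); first exact: powR_gt0.
move=> E m D Ef J K d Omega P X lcE sepE rm _ df rf jm hk pj hp sym assoc f fL.
have [s sP] := dense_sequence sepE.
have mdiag : measurable (~` @diagE R E).
  by apply: measurableC; exact: (measurable_diagE lcE sP).
have [mS mE] := sigma_finite_pack (radon_sigma_finite lcE sP rm); subst m.
have [k kE] := transition_kernel_ex hp.
have kP := transition_symmetric_semigroup hp kE sym.
have [N NK] := off_diagonal_kernel_ex sepE lcE jm hk.
pose J0 := [the {measure set (borel E * borel E) -> \bar R} of mrestr J mdiag].
have J0E F : nnm F -> (\int[J0]_z F z = \int[J]_(z in ~` diagE) F z)%E.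
  exact: nnm_integral_restr.
have J0null B : measurable B -> mS B = 0%E ->
    J0 ([set: borel E] `*` B) = 0%E /\ J0 (B `*` [set: borel E]) = 0%E.
  exact: (jump_null sepE lcE jm hk).
have energy u v : form_domain mS k u -> form_domain mS k v ->
    (forall x y, 0 <= (u y - u x) * (v y - v x)) ->
    exists2 l : R, t^-1 * (dot mS u v - dot mS (psg k t u) v) @[t --> 0^'+] --> l &
      ((2^-1)%:E * \int[mS]_x \int[N x]_y ((u y - u x) * (v y - v x))%:E <= l%:E)%E.
  (* The limit is the form itself. The jump integral of the product is [2 Ef u v], and integration
     against [N] does not exceed it, so that the factor one half gives the bound. *)
  move=> fu fv uv0; exists (Ef u v); first exact: (form_domain_form hp kE kP assoc fu fv).
  have Du := form_domain_D hp kE kP assoc fu.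
  have Dv := form_domain_D hp kE kP assoc fv.
  have prod := jump_form_product J0E J0null rm df rf pj Du Dv fu.1 fv.1 uv0.
  have mu := bint_measurable fu.1; have mv := bint_measurable fv.1.
  have nF : nnm (fun z : borel E * borel E => ((u z.2 - u z.1) * (v z.2 - v z.1))%:E).
    split; last by move=> z; rewrite lee_fin uv0.
    apply/measurable_EFinP; apply: measurable_funM; apply: measurable_funB.
    - exact: measurableT_comp mu measurable_snd.
    - exact: measurableT_comp mu measurable_fst.
    - exact: measurableT_comp mv measurable_snd.
    - exact: measurableT_comp mv measurable_fst.
  apply: le_trans (lee_wpmul2l _ (sfker_integral_le sepE lcE hk NK nF)) _.
    by rewrite lee_fin invr_ge0.
  by rewrite -J0E// prod -EFinM lee_fin mulrA mulVf// mul1r.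
have null B := sfker_null_respecting sepE lcE jm hk NK (B := B).
have mf : measurable_fun [set: borel E] f by move: fL; rewrite inE => /andP[/set_mem].
have fLp : (\int[mS]_x (`|f x| `^ p)%:E < +oo)%E.
  have /integrableP[_] := Lfun_integrable (ltW p1) fL.
  apply: le_lt_trans; apply: nnm_le_integral.
  - exact: nnm_norm_powR.
  - by split; [apply: measurableT_comp => //; exact: (nnm_norm_powR p mf).1|].
  - by move=> x; exact: lee_abs.
(* The expression under the square root; its power [p / 2] is the [p]-th power of the square
   function. *)
pose S (x : borel E) : \bar R := (\int[lebesgue_measure]_(t in `[0%R, +oo[)
      \int[K x]_(y in ~` [set x])
        ((semigroup P X t f y - semigroup P X t f x) ^+ 2 *
         chi (semigroup P X t f x) (semigroup P X t f y))%:E)%E.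
have dens0 (a b : R) : 0 <= (b - a) ^+ 2 * chi a b.
  by rewrite mulr_ge0 ?sqr_ge0// /chi; case: ifP => // _; case: ifP => // _; rewrite invr_ge0.
have S0 x : (0 <= S x)%E.
  by apply: integral_ge0 => t _; apply: integral_ge0 => y _; rewrite lee_fin.
have Sle : {ae mS, forall x, (S x <= \int[lebesgue_measure]_t (if (0 < t)%R then
    \int[N x]_y ((psg k t f y - psg k t f x) ^+ 2 *
      chi (psg k t f x) (psg k t f y))%:E else 0))%E}.
  apply: filterS (off_diagonal_integral NK) => x Nx.
  rewrite /S integral_mkcond.
  have mP := measurable_psg_joint kP mf.
  pose F (z : (R * borel E) * borel E) : \bar R :=
    ((psg k z.1.1 f z.2 - psg k z.1.1 f z.1.2) ^+ 2 *
     chi (psg k z.1.1 f z.1.2) (psg k z.1.1 f z.2))%:E.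
  have nF : nnm F.
    split; last by move=> z; rewrite lee_fin.
    have m1 : measurable_fun [set: (R * borel E) * borel E] (fun z => psg k z.1.1 f z.1.2).
      exact: (measurableT_comp mP measurable_fst).
    have m2 : measurable_fun [set: (R * borel E) * borel E] (fun z => psg k z.1.1 f z.2).
      apply: (measurableT_comp mP (g := fun z : (R * borel E) * borel E => (z.1.1, z.2))).
      apply: measurable_fun_pair; last exact: measurable_snd.
      exact: (measurableT_comp measurable_fst measurable_fst).
    apply/measurable_EFinP; apply: measurable_funM; last exact: measurable_chi.
    by apply: measurable_funX; exact: measurable_funB.
  have nI := @nnm_integral_sfker _ _ _ R (borel E) (borel E) R N F nF.
  have nt : nnm (fun t : measurableTypeR R => if (0 < t)%R then
      (\int[N x]_y F ((t, x), y))%E else 0%E).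
    apply: nnm_if; [exact: (@measurable_fun_ltr _ _ _ _ (fun=> 0))| |exact: nnm_cst].
    split; last by move=> t; exact: nI.2 (t, x).
    exact: (measurableT_comp nI.1 (measurable_pair2 x)).
  apply: integral_le_nnm => //.
  - move=> t; rewrite /patch; case: ifP => // _.
    by apply: integral_ge0 => y _; rewrite lee_fin.
  (* The time integral in [S] includes [t = 0], while the majorant vanishes there; this single time
     is negligible. *)
  exists [set 0]; split; [exact: measurable_set1|exact: lebesgue_measure_set1|].
  move=> t /=; apply: contra_notP => t0.
  rewrite /patch mem_setE in_itv/= andbT; case: ifPn => [t0'|]; last first.
    by rewrite -ltNge => t0'; rewrite ltNge (ltW t0').
  have t0'' : 0 < t by rewrite lt_neqAle t0' andbT eq_sym; apply/eqP.
  rewrite t0'' -Nx.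
    rewrite le_eqVlt; apply/orP; left; apply/eqP; apply: eq_integral => y _.
    by rewrite !(semigroup_psg hp kE _ t0').
  under eq_fun do rewrite !(semigroup_psg hp kE _ t0')//.
  split; last by move=> y; rewrite lee_fin.
  exact: (measurableT_comp nF.1 (measurable_pair1 (t, x))).
have main := lp_square_function kP energy null p1 p2 mf fLp S0 Sle.
rewrite unlock.
have -> : (\int[mS]_x (`|square_function P X K f x| `^ p) =
    \int[mS]_x (S x `^ (p / 2)))%E.
  apply: eq_integral => x _; rewrite gee0_abs ?poweR_ge0// /square_function -/(S x).
  by rewrite -poweRrM mulrC.
have -> : (\int[mS]_x (`|(EFin \o f) x| `^ p) = \int[mS]_x (`|f x| `^ p)%:E)%E.
  by apply: eq_integral => x _.
have ip0 : 0 <= p^-1 by rewrite invr_ge0 ltW.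
apply: le_trans (ge0_le_poweR ip0 _ main) _.
  by apply: integral_ge0 => x _; exact: poweR_ge0.
rewrite poweRM ?lee_fin ?(ltW c0)//.
by apply: integral_ge0 => x _; rewrite lee_fin powR_ge0.
Qed.
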